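(* Let $Q\subset\mathbf{R}^n$ be a closed set, let $\mathcal A$ be a $C^2$-stratification of $Q$ of depth $m$, and let $f:\mathbf{R}^n\to\mathbf{R}$ and $\varepsilon:\mathbf{R}^n\to(0,\infty)$ be continuous functions. Let $V_1$ be any neighborhood of the support of $f$, and let $V_2$ be any neighborhood of the set $\bigcup_{M\in\mathcal A,\ \dim M<n}M$. Then there exists a function $g:\mathbf{R}^n\to\mathbf{R}$ satisfying all of the following properties. (1) Uniform closeness: $|f(x)-g(x)|<\varepsilon(x)$ for all $x\in\mathbf{R}^n$. (2) Differentiability and Lipschitzness: $g$ is locally Lipschitz continuous and differentiable on $\mathbf{R}^n$. Moreover, if $f$ is Lipschitz continuous, then so is $g$, and $\operatorname{lip} g\le 11^{m+1}\operatorname{lip} f$. (3) Tangency condition: for every stratum $M\in\mathcal A$ and every point $x\in M$, one has $\nabla g(x)\in T_xM$. (4) Support: the support of $g$ is contained in $V_1$. (5) Agreement on full-dimensional strata: if $f$ is $C^1$-smooth, then $g$ coincides with $f$ outside of $V_2$. If $\mathcal A$ is in addition Whitney (a)-regular, then $g$ may be chosen so that, in addition to properties (1)–(5), $g$ is $C^1$-smooth.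
   Context: $|\cdot|$ is the Euclidean norm. For $f:Q\to\mathbf R$ with $Q\subset\mathbf R^n$, $\operatorname{lip} f:=\sup_{x\neq y\in Q}\frac{|f(x)-f(y)|}{|x-y|}$; $f$ is Lipschitz continuous if $\operatorname{lip} f<\infty$, and locally Lipschitz continuous if each point of $Q$ has a neighborhood $U$ such that $f|_{Q\cap U}$ is Lipschitz continuous. Here $p\in\{1,2,\ldots,\infty\}$. A set $M\subset\mathbf{R}^n$ is a $C^p$ manifold of dimension $r$ if each $\bar x\in M$ has an open neighborhood $U$ with $M\cap U=F^{-1}(0)$ for some $C^p$-smooth map $F:U\to\mathbf{R}^{n-r}$ whose derivative at $\bar x$ has full rank. $T_xM$ and $N_xM$ denote the tangent and normal spaces of $M$ at $x$, regarded as linear subspaces of $\mathbf{R}^n$. A $C^p$-stratification $\mathcal A$ of a set $Q\subset\mathbf{R}^n$ is a partition of $Q$ into finitely many nonempty $C^p$ manifolds (not necessarily connected), called strata, satisfying the frontier condition: for any two distinct strata $L$ and $M$, if $L\cap \operatorname{cl}M\neq\emptyset$ then $L\subset(\operatorname{cl}M)\setminus M$. It is Whitney (a)-regular if, for any strata $L,M$, whenever points $x_k\in M$ converge to $\bar x\in L$ and vectors $v_k\in N_{x_k}M$ converge to a vector $v$, one has $v\in N_{\bar x}L$. The strict partial order $\prec$ on $\mathcal A$ is defined by $L\prec M\iff L\subset(\operatorname{cl}M)\setminus M$. The depth of $\mathcal A$ is the maximal integer $m$ such that there exist strata $M_1\prec M_2\prec\cdots\prec M_m$. *)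

(* Defs.v *)
From mathcomp Require Import all_boot all_order all_algebra.
From mathcomp Require Import all_classical all_reals all_analysis.

Set Implicit Arguments.
Unset Strict Implicit.
Unset Printing Implicit Defensive.

Import Order.TTheory GRing.Theory Num.Theory.
Import numFieldNormedType.Exports.

Local Open Scope classical_set_scope.
Local Open Scope ring_scope.

(* R^n is ['rV[R]_n].  Its canonical norm in the library is the sup norm; this
   only matters for [lip], which uses the Euclidean norm [enorm], since the
   topology and differentiability do not depend on the norm. *)

Definition dot (R : realType) (n : nat) (x y : 'rV[R]_n) : R :=
  \sum_(i < n) x 0 i * y 0 i.

Definition enorm (R : realType) (n : nat) (x : 'rV[R]_n) : R :=
  Num.sqrt (dot x x).

(* The supremum is taken in [0, +oo], so that it is 0 when Q has at most one
   point; this is the role of the element 0. *)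
Definition lip (R : realType) (n : nat) (Q : set 'rV[R]_n)
    (f : 'rV[R]_n -> R) : \bar R :=
  ereal_sup (0%E |` [set t | exists x y, [/\ Q x, Q y, x <> y &
                       t = (`|f x - f y| / enorm (x - y))%:E]]).

Definition lipschitz_continuous (R : realType) (n : nat) (Q : set 'rV[R]_n)
    (f : 'rV[R]_n -> R) : Prop :=
  (lip Q f < +oo)%E.

Definition locally_lipschitz_continuous (R : realType) (n : nat)
    (Q : set 'rV[R]_n) (f : 'rV[R]_n -> R) : Prop :=
  forall x, Q x -> exists2 U, nbhs x U & lipschitz_continuous (Q `&` U) f.

Definition supp (R : realType) (n : nat) (f : 'rV[R]_n -> R) :
    set 'rV[R]_n :=
  closure [set x | f x != 0].

Definition gradient (R : realType) (n : nat) (f : 'rV[R]_n -> R)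
    (x : 'rV[R]_n) : 'rV[R]_n :=
  \row_(i < n) 'D_(delta_mx 0 i) f x.

(* [smooth_on p U f]: f is C^p on the open set U.  Functions are total; when U
   is open, the values of f outside U are irrelevant. *)
Fixpoint smooth_on (R : realType) (V W : normedModType R) (p : nat)
    (U : set V) (f : V -> W) : Prop :=
  if p is p'.+1 then
    (forall x, U x -> differentiable f x) /\
    (forall v : V, smooth_on p' U (fun x => 'D_v f x))
  else forall x, U x -> {for x, continuous f}.

(* [local_equation p M x U F]: near x, the set M is {F = 0} with F a C^p map
   from the open neighborhood U of x to R^k whose derivative at x has full
   rank.  The jacobian of the library acts on row vectors on the right. *)
Definition local_equation (R : realType) (n k p : nat) (M : set 'rV[R]_n)
    (x : 'rV[R]_n) (U : set 'rV[R]_n) (F : 'rV[R]_n -> 'rV[R]_k) : Prop :=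
  [/\ open_nbhs x U, smooth_on p U F,
      M `&` U = [set y | U y /\ F y = 0] &
      \rank (jacobian F x) = k].

Definition manifold (R : realType) (n p r : nat) (M : set 'rV[R]_n) : Prop :=
  (r <= n)%N /\
  forall x, M x -> exists U (F : 'rV[R]_n -> 'rV[R]_(n - r)),
    local_equation p M x U F.

(* The tangent space is the kernel of the derivative of a local equation; it
   does not depend on the choice of this equation. *)
Definition tangent (R : realType) (n : nat) (M : set 'rV[R]_n)
    (x : 'rV[R]_n) : set 'rV[R]_n :=
  [set v | exists r U (F : 'rV[R]_n -> 'rV[R]_(n - r)),
     [/\ (r <= n)%N, local_equation 1 M x U F & 'd F x v = 0]].

Definition normal (R : realType) (n : nat) (M : set 'rV[R]_n)
    (x : 'rV[R]_n) : set 'rV[R]_n :=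
  [set w | forall v, tangent M x v -> dot w v = 0].

Definition prec (R : realType) (n : nat) (L M : set 'rV[R]_n) : Prop :=
  L `<=` closure M `\` M.

(* [partition A id Q] includes the nonemptiness of the members of A. *)
Definition stratification (R : realType) (n p : nat) (Q : set 'rV[R]_n)
    (A : set (set 'rV[R]_n)) : Prop :=
  [/\ finite_set A,
      partition A id Q,
      forall M, A M -> exists r, manifold p r M &
      forall L M, A L -> A M -> L <> M -> L `&` closure M !=set0 -> prec L M].

Definition whitney_a (R : realType) (n : nat) (A : set (set 'rV[R]_n)) : Prop :=
  forall (L M : set 'rV[R]_n) (x v : nat -> 'rV[R]_n) (x0 v0 : 'rV[R]_n),
    A L -> A M -> (forall k, M (x k)) -> L x0 -> x @ \oo --> x0 ->
    (forall k, normal M (x k) (v k)) -> v @ \oo --> v0 ->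
    normal L x0 v0.

Definition has_chain (R : realType) (n : nat) (A : set (set 'rV[R]_n))
    (m : nat) : Prop :=
  exists2 c : 'I_m -> set 'rV[R]_n, (forall i, A (c i)) &
    forall i j : 'I_m, j = i.+1 :> nat -> prec (c i) (c j).

(* The empty chain is allowed: the depth is 0 when A is empty. *)
Definition depth (R : realType) (n : nat) (A : set (set 'rV[R]_n))
    (m : nat) : Prop :=
  has_chain A m /\ forall k, has_chain A k -> (k <= m)%N.

Definition low_dim_part (R : realType) (n p : nat)
    (A : set (set 'rV[R]_n)) : set 'rV[R]_n :=
  \bigcup_(M in [set M | A M /\ exists2 r, (r < n)%N & manifold p r M]) M.

Definition good_approximation (R : realType) (n m : nat)
    (A : set (set 'rV[R]_n)) (f eps : 'rV[R]_n -> R) (V1 V2 : set 'rV[R]_n)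
    (g : 'rV[R]_n -> R) : Prop :=
  [/\ forall x, `|f x - g x| < eps x,
      [/\ locally_lipschitz_continuous setT g,
          forall x, differentiable g x &
          lipschitz_continuous setT f ->
            lipschitz_continuous setT g /\
            (lip setT g <= (11 ^+ m.+1)%:E * lip setT f)%E],
      forall M, A M -> forall x, M x -> tangent M x (gradient g x),
      supp g `<=` V1 &
      smooth_on 1 setT f -> forall x, ~ V2 x -> g x = f x].

(* Main.v *)
Require Import Defs.
From mathcomp Require Import all_boot all_order all_algebra.
From mathcomp Require Import all_classical all_reals all_analysis.
From mathcomp Require finmap.
From mathcomp Require Import ring lra.
Import Order.TTheory GRing.Theory Num.Theory.
Import numFieldNormedType.Exports.
Local Open Scope classical_set_scope.
Local Open Scope ring_scope.
Set Implicit Arguments.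
Unset Strict Implicit.
Unset Printing Implicit Defensive.

(* The approximation is g = h o r_1 o ... o r_N, where h is a C^1 approximation of f and r_k is a
   map of R^n attached to the k-th stratum, the strata being listed so that each one follows the
   strata in its frontier.  The map r_k is the identity on the earlier strata, to which it is
   tangent to second order; on its stratum M its derivative is the orthogonal projection onto
   the tangent space, so the chain rule makes the gradient tangent to M without spoiling what was
   achieved on the earlier strata.

   In place of the nearest point projection, r_k(x) = x - chi(x) w(x), where w is a partition of
   unity average of the Newton steps F (J^T J)^-1 J^T of local equations F of M: near M these
   are C^1 and approximately equal to the normal displacement.  The cutoff chi is a function
   of the logarithm of the distance to M, so that the term (grad chi) w is as small as desired.
   Hence r_k has Lipschitz constant arbitrarily close to 1, and the strata can be treated one at
   a time whatever the depth: a total factor of 11 is enough.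

   Under Whitney's condition (a) the normal part of the gradient of the current approximation
   tends to 0 along M at points of the earlier strata, so composing with r_k preserves C^1. *)

(** * The Euclidean norm *)

(** [M] may accumulate on the union [B] of the earlier strata, so the retraction has to be
    controlled up to [B]. Bounding its displacement by the square of the distance to [B] gives it
    the identity as derivative at points of [B], but this derivative is in general discontinuous
    there: at points of [M] arbitrarily close to [B] normal components are still erased. Hence mere
    differentiability without condition (a). The cutoff is what threatens the Lipschitz constant.
    Near [M] the step [w] has the size of the distance to [M], while an ordinary cutoff on that
    scale has a gradient of the order of the inverse distance, so that their product would cost a
    fixed factor for each stratum. The order of the strata makes both [B] and its union with [M]
    closed at every stage, so the distances to them vanish only on them. Newton steps involve first
    derivatives of the equations, so C^2 strata yield C^1 steps. The smooth start costs a factor at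
    most 2, and each composition moves the current factor to its midpoint with 11, so 11 is never
    reached. *)

Section euclidean.
Context {R : realType} {n : nat}.
Implicit Types (x y z u v : 'rV[R]_n) (a r s : R).

Lemma dot_mx x y : dot x y = (x *m y^T) 0 0.
Proof. by rewrite mxE; apply: eq_bigr => i _; rewrite mxE. Qed.

Lemma dotC x y : dot x y = dot y x.
Proof. by apply: eq_bigr => i _; rewrite mulrC. Qed.

Lemma dotDl x y z : dot (x + y) z = dot x z + dot y z.
Proof. by rewrite !dot_mx mulmxDl mxE. Qed.

Lemma dotDr x y z : dot x (y + z) = dot x y + dot x z.
Proof. by rewrite dotC dotDl !(dotC x). Qed.

Lemma dotZl a x y : dot (a *: x) y = a * dot x y.
Proof. by rewrite !dot_mx -scalemxAl mxE. Qed.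

Lemma dotZr a x y : dot x (a *: y) = a * dot x y.
Proof. by rewrite dotC dotZl dotC. Qed.

Lemma dotNl x y : dot (- x) y = - dot x y.
Proof. by rewrite -scaleN1r dotZl mulN1r. Qed.

Lemma dotNr x y : dot x (- y) = - dot x y.
Proof. by rewrite dotC dotNl dotC. Qed.

Lemma dotBl x y z : dot (x - y) z = dot x z - dot y z.
Proof. by rewrite dotDl dotNl. Qed.

Lemma dotBr x y z : dot x (y - z) = dot x y - dot x z.
Proof. by rewrite dotDr dotNr. Qed.

Lemma dot0l x : dot 0 x = 0.
Proof. by rewrite -(scale0r 0) dotZl mul0r. Qed.

Lemma dot0r x : dot x 0 = 0.
Proof. by rewrite dotC dot0l. Qed.

Lemma dot_deltal i x : dot (delta_mx 0 i) x = x 0 i.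
Proof.
rewrite /dot (bigD1 i)//= big1 ?addr0 => [|j ji]; first by rewrite mxE !eqxx mul1r.
by rewrite mxE (negPf ji) andbF mul0r.
Qed.

Lemma dotxx_ge0 x : 0 <= dot x x.
Proof. by apply: sumr_ge0 => i _; rewrite -expr2 sqr_ge0. Qed.

Lemma enorm_ge0 x : 0 <= enorm x.
Proof. exact: sqrtr_ge0. Qed.

Lemma sqr_enorm x : enorm x ^+ 2 = dot x x.
Proof. by rewrite sqr_sqrtr// dotxx_ge0. Qed.

Lemma enorm0 : enorm (0 : 'rV[R]_n) = 0.
Proof. by rewrite /enorm dot0l sqrtr0. Qed.

Lemma enormN x : enorm (- x) = enorm x.
Proof. by rewrite /enorm dotNl dotNr opprK. Qed.

Lemma enormC x y : enorm (x - y) = enorm (y - x).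
Proof. by rewrite -enormN opprB. Qed.

Lemma enormZ a x : enorm (a *: x) = `|a| * enorm x.
Proof.
rewrite /enorm dotZl dotZr mulrA -expr2 sqrtrM ?sqr_ge0//.
by rewrite sqrtr_sqr.
Qed.

Lemma coord_le_enorm x i : `|x 0 i| <= enorm x.
Proof.
rewrite -sqrtr_sqr ler_sqrt ?dotxx_ge0// /dot (bigD1 i)//= -expr2 lerDl.
by apply: sumr_ge0 => j _; rewrite -expr2 sqr_ge0.
Qed.

Lemma enorm_eq0 x : (enorm x == 0) = (x == 0).
Proof.
apply/eqP/eqP => [x0|->]; last exact: enorm0.
apply/rowP => i; rewrite mxE; apply/eqP; rewrite -normr_le0 -x0.
exact: coord_le_enorm.
Qed.

Lemma enorm_gt0 x : (0 < enorm x) = (x != 0).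
Proof. by rewrite lt_def enorm_ge0 andbT enorm_eq0. Qed.

Lemma norm_le_enorm x : `|x| <= enorm x.
Proof.
rewrite [leLHS]/Num.Def.normr/= mx_normrE bigmax_le ?enorm_ge0// => -[i j] _ /=.
by rewrite (ord1 i) coord_le_enorm.
Qed.

Lemma coord_le_norm x i : `|x 0 i| <= `|x|.
Proof.
rewrite [leRHS]/Num.Def.normr/= mx_normrE.
exact: (le_bigmax _ (fun ij : 'I_1 * 'I_n => `|x ij.1 ij.2|) (0, i)).
Qed.

(** The factor [n.+1] instead of the optimal square root of [n] stays positive when [n = 0], so that
    radii can be divided by it. *)
Lemma enorm_le_norm x : enorm x <= n.+1%:R * `|x|.
Proof.
have h : 0 <= n.+1%:R * `|x| by rewrite mulr_ge0.
rewrite -(ger0_norm h) -sqrtr_sqr ler_sqrt ?sqr_ge0// exprMn.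
apply: (@le_trans _ _ (n%:R * `|x| ^+ 2)).
  rewrite /dot -[n in n%:R]card_ord -sumr_const mulr_suml.
  apply: ler_sum => i _; rewrite mul1r -expr2 -[leLHS]ger0_norm ?sqr_ge0//.
  by rewrite normrX lerXn2r ?nnegrE// coord_le_norm.
rewrite ler_wpM2r ?sqr_ge0// -natrX ler_nat.
by rewrite (leq_trans (leqnSn n))// leq_pmulr.
Qed.

(** Cauchy-Schwarz: expand the square of [dot y y *: x - dot x y *: y], which is nonnegative, and
    divide by [dot y y]. *)
Lemma normr_dot_le x y : `|dot x y| <= enorm x * enorm y.
Proof.
have [->|y0] := eqVneq y 0; first by rewrite dot0r normr0 enorm0 mulr0.
have y1 : 0 < enorm y by rewrite enorm_gt0.
have h : 0 <= enorm x * enorm y by rewrite mulr_ge0 ?enorm_ge0.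
rewrite -(ger0_norm h) -ler_sqr ?nnegrE// !real_normK ?num_real// exprMn.
have := dotxx_ge0 (dot y y *: x - dot x y *: y).
rewrite !(dotBl, dotBr, dotZl, dotZr) (dotC y x) !sqr_enorm => h1.
have d0 : 0 < dot y y by rewrite -sqr_enorm exprn_gt0.
by rewrite -(ler_pM2l d0) -subr_ge0; apply: le_trans h1 _; lra.
Qed.

Lemma dot_le_enorm x y : dot x y <= enorm x * enorm y.
Proof. exact: le_trans (ler_norm _) (normr_dot_le x y). Qed.

Lemma ler_enormD x y : enorm (x + y) <= enorm x + enorm y.
Proof.
rewrite -ler_sqr ?nnegrE ?addr_ge0 ?enorm_ge0//.
rewrite sqr_enorm sqrrD !sqr_enorm !(dotDl, dotDr) (dotC y x).
by have := dot_le_enorm x y; lra.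
Qed.

Lemma ler_enormB x y : enorm (x - y) <= enorm x + enorm y.
Proof. by rewrite -[enorm y]enormN ler_enormD. Qed.

Lemma ler_enorm_trans z x y : enorm (x - y) <= enorm (x - z) + enorm (z - y).
Proof. by rewrite -[x - y](subrKA z) ler_enormD. Qed.

Lemma ler_enorm_dist x y : `|enorm x - enorm y| <= enorm (x - y).
Proof.
rewrite ler_norml; apply/andP; split.
  by have := ler_enormD (y - x) x; rewrite subrK enormC; lra.
by have := ler_enormD (x - y) y; rewrite subrK; lra.
Qed.

(** Testing with [v = u] suffices. Vectors known only through their scalar products, such as
    gradients, are bounded in this way. *)
Lemma enorm_le_dot u r : 0 <= r -> (forall v, dot u v <= r * enorm v) -> enorm u <= r.
Proof.
move=> r0 /(_ u); rewrite -sqr_enorm expr2.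
by have [-> //|u0] := eqVneq (enorm u) 0; rewrite ler_pM2r// lt_def u0 enorm_ge0.
Qed.

Definition eball x r := [set y | enorm (y - x) < r].

Lemma eball_center x r : 0 < r -> eball x r x.
Proof. by rewrite /eball/= subrr enorm0. Qed.

(** Equivalence of the sup and Euclidean norms: topological statements can be proved by Euclidean
    estimates. *)
Lemma nbhs_eballP x (A : set 'rV[R]_n) :
  nbhs x A <-> exists2 r, 0 < r & eball x r `<=` A.
Proof.
split.
  move=> /nbhs_ballP[r /= r0 rA]; exists r => // y yr; apply: rA.
  by rewrite -ball_normE/= distrC; exact: le_lt_trans (norm_le_enorm _) yr.
move=> [r r0 rA]; apply/nbhs_ballP; exists (r / n.+1%:R) => /=.
  by rewrite divr_gt0.
move=> y; rewrite -ball_normE/= distrC => yr; apply: rA => /=.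
by apply: le_lt_trans (enorm_le_norm _) _; rewrite mulrC -ltr_pdivlMr.
Qed.

Lemma nbhs_eball x r : 0 < r -> nbhs x (eball x r).
Proof. by move=> r0; apply/nbhs_eballP; exists r. Qed.

Lemma sub_eball x y r s : r + enorm (x - y) <= s -> eball x r `<=` eball y s.
Proof.
move=> h z /= zx; apply: lt_le_trans h.
by apply: le_lt_trans (ler_enorm_trans x _ _) _; rewrite ltrD2r.
Qed.

Lemma open_eball x r : open (eball x r).
Proof.
rewrite openE => y /= yx; apply/nbhs_eballP; exists (r - enorm (y - x)).
  by rewrite subr_gt0.
by apply: sub_eball; lra.
Qed.

Lemma continuous_eballP (W : pseudoMetricType R) (f : 'rV[R]_n -> W) x :
  {for x, continuous f} <->
  forall e, 0 < e -> exists2 r, 0 < r & forall y, enorm (y - x) < r -> ball (f x) e (f y).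
Proof.
split.
  by move=> fx e e0; have /nbhs_eballP := fx _ (nbhsx_ballx (f x) e e0).
move=> h A /nbhs_ballP[e e0 eA]; have [r r0 rf] := h _ e0.
by apply/nbhs_eballP; exists r => // y /rf /eA.
Qed.

Lemma continuousR_eballP (f : 'rV[R]_n -> R) x :
  {for x, continuous f} <->
  forall e, 0 < e -> exists2 r, 0 < r & forall y, enorm (y - x) < r -> `|f y - f x| < e.
Proof.
split.
  move=> /continuous_eballP fx e /fx[r r0 rf]; exists r => // y /rf.
  by rewrite /ball/= distrC.
move=> h; apply/continuous_eballP => e /h[r r0 rf]; exists r => // y /rf.
by rewrite /ball/= distrC.
Qed.

Lemma continuous_enorm_sub c : continuous (fun x => enorm (x - c)).
Proof.
move=> x; apply/continuousR_eballP => e e0; exists e => // y yx.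
apply: le_lt_trans yx; apply: le_trans (ler_enorm_dist _ _) _.
by rewrite opprB addrA subrK.
Qed.

Definition ecball x r := [set y | enorm (y - x) <= r].

Lemma compact_ecball x r : compact (ecball x r).
Proof.
apply: bounded_closed_compact.
  exists (r + enorm x); split; first exact: num_real.
  move=> M rM y /= yx; apply: le_trans (ltW rM).
  apply: le_trans (norm_le_enorm _) _.
  by rewrite -[y in enorm y](subrK x); apply: le_trans (ler_enormD _ _) _; rewrite lerD2r.
rewrite (_ : ecball x r = (fun y => enorm (y - x)) @^-1` [set t | t <= r])//.
by apply: closed_comp; [move=> y _; exact: continuous_enorm_sub|exact: closed_le].
Qed.

End euclidean.

(** * Functions of class C^1 *)

Section near.
Context {R : realType}.

Lemma near_nbhs (T : topologicalType) (x : T) (P : T -> Prop) :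
  (\forall y \near x, P y) -> \forall y \near x, \forall z \near y, P z.
Proof. by move=> /nbhs_interior; apply: filterS. Qed.

Lemma near_all (T : topologicalType) (x : T) (P : T -> Prop) :
  (forall y, P y) -> \forall y \near x, P y.
Proof. exact: nearW. Qed.

Lemma near_forall (I : finType) (T : topologicalType) (x : T) (P : I -> T -> Prop) :
  (forall i, \forall y \near x, P i y) -> \forall y \near x, forall i, P i y.
Proof. exact: filter_forall. Qed.

Lemma near_comp (T S : topologicalType) (r : T -> S) (x : T) (P : S -> Prop) :
  {for x, continuous r} -> (\forall y \near r x, P y) -> \forall y \near x, P (r y).
Proof. by move=> rc; exact: rc. Qed.

Lemma near_eq_continuous (T S : topologicalType) (x : T) (f g : T -> S) :
  (\forall y \near x, f y = g y) -> {for x, continuous f} -> {for x, continuous g}.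
Proof.
move=> fg fx; rewrite /prop_for /continuous_at -(nbhs_singleton fg).
apply: cvg_trans fx; apply: near_eq_cvg.
by apply: filterS fg.
Qed.

Lemma differentiable_epsP (V W : normedModType R) (f : V -> W) (x : V)
    (df : {linear V -> W}) : continuous df ->
  (forall e, 0 < e -> \forall h \near 0, `|f (h + x) - f x - df h| <= e * `|h|) ->
  differentiable f x /\ 'd f x = df :> (V -> W).
Proof.
move=> dfc H.
have E : f \o shift x = cst (f x) + df +o_ (0 : V) id.
  apply/eqaddoP => e e0; have := H e e0; apply: filterS => h /= hh.
  by rewrite -[(_ - _) h]/(f (h + x) - (f x + df h)) opprD addrA.
have D : 'd f x = df :> (V -> W) by apply: diff_unique.
by split => //; apply/diff_locallyP; rewrite D.
Qed.

Lemma differentiable_eps (V W : normedModType R) (f : V -> W) (x : V) :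
  differentiable f x ->
  forall e, 0 < e -> \forall h \near 0, `|f (h + x) - f x - 'd f x h| <= e * `|h|.
Proof.
move=> /diff_locallyP[_ /eqaddoP H] e e0; have := H e e0; apply: filterS => h /= hh.
by apply: le_trans hh; rewrite -[(_ - _) h]/(f (h + x) - (f x + 'd f x h)) opprD addrA.
Qed.

Lemma near_eq_diff (V W : normedModType R) (f g : V -> W) (x : V) :
  (\forall y \near x, f y = g y) -> differentiable f x ->
  differentiable g x /\ 'd g x = 'd f x :> (V -> W).
Proof.
move=> fg df; apply: differentiable_epsP; first exact: diff_continuous.
move=> e e0; near=> h.
rewrite -(nbhs_singleton fg) -(_ : f (h + x) = g (h + x)).
  by near: h; exact: differentiable_eps.
near: h; move: fg; rewrite (near_shift 0) subr0.
exact.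
Unshelve. all: by end_near. Qed.

Lemma near_eq_differentiable (V W : normedModType R) (f g : V -> W) (x : V) :
  (\forall y \near x, f y = g y) -> differentiable f x -> differentiable g x.
Proof. by move=> fg /(near_eq_diff fg)[]. Qed.

End near.

Section derive.
Context {R : realType} {V : normedModType R}.
Implicit Types (f g : V -> R) (x v : V).

Lemma derive_add f g x v : differentiable f x -> differentiable g x ->
  'D_v (fun y => f y + g y) x = 'D_v f x + 'D_v g x.
Proof. by move=> df dg; apply: deriveD; exact: diff_derivable. Qed.

Lemma derive_sub f g x v : differentiable f x -> differentiable g x ->
  'D_v (fun y => f y - g y) x = 'D_v f x - 'D_v g x.
Proof. by move=> df dg; apply: deriveB; exact: diff_derivable. Qed.

Lemma derive_mul f g x v : differentiable f x -> differentiable g x ->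
  'D_v (fun y => f y * g y) x = f x * 'D_v g x + g x * 'D_v f x.
Proof. by move=> df dg; apply: deriveM; exact: diff_derivable. Qed.

Lemma differentiable_bigsum I (s : seq I) (F : I -> V -> R) x :
  (forall i, differentiable (F i) x) -> differentiable (fun y => \sum_(i <- s) F i y) x.
Proof.
move=> dF; elim: s => [|i s IH].
  by under eq_fun do rewrite big_nil; exact: differentiable_cst.
by under eq_fun do rewrite big_cons; exact: differentiableD.
Qed.

Lemma derive_bigsum I (s : seq I) (F : I -> V -> R) x v :
  (forall i, differentiable (F i) x) ->
  'D_v (fun y => \sum_(i <- s) F i y) x = \sum_(i <- s) 'D_v (F i) x.
Proof.
move=> dF; elim: s => [|i s IH].
  by under eq_fun do rewrite big_nil; rewrite derive_cst big_nil.
under eq_fun do rewrite big_cons; rewrite big_cons -IH.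
exact: derive_add (dF i) (differentiable_bigsum s dF).
Qed.

Lemma differentiable_comp1 (phi : R -> R) (dphi : R) f x :
  is_derive (f x) 1 phi dphi -> differentiable f x ->
  differentiable (fun y => phi (f y)) x.
Proof.
move=> [dp _] df; apply: (@differentiable_comp _ _ _ _ f phi) => //.
exact/derivable1_diffP.
Qed.

Lemma derive_comp1 (phi : R -> R) (dphi : R) f x v :
  is_derive (f x) 1 phi dphi -> differentiable f x ->
  'D_v (fun y => phi (f y)) x = dphi * 'D_v f x.
Proof.
move=> [dp dpE] df; have dphi' : differentiable phi (f x) by apply/derivable1_diffP.
rewrite (deriveE _ (differentiable_comp df dphi')) (deriveE _ df).
rewrite (diff_comp df dphi') /= deriv1E//= derive1E dpE.
by rewrite mulrC.
Qed.

(** Pointwise form of C^1: the derivatives exist near [x] but are continuous only at [x]. On an open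
    set this is C^1 ([smooth_on1P]), and it can be proved by cases on the position of the point. *)
Definition c1at f x := (\forall y \near x, differentiable f y) /\
  forall v, {for x, continuous (fun y => 'D_v f y)}.

Lemma c1at_differentiable f x : c1at f x -> differentiable f x.
Proof. by move=> [/nbhs_singleton]. Qed.

Lemma c1at_continuous f x : c1at f x -> {for x, continuous f}.
Proof. by move=> /c1at_differentiable; exact: differentiable_continuous. Qed.

Lemma smooth_on1P (U : set V) f : open U ->
  smooth_on 1 U f <-> forall x, U x -> c1at f x.
Proof.
move=> Uo; split=> [[df cf] x Ux|H].
  split; last by move=> v; exact: cf.
  by apply: filterS (open_nbhs_nbhs (conj Uo Ux)) => y; exact: df.
by split=> [x /H/c1at_differentiable//|v x /H[]].
Qed.

Lemma c1at_near f g x : (\forall y \near x, f y = g y) -> c1at f x -> c1at g x.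
Proof.
move=> fg [df cf]; split.
  apply: filterS2 (near_nbhs fg) df => y.
  exact: near_eq_differentiable.
move=> v; apply: near_eq_continuous (cf v).
by apply: filterS (near_nbhs fg) => y; exact: near_eq_derive.
Qed.

Lemma c1at_cst (a : R) x : c1at (fun=> a) x.
Proof.
split; first by apply: nearW => y; exact: differentiable_cst.
move=> v; apply: (@near_eq_continuous _ _ _ (fun=> 0)); last exact: cvg_cst.
by apply: nearW => y; rewrite derive_cst.
Qed.

Lemma c1atD f g x : c1at f x -> c1at g x -> c1at (fun y => f y + g y) x.
Proof.
move=> [df cf] [dg cg]; split; first by apply: filterS2 df dg => y; exact: differentiableD.
move=> v; apply: (@near_eq_continuous _ _ _ (fun y => 'D_v f y + 'D_v g y)).
  by apply: filterS2 df dg => y dfy dgy; rewrite derive_add.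
by apply: cvgD; [exact: cf|exact: cg].
Qed.

Lemma c1atM f g x : c1at f x -> c1at g x -> c1at (fun y => f y * g y) x.
Proof.
move=> cf' cg'; have [df cf] := cf'; have [dg cg] := cg'.
split; first by apply: filterS2 df dg => y; exact: differentiableM.
move=> v; apply: (@near_eq_continuous _ _ _ (fun y => f y * 'D_v g y + g y * 'D_v f y)).
  by apply: filterS2 df dg => y dfy dgy; rewrite derive_mul.
apply: cvgD; apply: cvgM; [exact: c1at_continuous|exact: cg|exact: c1at_continuous|exact: cf].
Qed.

Lemma c1atN f x : c1at f x -> c1at (fun y => - f y) x.
Proof.
move=> cf; apply: (@c1at_near (fun y => -1 * f y)).
  by apply: nearW => y; rewrite mulN1r.
exact: c1atM (c1at_cst _ _) cf.
Qed.

Lemma c1atB f g x : c1at f x -> c1at g x -> c1at (fun y => f y - g y) x.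
Proof. by move=> cf cg; apply: c1atD cf (c1atN cg). Qed.

Lemma c1at_sum I (s : seq I) (F : I -> V -> R) x :
  (forall i, c1at (F i) x) -> c1at (fun y => \sum_(i <- s) F i y) x.
Proof.
move=> dF; elim: s => [|i s IH].
  by under eq_fun do rewrite big_nil; exact: c1at_cst.
by under eq_fun do rewrite big_cons; exact: c1atD (dF i) IH.
Qed.

Lemma c1at_prod I (s : seq I) (F : I -> V -> R) x :
  (forall i, c1at (F i) x) -> c1at (fun y => \prod_(i <- s) F i y) x.
Proof.
move=> dF; elim: s => [|i s IH].
  by under eq_fun do rewrite big_nil; exact: c1at_cst.
by under eq_fun do rewrite big_cons; exact: c1atM (dF i) IH.
Qed.

Lemma c1at_comp1 (phi dphi : R -> R) f x :
  (\forall t \near f x, is_derive (t : R) (1 : R) phi (dphi t)) -> {for f x, continuous dphi} ->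
  c1at f x -> c1at (fun y => phi (f y)) x.
Proof.
move=> dp cp cf'; have [df cf] := cf'.
have fc := c1at_continuous cf'.
have dpx : \forall y \near x, is_derive (f y) (1 : R) phi (dphi (f y)) by exact: (fc _ dp).
split.
  by apply: filterS2 dpx df => y dpy dfy; exact: differentiable_comp1 dpy dfy.
move=> v; apply: (@near_eq_continuous _ _ _ (fun y => dphi (f y) * 'D_v f y)).
  by apply: filterS2 dpx df => y dpy dfy; rewrite (derive_comp1 _ dpy dfy).
apply: cvgM; last exact: cf.
exact: (@continuous_comp _ _ _ f dphi).
Qed.

Lemma c1atV f x : f x != 0 -> c1at f x -> c1at (fun y => (f y)^-1) x.
Proof.
move=> f0; apply: (@c1at_comp1 GRing.inv (fun t => - t ^- 2)).
  near=> t.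
  have t0 : t != 0 by near: t; apply: open_nbhs_nbhs; split; [exact: open_neq|].
  by apply: is_derive_eq (is_deriveV _ _) _ => //; rewrite /GRing.scale/= mulr1.
apply: continuousN; apply: continuousV; first by rewrite expf_neq0.
exact: exprn_continuous.
Unshelve. all: by end_near. Qed.

End derive.

Section gradient.
Context {R : realType}.

Lemma continuous_row (T : topologicalType) n (F : T -> 'rV[R]_n) x :
  (forall i, {for x, continuous (fun y => F y 0 i)}) -> {for x, continuous F}.
Proof.
move=> H A [P FP PA].
suff : \forall y \near x, forall i, P 0 i (F y 0 i).
  by apply: filterS => y Py; apply: PA => i j; rewrite (ord1 i).
by apply: near_forall => i; apply: H; exact: FP.
Qed.

Lemma continuous_bigsum (T : topologicalType) I (s : seq I) (F : I -> T -> R) x :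
  (forall i, {for x, continuous (F i)}) ->
  {for x, continuous (fun y => \sum_(i <- s) F i y)}.
Proof.
move=> cF; elim: s => [|i s IH].
  apply: (@near_eq_continuous _ _ _ (fun=> 0)); last exact: cst_continuous.
  by apply: near_all => y; rewrite big_nil.
apply: (@near_eq_continuous _ _ _ (fun y => F i y + \sum_(i <- s) F i y)).
  by apply: near_all => y; rewrite big_cons.
by apply: cvgD => //; exact: cF.
Qed.

Lemma continuous_dot (T : topologicalType) n (F G : T -> 'rV[R]_n) x :
  {for x, continuous F} -> {for x, continuous G} ->
  {for x, continuous (fun y => dot (F y) (G y))}.
Proof.
move=> cF cG; rewrite /dot; apply: continuous_bigsum => i; apply: cvgM.
  by apply: (@continuous_comp _ _ _ F (fun v : 'rV[R]_n => v 0 i)) => //; exact: coord_continuous.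
by apply: (@continuous_comp _ _ _ G (fun v : 'rV[R]_n => v 0 i)) => //; exact: coord_continuous.
Qed.

Context {n : nat}.
Implicit Types (f g : 'rV[R]_n -> R) (x v : 'rV[R]_n).

Lemma derive_gradient f x v : differentiable f x -> 'D_v f x = dot v (gradient f x).
Proof.
move=> df; rewrite (deriveE _ df) {1}(row_sum_delta v) linear_sum.
by apply: eq_bigr => i _; rewrite linearZ/= mxE -(deriveE _ df).
Qed.

Lemma gradient_unique f x (G : 'rV[R]_n) :
  (forall v, 'D_v f x = dot v G) -> gradient f x = G.
Proof. by move=> H; apply/rowP => i; rewrite mxE H dot_deltal. Qed.

Lemma enorm_gradient_le f x K : 0 <= K -> differentiable f x ->
  (forall v, 'D_v f x <= K * enorm v) -> enorm (gradient f x) <= K.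
Proof.
move=> K0 df H; apply: enorm_le_dot => // v.
by rewrite dotC -derive_gradient.
Qed.

Lemma derive_le_enorm f x v : differentiable f x ->
  `|'D_v f x| <= enorm (gradient f x) * enorm v.
Proof. by move=> df; rewrite derive_gradient// dotC normr_dot_le. Qed.

Lemma c1at_gradient f x : c1at f x -> {for x, continuous (gradient f)}.
Proof.
move=> [_ cf]; apply: continuous_row => i.
apply: (@near_eq_continuous _ _ _ (fun y => 'D_(delta_mx 0 i) f y)); last exact: cf.
by apply: near_all => y; rewrite mxE.
Qed.

Lemma c1atP f x : (\forall y \near x, differentiable f y) ->
  {for x, continuous (gradient f)} -> c1at f x.
Proof.
move=> df cf; split => // v.
apply: (@near_eq_continuous _ _ _ (fun y => dot v (gradient f y))).
  by apply: filterS df => y dfy; rewrite derive_gradient.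
by apply: continuous_dot => //; exact: cst_continuous.
Qed.

Lemma near_eq_gradient f g x : (\forall y \near x, f y = g y) ->
  gradient f x = gradient g x.
Proof. by move=> fg; apply/rowP => i; rewrite !mxE; exact: near_eq_derive. Qed.

Lemma MVT_seg f a b K :
  (forall t, 0 <= t <= 1 -> differentiable f (a + t *: (b - a)) /\
    `|'D_(b - a) f (a + t *: (b - a))| <= K) -> `|f b - f a| <= K.
Proof.
move=> H.
pose p (t : R) := a + t *: (b - a).
have dp t : differentiable p t by apply: differentiableD => //; exact: differentiableZl.
have dpE t : 'd p t 1 = b - a.
  rewrite -(deriveE _ (dp t)) /p (_ : (fun _ => _) = cst a + (fun t : R => t *: (b - a)))//.
  rewrite deriveD ?derive_cst ?add0r//; last first.
    by apply: diff_derivable; exact: differentiableZl.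
  rewrite deriveE; last exact: differentiableZl.
  by rewrite (@diffZl _ _ _ id)//= (diff_val (is_diff_def := is_diff_id t)) scale1r.
have dfp (t : R) : 0 <= t <= 1 -> differentiable (f \o p) t.
  by move=> /H[df _]; exact: differentiable_comp.
have dfpE (t : R) : 0 <= t <= 1 -> is_derive t (1 : R) (f \o p) ('D_(b - a) f (p t)).
  move=> t01; have dt := dfp _ t01; have [df _] := H _ t01.
  apply: DeriveDef; first exact: diff_derivable.
  by rewrite deriveE// (diff_comp (dp t) df)/= dpE -deriveE.
have cfp : {within `[0, 1], continuous (f \o p)}.
  apply: continuous_in_subspaceT => t; rewrite inE/= in_itv/= => t01.
  exact: differentiable_continuous (dfp _ t01).
have [c c01] := @MVT R (f \o p) (fun t => 'D_(b - a) f (p t)) 0 1 ltr01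
  (fun t ht => dfpE t (subset_itv_oo_cc ht)) cfp.
rewrite /= subr0 mulr1 /p scale1r scale0r addr0 (addrC a) subrK => ->.
by have [] := H c (subset_itv_oo_cc c01).
Qed.

Lemma gradient_lipschitz_eball f c s K : 0 <= K ->
  (forall z, eball c s z -> differentiable f z /\ enorm (gradient f z) <= K) ->
  forall a b, eball c s a -> eball c s b -> `|f b - f a| <= K * enorm (b - a).
Proof.
move=> K0 H a b ac bc; apply: MVT_seg => t /andP[t0 t1].
have /H[df gK] : eball c s (a + t *: (b - a)).
  rewrite /eball/= (_ : _ - c = (1 - t) *: (a - c) + t *: (b - c)); last first.
    by apply/rowP => i; rewrite !mxE; ring.
  apply: le_lt_trans (ler_enormD _ _) _; rewrite !enormZ !ger0_norm ?subr_ge0//.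
  (* The strict inequality comes from the end [b], whose weight [t] must be positive; at [t = 0] the
     point is [a] itself. *)
  have [->|t0'] := eqVneq t 0; first by rewrite subr0 mul1r mul0r addr0.
  apply: (@lt_le_trans _ _ ((1 - t) * s + t * s)); last by lra.
  apply: ler_ltD; first by rewrite ler_wpM2l ?subr_ge0// ltW.
  by rewrite ltr_pM2l// lt_def t0'.
split => //; apply: le_trans (derive_le_enorm _ df) _.
by rewrite ler_wpM2r ?enorm_ge0.
Qed.

Lemma gradient_lipschitz f K : 0 <= K ->
  (forall z, differentiable f z /\ enorm (gradient f z) <= K) ->
  forall a b, `|f b - f a| <= K * enorm (b - a).
Proof.
move=> K0 H a b; apply: (@gradient_lipschitz_eball f a (enorm (b - a) + 1)) => //.
  by rewrite /eball/= subrr enorm0 ltr_wpDl ?enorm_ge0.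
by rewrite /eball/= ltrDl.
Qed.

End gradient.

(** The transposed derivative of [r] at [x], applied to [u]. Gradients of compositions are pulled
    back by it ([gradient_gcomp]), so tangency and Lipschitz bounds are both read off from it. *)
Definition tgrad {R : realType} {n k : nat} (r : 'rV[R]_n -> 'rV[R]_k) x (u : 'rV[R]_k) :=
  gradient (fun z => dot (r z) u) x.

Section vector_valued.
Context {R : realType} {n k : nat}.
Implicit Types (x v : 'rV[R]_n) (u : 'rV[R]_k) (r : 'rV[R]_n -> 'rV[R]_k).

Lemma differentiable_row r x :
  (forall i, differentiable (fun y => r y 0 i) x) -> differentiable r x.
Proof.
move=> dr.
rewrite (_ : r = \sum_(i < k) (fun y => r y 0 i *: delta_mx 0 i)); last first.
  by apply/funext => y; rewrite {1}(row_sum_delta (r y)) fct_sumE.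
apply: differentiable_sum => i; exact: differentiableZl.
Qed.

Lemma differentiable_rowE r x i : differentiable r x -> differentiable (fun y => r y 0 i) x.
Proof.
move=> dr; apply: (@differentiable_comp _ _ _ _ r (fun v : 'rV[R]_k => v 0 i : R)) => //.
exact: differentiable_coord.
Qed.

Lemma derive_row r x v i : differentiable r x -> ('D_v r x) 0 i = 'D_v (fun y => r y 0 i) x.
Proof. by move=> dr; rewrite derive_mx ?mxE//; exact: diff_derivable. Qed.

Lemma differentiable_dot r x u : differentiable r x -> differentiable (fun z => dot (r z) u) x.
Proof.
move=> dr; apply: differentiable_bigsum => i; apply: differentiableM => //.
exact: differentiable_rowE.
Qed.

Lemma derive_dot r x u v : differentiable r x ->
  'D_v (fun z => dot (r z) u) x = dot ('D_v r x) u.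
Proof.
move=> dr; rewrite derive_bigsum => [|i]; last first.
  by apply: differentiableM => //; exact: differentiable_rowE.
apply: eq_bigr => i _; have dri := differentiable_rowE i dr.
rewrite (derive_mul _ dri (differentiable_cst _ _)).
by rewrite [X in _ * X + _]derive_cst mulr0 add0r mulrC derive_row.
Qed.

Lemma dot_tgrad r x u v : differentiable r x -> dot v (tgrad r x u) = dot ('D_v r x) u.
Proof.
by move=> dr; rewrite -derive_gradient ?derive_dot//; exact: differentiable_dot.
Qed.

Lemma tgradE r x u : differentiable r x ->
  tgrad r x u = \sum_(i < k) u 0 i *: gradient (fun y => r y 0 i) x.
Proof.
move=> dr; apply/rowP => j; rewrite -dot_deltal dot_tgrad// summxE.
by apply: eq_bigr => i _; rewrite !mxE derive_row// mulrC.
Qed.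

Lemma derive_gcomp r (g : 'rV[R]_k -> R) x v : differentiable r x ->
  differentiable g (r x) ->
  'D_v (fun y => g (r y)) x = dot ('D_v r x) (gradient g (r x)).
Proof.
move=> dr dg; rewrite (deriveE _ (differentiable_comp dr dg)) (diff_comp dr dg)/=.
by rewrite -(deriveE _ dr) -(deriveE _ dg) derive_gradient.
Qed.

Lemma gradient_gcomp r (g : 'rV[R]_k -> R) x : differentiable r x ->
  differentiable g (r x) ->
  gradient (fun y => g (r y)) x = tgrad r x (gradient g (r x)).
Proof.
by move=> dr dg; apply: gradient_unique => v; rewrite derive_gcomp// dot_tgrad.
Qed.

Lemma c1at_row_differentiable r x : (forall i, c1at (fun y => r y 0 i) x) ->
  \forall y \near x, differentiable r y.
Proof.
move=> cr; suff : \forall y \near x, forall i, differentiable (fun z => r z 0 i) y.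
  by apply: filterS => y; exact: differentiable_row.
by apply: near_forall => i; have [] := cr i.
Qed.

Lemma c1at_row_continuous r x : (forall i, c1at (fun y => r y 0 i) x) ->
  {for x, continuous r}.
Proof. by move=> cr; apply: continuous_row => i; exact: c1at_continuous. Qed.

Lemma c1at_gcomp r (g : 'rV[R]_k -> R) x : (forall i, c1at (fun y => r y 0 i) x) ->
  c1at g (r x) -> c1at (fun y => g (r y)) x.
Proof.
move=> cr cg; have rc := c1at_row_continuous cr.
have dr := c1at_row_differentiable cr.
have dg : \forall y \near x, differentiable g (r y) by apply: near_comp rc cg.1.
split; first by apply: filterS2 dr dg => y dry dgy; exact: (differentiable_comp dry dgy).
move=> v; apply: (@near_eq_continuous _ _ _ (fun y => dot ('D_v r y) (gradient g (r y)))).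
  by apply: filterS2 dr dg => y dry dgy; rewrite derive_gcomp.
apply: continuous_dot.
  apply: continuous_row => i.
  apply: (@near_eq_continuous _ _ _ (fun y => 'D_v (fun z => r z 0 i) y)).
    by apply: filterS dr => y dry; rewrite derive_row.
  by have [_] := cr i.
exact: (@continuous_comp _ _ _ r (gradient g) x rc (c1at_gradient cg)).
Qed.

End vector_valued.

Section coordinates.
Context {R : realType} {n : nat}.
Implicit Types (c x v : 'rV[R]_n).

Lemma c1at_coord x i : c1at (fun y : 'rV[R]_n => y 0 i) x.
Proof.
split; first by apply: near_all => y; exact: differentiable_coord.
move=> v; apply: (@near_eq_continuous _ _ _ (fun=> v 0 i)); last exact: cst_continuous.
apply: near_all => y; rewrite -(@derive_row _ _ _ id)// derive_id//.
Qed.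

Lemma c1at_dist2 c x : c1at (fun y => dot (y - c) (y - c)) x.
Proof.
have cc i : c1at (fun y : 'rV[R]_n => (y - c) 0 i) x.
  apply: (@c1at_near _ _ (fun y : 'rV[R]_n => y 0 i - c 0 i)).
    by apply: near_all => y; rewrite !mxE.
  by apply: c1atB; [exact: c1at_coord|exact: c1at_cst].
by apply: c1at_sum => i; exact: c1atM.
Qed.

Lemma derive_dist2 c x v : 'D_v (fun y => dot (y - c) (y - c)) x = 2 * dot v (x - c).
Proof.
have dc i : differentiable (fun y : 'rV[R]_n => (y - c) 0 i) x.
  by apply: (@differentiable_rowE _ _ _ (fun y => y - c)); exact: differentiableB.
rewrite derive_bigsum => [|i]; last exact: differentiableM.
rewrite /dot mulr_sumr; apply: eq_bigr => i _; rewrite derive_mul//.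
suff -> : 'D_v (fun y : 'rV[R]_n => (y - c) 0 i) x = v 0 i by ring.
rewrite -(@derive_row _ _ _ (fun y => y - c)); last exact: differentiableB.
by rewrite deriveB// derive_id derive_cst subr0.
Qed.

End coordinates.

(** * Partitions of unity and smoothing *)

Section step.
Context {R : realType}.
Implicit Types t : R.

Definition pos_part t : R := Num.max 0 t.
Definition pos_sqr t : R := pos_part t ^+ 2.

Lemma pos_part_ge0 t : 0 <= pos_part t.
Proof. by rewrite /pos_part le_max lexx. Qed.

Lemma pos_part_id t : 0 <= t -> pos_part t = t.
Proof. by move=> t0; rewrite /pos_part max_r. Qed.

Lemma pos_part0 t : t <= 0 -> pos_part t = 0.
Proof. by move=> t0; rewrite /pos_part max_l. Qed.

Lemma continuous_pos_part : continuous pos_part.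
Proof. by move=> t; apply: continuous_max; [exact: cst_continuous|exact: id]. Qed.

(** The remainder is at most [h ^+ 2] in each of the four sign cases, so the derivative follows with
    no separate discussion of the corner at 0. *)
Lemma pos_sqr_taylor t h : `|pos_sqr (h + t) - pos_sqr t - 2 * pos_part t * h| <= h ^+ 2.
Proof.
rewrite /pos_sqr; have [t0|t0] := leP 0 t; have [s0|s0] := leP 0 (h + t).
- by rewrite !pos_part_id// ler_norml; nra.
- by rewrite (pos_part_id t0) (pos_part0 (ltW s0)) ler_norml; nra.
- by rewrite (pos_part_id s0) (pos_part0 (ltW t0)) ler_norml; nra.
- by rewrite (pos_part0 (ltW s0)) (pos_part0 (ltW t0)) ler_norml; nra.
Qed.

Lemma is_derive_pos_sqr t : is_derive t (1 : R) pos_sqr (2 * pos_part t).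
Proof.
suff H : h^-1 *: (pos_sqr (h *: 1 + t) - pos_sqr t) @[h --> 0^'] --> 2 * pos_part t.
  by apply: DeriveDef; [apply/cvg_ex; exists (2 * pos_part t)|exact: cvg_lim H].
apply/cvgrPdist_le => e e0; near=> h.
have h0 : h != 0 by near: h; exact: nbhs_dnbhs_neq.
have he : `|h| <= e by near: h; exact: dnbhs0_le.
rewrite /GRing.scale/= mulr1 -normrN opprB.
rewrite (_ : _ - _ = h^-1 * (pos_sqr (h + t) - pos_sqr t - 2 * pos_part t * h)); last first.
  by field.
rewrite normrM normfV; apply: le_trans (ler_wpM2l _ (pos_sqr_taylor t h)) _.
  by rewrite invr_ge0.
by rewrite -[h ^+ 2]real_normK ?num_real// expr2 mulKf// normr_eq0.
Unshelve. all: by end_near. Qed.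

(** On the unit interval this is [1 - (1 - t ^+ 2) ^+ 2]: a transition from 0 to 1 whose derivative
    [4 * t * (1 - t ^+ 2)] vanishes at both ends, hence C^1. *)
Definition step t : R := 1 - pos_sqr (1 - pos_sqr t).
Definition dstep t : R := 4 * pos_part (1 - pos_sqr t) * pos_part t.

Lemma is_derive_step t : is_derive t (1 : R) step (dstep t).
Proof.
have H1 := is_derive_pos_sqr t.
have H2 : is_derive t (1 : R) (fun s => 1 - pos_sqr s) (- (2 * pos_part t)).
  by apply: is_derive_eq (is_deriveB _ _) _; rewrite sub0r.
have H3 := is_derive_pos_sqr (1 - pos_sqr t).
have H4 : is_derive t (1 : R) (fun s => pos_sqr (1 - pos_sqr s)) (- dstep t).
  have [d1 e1] := H2; have df : differentiable (fun s => 1 - pos_sqr s) t by exact/derivable1_diffP.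
  apply: DeriveDef; first by apply/derivable1_diffP; exact: (@differentiable_comp1 _ _ pos_sqr _ (fun s => 1 - pos_sqr s) t H3 df).
  by rewrite (@derive_comp1 _ _ pos_sqr _ (fun s => 1 - pos_sqr s) t 1 H3 df) e1 /dstep; ring.
by apply: is_derive_eq (is_deriveB _ _) _; rewrite sub0r opprK.
Qed.

Lemma continuous_pos_sqr : continuous pos_sqr.
Proof.
move=> t; apply: (@continuous_comp _ _ _ pos_part (fun s => s ^+ 2)).
  exact: continuous_pos_part.
exact: exprn_continuous.
Qed.

Lemma continuous_dstep : continuous dstep.
Proof.
move=> t; apply: cvgM; last exact: continuous_pos_part.
apply: cvgM; first exact: cst_continuous.
apply: (@continuous_comp _ _ _ (fun s => 1 - pos_sqr s) pos_part); last exact: continuous_pos_part.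
by apply: cvgB; [exact: cst_continuous|exact: continuous_pos_sqr].
Qed.

Lemma step0 t : t <= 0 -> step t = 0.
Proof.
move=> t0; rewrite /step /pos_sqr (pos_part0 t0) expr0n subr0.
by rewrite pos_part_id// expr1n subrr.
Qed.

Lemma step1 t : 1 <= t -> step t = 1.
Proof.
move=> t1; rewrite /step /pos_sqr (@pos_part_id t) ?(le_trans ler01)//.
by rewrite pos_part0 ?expr0n ?subr0//; nra.
Qed.

Lemma step_ge0 t : 0 <= step t.
Proof.
rewrite /step subr_ge0 /pos_sqr expr_le1// ?pos_part_ge0// /pos_part ge_max ler01/=.
by rewrite lerBlDr lerDl sqr_ge0.
Qed.

Lemma step_le1 t : step t <= 1.
Proof. by rewrite /step lerBlDr lerDl sqr_ge0. Qed.

Lemma dstep_eq0 t : ~~ (0 < t < 1) -> dstep t = 0.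
Proof.
rewrite negb_and -!leNgt => /orP[t0|t1]; rewrite /dstep.
  by rewrite (pos_part0 t0) mulr0.
rewrite (@pos_part0 (1 - _)) ?mulr0 ?mul0r// /pos_sqr pos_part_id ?(le_trans ler01)//.
by nra.
Qed.

Lemma dstep_le4 t : `|dstep t| <= 4.
Proof.
have [/andP[t0 t1]|/dstep_eq0->] := boolP (0 < t < 1); last by rewrite normr0.
rewrite /dstep !normrM !ger0_norm ?pos_part_ge0// /pos_sqr (pos_part_id (ltW t0)).
by rewrite pos_part_id; nra.
Qed.

Lemma c1at_step (V : normedModType R) (f : V -> R) x : c1at f x -> c1at (fun y => step (f y)) x.
Proof.
apply: (@c1at_comp1 _ _ step dstep); last exact: continuous_dstep.
by apply: near_all => t; exact: is_derive_step.
Qed.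

Lemma derive_step (V : normedModType R) (f : V -> R) x v : differentiable f x ->
  'D_v (fun y => step (f y)) x = dstep (f x) * 'D_v f x.
Proof. by move=> df; rewrite (derive_comp1 _ (is_derive_step _) df). Qed.

Lemma c1at_ln (V : normedModType R) (f : V -> R) x : 0 < f x ->
  c1at f x -> c1at (fun y => ln (f y)) x.
Proof.
move=> f0; apply: (@c1at_comp1 _ _ (@ln R) GRing.inv).
  near=> t; apply: is_derive1_ln.
  by near: t; exact: lt_nbhsr.
by apply: (@continuousV _ _ id) => //; rewrite gt_eqF.
Unshelve. all: by end_near. Qed.

Lemma derive_ln_comp (V : normedModType R) (f : V -> R) x v : 0 < f x -> differentiable f x ->
  'D_v (fun y => ln (f y)) x = (f x)^-1 * 'D_v f x.
Proof. by move=> f0 df; rewrite (derive_comp1 _ (is_derive1_ln f0) df). Qed.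

Lemma c1at_sqrt (V : normedModType R) (f : V -> R) x : 0 < f x ->
  c1at f x -> c1at (fun y => Num.sqrt (f y)) x.
Proof.
move=> f0; apply: (@c1at_comp1 _ _ (@Num.sqrt R) (fun t => (2 * Num.sqrt t)^-1)).
  near=> t; apply: is_derive1_sqrt.
  by near: t; exact: lt_nbhsr.
apply: continuousV; first by rewrite mulf_neq0// gt_eqF// sqrtr_gt0.
apply: cvgM; first exact: cst_continuous.
exact: sqrt_continuous.
Unshelve. all: by end_near. Qed.

Lemma derive_sqrt_comp (V : normedModType R) (f : V -> R) x v : 0 < f x -> differentiable f x ->
  'D_v (fun y => Num.sqrt (f y)) x = (2 * Num.sqrt (f x))^-1 * 'D_v f x.
Proof. by move=> f0 df; rewrite (derive_comp1 _ (is_derive1_sqrt f0) df). Qed.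

End step.

(** * Bump functions and partitions of unity *)

Section partition_of_unity.
Context {R : realType} {n : nat}.
Implicit Types (x v : 'rV[R]_n) (f g : 'rV[R]_n -> R).

(** The squared distance keeps it C^1 at the center. It is 1 up to radius [s] and 0 from radius [s]
    times the square root of 2, which leaves room before [2 * s]. *)
Definition bump (c : 'rV[R]_n) (s : R) x : R := step (2 - s ^- 2 * dot (x - c) (x - c)).

Let bump_arg_c1 (c : 'rV[R]_n) (s : R) x : c1at (fun y => 2 - s ^- 2 * dot (y - c) (y - c)) x.
Proof.
apply: c1atB; first exact: c1at_cst.
by apply: c1atM; [exact: c1at_cst|exact: c1at_dist2].
Qed.

Lemma c1at_bump c s x : c1at (bump c s) x.
Proof. exact: c1at_step (bump_arg_c1 c s x). Qed.

Lemma bump1 c s x : 0 < s -> enorm (x - c) <= s -> bump c s x = 1.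
Proof.
move=> s0 xs; apply: step1; rewrite -sqr_enorm -exprVn -exprMn mulrC.
have : 0 <= enorm (x - c) / s <= 1 by rewrite divr_ge0 ?enorm_ge0 ?(ltW s0)// ler_pdivrMr// mul1r.
by move: (_ / s) => t /andP[t0 t1]; nra.
Qed.

Lemma bump_support c s x : 0 < s -> 2 * s <= enorm (x - c) -> \forall y \near x, bump c s y = 0.
Proof.
move=> s0 xs; apply/nbhs_eballP; exists (s / 2); first by rewrite divr_gt0.
move=> y; rewrite /eball/= => yx; apply: step0; rewrite -sqr_enorm -exprVn -exprMn mulrC.
have : 3 / 2 <= enorm (y - c) / s.
  rewrite ler_pdivlMr//; have := ler_enorm_trans y x c; rewrite (enormC x y); lra.
by move: (_ / s) => t t0; nra.
Qed.

(** One bound on the whole space, for each member of the partition separately: it fixes how accurate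
    the approximation glued by that member must be. *)
Definition bounded_derive f := exists2 G, 0 <= G & forall x v, `|'D_v f x| <= G * enorm v.

Lemma bounded_derive_mul f g : (forall x, differentiable f x) -> (forall x, differentiable g x) ->
  (forall x, 0 <= f x <= 1) -> (forall x, 0 <= g x <= 1) ->
  bounded_derive f -> bounded_derive g -> bounded_derive (fun x => f x * g x).
Proof.
move=> df dg f01 g01 [F F0 hF] [G G0 hG]; exists (F + G); first exact: addr_ge0.
move=> x v; rewrite derive_mul//; have /andP[f0 f1] := f01 x; have /andP[g0 g1] := g01 x.
apply: le_trans (ler_normD _ _) _; rewrite !normrM (ger0_norm f0) (ger0_norm g0).
have := hF x v; have := hG x v; move: `|_| `|_| => a b ha hb.
have := @enorm_ge0 _ _ v; move: (enorm v) ha hb => e ha hb e0; rewrite mulrDl addrC.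
have Ge : 0 <= G * e by exact: mulr_ge0.
have Fe : 0 <= F * e by exact: mulr_ge0.
by apply: lerD; [apply: le_trans (ler_wpM2l g0 hb) _|apply: le_trans (ler_wpM2l f0 ha) _];
  rewrite ler_piMl.
Qed.

Lemma derive_bump c s x v : 'D_v (bump c s) x =
  - dstep (2 - s ^- 2 * dot (x - c) (x - c)) * s ^- 2 * (2 * dot v (x - c)).
Proof.
rewrite derive_step; last exact: c1at_differentiable.
rewrite (_ : (fun _ => _) = (fun y => cst 2 y + (- s ^- 2) * dot (y - c) (y - c))); last first.
  by apply/funext => y; rewrite mulNr.
have d2 := c1at_differentiable (c1at_dist2 c x).
have dc := differentiable_cst (- s ^- 2 : R) x.
rewrite derive_add//; last exact: differentiableM.
by rewrite derive_cst derive_mul// derive_cst derive_dist2; ring.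
Qed.

Lemma bounded_derive_bump c s : 0 < s -> bounded_derive (bump c s).
Proof.
move=> s0; exists (16 / s); first by rewrite divr_ge0// ltW.
move=> x v; rewrite derive_bump.
have [xs|xs] := leP (2 * s) (enorm (x - c)).
  suff -> : dstep (2 - s ^- 2 * dot (x - c) (x - c)) = 0.
    by rewrite oppr0 !mul0r normr0 mulr_ge0 ?enorm_ge0// divr_ge0// ltW.
  apply: dstep_eq0; rewrite negb_and -leNgt; apply/orP; left.
  rewrite -sqr_enorm -exprVn -exprMn mulrC.
  have : 2 <= enorm (x - c) / s by rewrite ler_pdivlMr.
  by move: (_ / s) => t t0; nra.
rewrite !normrM normrN.
rewrite (ger0_norm (_ : 0 <= s ^- 2)) ?invr_ge0 ?sqr_ge0// (ger0_norm (_ : 0 <= 2 :> R))//.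
have h1 := normr_dot_le v (x - c).
have h2 := dstep_le4 (2 - s ^- 2 * dot (x - c) (x - c)).
apply: (@le_trans _ _ (4 * s ^- 2 * (2 * (enorm v * (2 * s))))).
  rewrite ler_pM ?mulr_ge0 ?normr_ge0 ?invr_ge0 ?sqr_ge0//.
    by rewrite ler_wpM2r// invr_ge0 sqr_ge0.
  rewrite ler_wpM2l//; apply: le_trans h1 _.
  by rewrite ler_wpM2l ?enorm_ge0// ltW.
by rewrite le_eqVlt; apply/orP; left; apply/eqP; field; rewrite gt_eqF.
Qed.

Lemma rational_dense x e : 0 < e -> exists q : 'rV[rat]_n, enorm (x - map_mx ratr q) < e.
Proof.
move=> e0; pose d := e / n.+1%:R / 2.
have d0 : 0 < d by rewrite /d !divr_gt0.
have H (i : 'I_n) : exists q : rat, `|x 0 i - ratr q| <= d.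
  have [|q] := @rat_in_itvoo R (x 0 i) (x 0 i + d); first by rewrite ltrDl.
  by rewrite in_itv/= => /andP[a b]; exists q; rewrite ler_norml; lra.
have [q hq] := fin_all_exists H; exists (\row_i q i).
apply: le_lt_trans (enorm_le_norm _) _; rewrite mulrC -ltr_pdivlMr//.
apply: (@le_lt_trans _ _ d).
  rewrite [leLHS]/Num.Def.normr/= mx_normrE bigmax_le ?(ltW d0)// => -[i j] _ /=.
  by rewrite (ord1 i) !mxE.
by rewrite /d ltr_pdivrMr// ltr_pMr ?ltr1n// divr_gt0.
Qed.

(** The functions are C^1 on the whole space, but they are locally finite with sum 1 only near
    points of [O]; the local bound [N] turns the infinite sum into finite ones. *)
Record partition_of_unity (O : set 'rV[R]_n) (c : nat -> 'rV[R]_n) (s : nat -> R)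
    (psi : nat -> 'rV[R]_n -> R) : Prop := {
  pou_c1at : forall i x, c1at (psi i) x ;
  pou_ge0_le1 : forall i x, 0 <= psi i x <= 1 ;
  pou_support : forall i x, 2 * s i <= enorm (x - c i) -> \forall y \near x, psi i y = 0 ;
  pou_bounded_derive : forall i, bounded_derive (psi i) ;
  pou_locally_finite : forall x, O x -> exists N,
    \forall y \near x, (forall i, (N <= i)%N -> psi i y = 0) /\ \sum_(i < N) psi i y = 1
}.

(** [P] says that a ball is small enough for the purpose at hand. The balls with rational center and
    radius an inverse integer that satisfy [P] are countably many and cover [O]. *)
Lemma partition_of_unity_exists (O : set 'rV[R]_n) (P : 'rV[R]_n -> R -> Prop) : O !=set0 ->
  (forall x, O x -> exists2 rho, 0 < rho &
    forall c s, 0 < s -> s < rho -> enorm (c - x) < rho -> P c s) ->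
  exists c s psi, partition_of_unity O c s psi /\ forall i, P (c i) (s i).
Proof.
move=> [x0 Ox0] HP.
have small e : 0 < e -> exists k : nat, k.+1%:R^-1 < e :> R.
  move=> e0; exists (Num.truncn e^-1); rewrite invf_plt ?posrE//.
  by rewrite truncnS_gt// invr_ge0 ltW.
have [k0 good0] : exists k : nat, P x0 k.+1%:R^-1.
  have [rho rho0 h] := HP _ Ox0; have [k hk] := small _ rho0; exists k; apply: h => //.
  by rewrite subrr enorm0.
(* Codes that do not give an admissible ball are sent to a fixed admissible one; the repetitions are
   harmless. *)
pose cs (i : nat) : 'rV[R]_n * R :=
  if unpickle i is Some qk then
    if pselect (P (map_mx ratr (qk : 'rV[rat]_n * nat).1) (qk.2.+1%:R^-1)) then
      (map_mx ratr qk.1, qk.2.+1%:R^-1)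
    else (x0, k0.+1%:R^-1)
  else (x0, k0.+1%:R^-1).
pose c i := (cs i).1; pose s i := (cs i).2.
have csP i : 0 < s i /\ P (c i) (s i).
  rewrite /s /c /cs; case: (unpickle i) => [qk|]; last by rewrite invr_gt0.
  by case: pselect => /= h; rewrite invr_gt0.
have s0 i := (csP i).1.
have cover x : O x -> exists i, enorm (x - c i) < s i.
  move=> /HP[rho rho0 h]; have [k hk] := small _ rho0.
  have [q hq] := @rational_dense x k.+1%:R^-1 ltac:(by rewrite invr_gt0).
  exists (pickle (q, k)); rewrite /c /s /cs pickleK; case: pselect => //= nP.
  by exfalso; apply: nP; apply: h => //; rewrite enormC; exact: lt_trans hk.
pose b i := bump (c i) (s i).
pose p (i : nat) x := \prod_(j < i) (1 - b j x).
have b01 i x : 0 <= b i x <= 1 by rewrite step_ge0 step_le1.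
have b'01 i x : 0 <= 1 - b i x <= 1.
  by have /andP[? ?] := b01 i x; apply/andP; split; lra.
have b'c i x : c1at (fun y => 1 - b i y) x.
  by apply: c1atB; [exact: c1at_cst|exact: c1at_bump].
have b'd i : bounded_derive (fun y => 1 - b i y).
  have [G G0 hG] := @bounded_derive_bump (c i) (s i) (s0 i); exists G => // x v.
  have db := c1at_differentiable (c1at_bump (c i) (s i) x).
  rewrite (derive_sub v (differentiable_cst (1 : R) x) db) derive_cst sub0r normrN.
  exact: hG.
have pc i x : c1at (p i) x by apply: c1at_prod.
have p01 i x : 0 <= p i x <= 1.
  apply/andP; split; [apply: prodr_ge0 => j _; by case/andP: (b'01 j x)|].
  apply: (@le_trans _ _ (\prod_(j < i) 1)); last by rewrite big1.
  by apply: ler_prod => j _; exact: b'01.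
have dp i x : differentiable (p i) x by exact: c1at_differentiable (pc i x).
have db i x : differentiable (b i) x by exact: c1at_differentiable (c1at_bump _ _ _).
have db' i x : differentiable (fun y => 1 - b i y) x by exact: c1at_differentiable (b'c i x).
have pd i : bounded_derive (p i).
  elim: i => [|i IH].
    exists 0 => // x v; rewrite (_ : p 0 = cst 1) ?derive_cst ?normr0 ?mul0r//.
    by apply/funext => y; rewrite /p big_ord0.
  rewrite (_ : p i.+1 = fun x => p i x * (1 - b i x)); last first.
    by apply/funext => y; rewrite /p big_ord_recr.
  exact: bounded_derive_mul (dp i) (db' i) (p01 i) (b'01 i) IH (b'd i).
(* The partial sums telescope to [1 - p i], where [p i] is the product of the [1 - b j] for [j < i].
   Wherever some [b j] is 1, all later [p i] vanish: this gives both local finiteness and total sum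
   1. *)
exists c, s, (fun i x => b i x * p i x); split; last by move=> i; case: (csP i).
split.
- by move=> i x; exact: c1atM (c1at_bump _ _ _) (pc i x).
- move=> i x; have /andP[? ?] := b01 i x; have /andP[? ?] := p01 i x.
  by rewrite mulr_ge0// mulr_ile1.
- by move=> i x /(bump_support (s0 i)); apply: filterS => y; rewrite /b => ->; rewrite mul0r.
- by move=> i; exact: bounded_derive_mul (db i) (dp i) (b01 i) (p01 i)
    (bounded_derive_bump (c i) (s0 i)) (pd i).
- move=> x /cover[j xj]; exists j.+1.
  have /nbhs_eballP : exists2 r, 0 < r & eball x r `<=` eball (c j) (s j).
    exists (s j - enorm (x - c j)); first by rewrite subr_gt0.
    by apply: sub_eball; lra.
  apply: filterS => y /= yj.
  have bj : b j y = 1 by apply: bump1 => //; exact: ltW.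
  have p0 i : (j < i)%N -> p i y = 0.
    by move=> ji; rewrite /p (bigD1 (Ordinal ji))//= bj subrr mul0r.
  split; first by move=> i /p0 ->; rewrite mulr0.
  have tel i : \sum_(k < i) b k y * p k y = 1 - p i y.
    elim: i => [|i IH]; first by rewrite big_ord0 /p big_ord0 subrr.
    by rewrite big_ord_recr/= IH /p big_ord_recr/=; ring.
  by rewrite tel p0// subr0.
Qed.

End partition_of_unity.

(** * Gluing functions defined on small balls *)

Lemma eq_sum_support (R : realType) (a : nat -> R) (N M : nat) :
  (forall i, (N <= i)%N -> a i = 0) -> (forall i, (M <= i)%N -> a i = 0) ->
  \sum_(i < N) a i = \sum_(i < M) a i.
Proof.
wlog NM : N M / (N <= M)%N => [H|] hN hM.
  by case: (leqP N M) => [/H->//|/ltnW/H->].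
rewrite -!(big_mkord predT) (big_cat_nat _ NM)//= [X in _ + X]big1_seq ?addr0//.
by move=> i /=; rewrite mem_index_iota => /andP[/hN].
Qed.

Section glue.
Context {R : realType} {n : nat}.
Variables (O : set 'rV[R]_n) (c : nat -> 'rV[R]_n) (s : nat -> R)
  (psi : nat -> 'rV[R]_n -> R) (N : 'rV[R]_n -> nat).
Hypothesis (Oopen : open O) (pou : partition_of_unity O c s psi).
Hypothesis pouN : forall x, O x ->
  \forall y \near x, (forall i, (N x <= i)%N -> psi i y = 0) /\ \sum_(i < N x) psi i y = 1.
Implicit Types (x v : 'rV[R]_n) (h : nat -> 'rV[R]_n -> R).

Lemma psi_eq0 i x : ~ eball (c i) (2 * s i) x -> psi i x = 0.
Proof.
by move=> /negP; rewrite -leNgt => /(pou_support pou)/nbhs_singleton.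
Qed.

Lemma derive_psi_eq0 i x v : ~ eball (c i) (2 * s i) x -> 'D_v (psi i) x = 0.
Proof.
move=> /negP; rewrite -leNgt => /(pou_support pou) h.
by rewrite (@near_eq_derive _ _ _ _ (cst (0 : R)) _ _ h) derive_cst.
Qed.

Lemma sum_psi x : O x -> \sum_(i < N x) psi i x = 1.
Proof. by move=> /pouN/nbhs_singleton[]. Qed.

Lemma sum_derive_psi x v : O x -> \sum_(i < N x) 'D_v (psi i) x = 0.
Proof.
move=> Ox; rewrite -(@derive_bigsum _ _ _ _ (fun i : 'I_(N x) => psi i)); last first.
  by move=> i; exact: c1at_differentiable (pou_c1at pou i x).
rewrite (@near_eq_derive _ _ _ _ (cst (1 : R)) x) ?derive_cst//.
by apply: filterS (pouN Ox) => y [].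
Qed.

(** The number of terms varies with the point. Any two valid bounds give the same sum, so near a
    given point the bound can be frozen ([glue_near]) before differentiating. *)
Definition glued h x := \sum_(i < N x) psi i x * h i x.

Lemma glue_near h x : O x -> \forall y \near x, glued h y = \sum_(i < N x) psi i y * h i y.
Proof.
move=> Ox; apply: filterS2 (pouN Ox) (open_nbhs_nbhs (conj Oopen Ox)) => y [py _] Oy.
have [py' _] := nbhs_singleton (pouN Oy).
apply: (eq_sum_support (a := fun i => psi i y * h i y)) => i hi.
  by rewrite py' ?mul0r.
by rewrite py ?mul0r.
Qed.

Variable h : nat -> 'rV[R]_n -> R.
Hypothesis hc1 : forall i x, eball (c i) (2 * s i) x -> c1at (h i) x.

Lemma c1at_psiM i x : c1at (fun y => psi i y * h i y) x.
Proof.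
have [xi|xi] := pselect (eball (c i) (2 * s i) x).
  by apply: c1atM; [exact: pou_c1at pou i x|exact: hc1].
apply: (@c1at_near _ _ (fun=> 0)); last exact: c1at_cst.
move/negP: xi; rewrite -leNgt => /(pou_support pou); apply: filterS => y ->.
by rewrite mul0r.
Qed.

Lemma derive_psiM i x v :
  'D_v (fun y => psi i y * h i y) x = psi i x * 'D_v (h i) x + h i x * 'D_v (psi i) x.
Proof.
have [xi|xi] := pselect (eball (c i) (2 * s i) x).
  rewrite derive_mul//; apply: c1at_differentiable; [exact: pou_c1at pou i x|exact: hc1].
rewrite psi_eq0// derive_psi_eq0// mul0r mulr0 addr0.
rewrite (@near_eq_derive _ _ _ _ (cst (0 : R)) x) ?derive_cst//.
move/negP: xi; rewrite -leNgt => /(pou_support pou); apply: filterS => y ->.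
by rewrite mul0r.
Qed.

Lemma c1at_glue x : O x -> c1at (glued h) x.
Proof.
move=> Ox; apply: (@c1at_near _ _ (fun y => \sum_(i < N x) psi i y * h i y)).
  by apply: filterS (glue_near h Ox) => y ->.
by apply: c1at_sum => i; exact: c1at_psiM.
Qed.

Lemma derive_glue x v : O x -> 'D_v (glued h) x =
  \sum_(i < N x) psi i x * 'D_v (h i) x + \sum_(i < N x) h i x * 'D_v (psi i) x.
Proof.
move=> Ox; rewrite (near_eq_derive _ (glue_near h Ox)).
rewrite (@derive_bigsum _ _ _ _ (fun i : 'I_(N x) => fun y => psi i y * h i y)).
  by rewrite -big_split/=; apply: eq_bigr => i _; rewrite derive_psiM.
by move=> i; exact: c1at_differentiable (c1at_psiM i x).
Qed.

End glue.

Lemma pou_index (R : realType) n (O : set 'rV[R]_n) c s psi :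
  partition_of_unity O c s psi -> exists N : 'rV[R]_n -> nat, forall x, O x ->
  \forall y \near x, (forall i, (N x <= i)%N -> psi i y = 0) /\ \sum_(i < N x) psi i y = 1.
Proof.
move=> pou.
have H x : exists N, O x -> \forall y \near x,
    (forall i, (N <= i)%N -> psi i y = 0) /\ \sum_(i < N) psi i y = 1.
  have [/(pou_locally_finite pou)[N hN]|nO] := pselect (O x); first by exists N.
  by exists 0%N.
by have [N hN] := choice H; exists N.
Qed.

(** * C^1 approximation with control of the Lipschitz constant *)

Section smoothing.
Context {R : realType} {n : nat}.
Implicit Types (x v : 'rV[R]_n) (f g h : 'rV[R]_n -> R).

Definition c1lip (L : R) f := (forall x, c1at f x) /\
  forall x v, `|'D_v f x| <= L * enorm v.

(** Smooth minimum: in [(a + b - |a - b|) / 2] the absolute value is replaced by the square root of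
    [(a - b) ^+ 2 + (2 * eta) ^+ 2]. Its derivative is a convex combination of those of [a] and [b],
    so the constant [L] is kept. *)
Lemma c1lip_min L (a b : 'rV[R]_n -> R) eta : 0 < eta -> c1lip L a -> c1lip L b ->
  exists2 m, c1lip L m & forall x, [/\ m x <= a x, m x <= b x &
    Num.min (a x) (b x) - eta <= m x].
Proof.
move=> eta0 [ca da] [cb db].
pose d x := a x - b x.
pose q x := d x * d x + (2 * eta) ^+ 2.
have e2 : 0 < (2 * eta) ^+ 2 by rewrite exprn_gt0// mulr_gt0.
have q0 x : 0 < q x by rewrite ltr_wpDl// -expr2 sqr_ge0.
have cd x : c1at d x by apply: c1atB.
have cq x : c1at q x by apply: c1atD; [exact: c1atM|exact: c1at_cst].
have csq x : c1at (fun y => Num.sqrt (q y)) x by apply: c1at_sqrt.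
have dd x : differentiable d x by exact: c1at_differentiable.
have da' x : differentiable a x by exact: c1at_differentiable.
have db' x : differentiable b x by exact: c1at_differentiable.
have Dd x v : 'D_v d x = 'D_v a x - 'D_v b x.
  exact: derive_sub (da' x) (db' x).
have sq_ge x : `|d x| <= Num.sqrt (q x).
  by rewrite -sqrtr_sqr ler_sqrt ?(ltW (q0 x))// expr2 lerDl ltW.
have sq_le x : Num.sqrt (q x) <= `|d x| + 2 * eta.
  have h : 0 <= `|d x| + 2 * eta by rewrite addr_ge0// mulr_ge0// ltW.
  rewrite -(ger0_norm h) -sqrtr_sqr ler_sqrt ?sqr_ge0// sqrrD real_normK ?num_real// /q -expr2.
  by rewrite lerD2r lerDl mulrn_wge0// mulr_ge0// mulr_ge0// ltW.
exists (fun x => 2^-1 * (a x + b x - Num.sqrt (q x))); last first.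
  move=> x; have := sq_ge x; have := sq_le x; rewrite /d.
  move: (a x) (b x) (Num.sqrt _) => A B S.
  have [AB|BA] := leP A B.
    rewrite ler0_norm ?subr_le0// => h1 h2; split; lra.
  by rewrite gtr0_norm ?subr_gt0// => h1 h2; split; lra.
split => [x|x v].
  by apply: c1atM; [exact: c1at_cst|apply: c1atB => //; exact: c1atD].
have cab : c1at (fun y => a y + b y) x by exact: c1atD.
have dab := c1at_differentiable cab; have dsq := c1at_differentiable (csq x).
have dq := c1at_differentiable (cq x).
have ddd : differentiable (fun y => d y * d y) x by exact: c1at_differentiable (c1atM (cd x) (cd x)).
rewrite (derive_mul v (differentiable_cst (2^-1 : R) x) (c1at_differentiable (c1atB cab (csq x)))).
rewrite derive_cst mulr0 addr0 (derive_sub v dab dsq) (derive_add v (da' x) (db' x)).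
rewrite (derive_sqrt_comp v (q0 x) dq) (derive_add v ddd (differentiable_cst ((2 * eta) ^+ 2 : R) x)).
rewrite derive_cst addr0 (derive_mul v (dd x) (dd x)) Dd.
have S0 : 0 < Num.sqrt (q x) by rewrite sqrtr_gt0.
(* The weights of the convex combination are [(1 - th) / 2] and [(1 + th) / 2]. *)
set S := Num.sqrt (q x); pose th := d x / S.
have th1 : -1 <= th <= 1 by rewrite -ler_norml normf_div (gtr0_norm S0) ler_pdivrMr// mul1r.
rewrite (_ : 2^-1 * _ = (1 - th) / 2 * 'D_v a x + (1 + th) / 2 * 'D_v b x); last first.
  by rewrite /th /S; field; rewrite gt_eqF.
apply: le_trans (ler_normD _ _) _; rewrite !normrM.
have /andP[t0 t1] := th1.
rewrite (ger0_norm (_ : 0 <= 1 - th)) ?subr_ge0// (ger0_norm (_ : 0 <= 1 + th)); last by lra.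
rewrite ger0_norm//.
by have := da x v; have := db x v; move: `|_| `|_| (L * _) => A B C; nra.
Qed.

(** Half of the tolerance goes to the tail of the list and half to the comparison with its head. *)
Lemma c1lip_softmin (T : eqType) L (F : T -> 'rV[R]_n -> R) (y0 : T) (l : seq T) eta :
  0 < eta -> (forall y, c1lip L (F y)) ->
  exists2 m, c1lip L m & forall x, (forall y, y \in y0 :: l -> m x <= F y x) /\
    exists2 y, y \in y0 :: l & F y x - eta <= m x.
Proof.
move=> + FL; elim: l y0 eta => [|y1 l IH] y0 eta eta0.
  exists (F y0) => // x; split; first by move=> y; rewrite inE => /eqP ->.
  by exists y0; rewrite ?inE// lerBlDr lerDl ltW.
have [m mL mP] := IH y1 (eta / 2) ltac:(by rewrite divr_gt0).
have eta2 : 0 < eta / 2 by rewrite divr_gt0.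
have [m' m'L m'P] := c1lip_min eta2 (FL y0) mL.
exists m' => // x; have [m1 m2 m3] := m'P x; have [mle [y yl ym]] := mP x; split.
  move=> z; rewrite inE => /orP[/eqP->//|/mle]; exact: le_trans.
move: m3; have [h|h] := leP (F y0 x) (m x) => m3.
  by exists y0; rewrite ?inE ?eqxx//; lra.
by exists y; [rewrite inE yl orbT|lra].
Qed.

Lemma c1lip_cone L y a eta : 0 <= L -> 0 < eta -> exists2 h, c1lip L h &
  forall x, a + L * enorm (x - y) <= h x <= a + L * (enorm (x - y) + eta).
Proof.
move=> L0 eta0; pose q x := dot (x - y) (x - y) + eta ^+ 2.
have q0 x : 0 < q x by rewrite ltr_wpDl ?dotxx_ge0// exprn_gt0.
have cq x : c1at q x by apply: c1atD; [exact: c1at_dist2|exact: c1at_cst].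
have csq x : c1at (fun z => Num.sqrt (q z)) x by apply: c1at_sqrt.
have sq_ge x : enorm (x - y) <= Num.sqrt (q x).
  by rewrite ler_sqrt ?(ltW (q0 x))// lerDl sqr_ge0.
have sq_le x : Num.sqrt (q x) <= enorm (x - y) + eta.
  have h : 0 <= enorm (x - y) + eta by rewrite addr_ge0 ?enorm_ge0// ltW.
  rewrite -(ger0_norm h) -sqrtr_sqr ler_sqrt ?sqr_ge0// sqrrD sqr_enorm.
  by rewrite lerD2r lerDl mulrn_wge0// mulr_ge0 ?enorm_ge0// ltW.
exists (fun x => a + L * Num.sqrt (q x)); last first.
  by move=> x; rewrite !lerD2l !ler_wpM2l.
split=> [x|x v].
  by apply: c1atD; [exact: c1at_cst|apply: c1atM => //; exact: c1at_cst].
have dsq : differentiable (fun z => Num.sqrt (q z)) x by exact: c1at_differentiable.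
rewrite derive_add; [|exact: differentiable_cst|exact: differentiableM].
rewrite derive_cst add0r derive_mul// derive_cst mulr0 addr0.
rewrite normrM ger0_norm// ler_wpM2l// derive_sqrt_comp//; last exact: c1at_differentiable.
rewrite derive_add; [|exact: c1at_differentiable (c1at_dist2 _ _)|exact: differentiable_cst].
have S0 : 0 < Num.sqrt (q x) by rewrite sqrtr_gt0.
rewrite derive_cst addr0 derive_dist2 invfM mulrACA mulVf// mul1r normrM.
rewrite ger0_norm ?invr_ge0 ?(ltW S0)// mulrC ler_pdivrMr//.
apply: le_trans (normr_dot_le _ _) _.
by rewrite ler_wpM2l ?enorm_ge0.
Qed.

Lemma finite_net c r d : 0 < d -> exists l : seq 'rV[R]_n,
  forall x, enorm (x - c) <= r -> exists2 y, y \in l & enorm (x - y) < d.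
Proof.
move=> d0; have := @compact_ecball R n c r; rewrite compact_cover => cov.
have [|x _|D _ hD] := cov _ setT (fun y => eball y d).
- by move=> y _; exact: open_eball.
- by exists x => //; exact: eball_center.
exists (finmap.enum_fset D) => x /hD[y Dy xy]; exists y => //.
Qed.

(** An [L]-Lipschitz [f] is the infimum over [y] of the cones [f y + L * enorm (x - y)]. Taking a
    smooth minimum of smoothed cones over a finite net gives a C^1 function with exactly the same
    constant [L]. *)
Lemma c1lip_approx f L c r tau : 0 <= L -> (forall x y, `|f x - f y| <= L * enorm (x - y)) ->
  0 < tau -> exists2 h, c1lip L h & forall x, enorm (x - c) <= r -> `|h x - f x| <= tau.
Proof.
move=> L0 fL tau0.
(* Passing to a net point costs [2 * L * d <= tau / 4], smoothing the cones [L * eta <= tau / 4],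
   the soft minimum [tau / 4]. The [+ 1] covers [L = 0]. *)
pose d := tau / (8 * (L + 1)); pose eta := tau / (4 * (L + 1)).
have L1 : 0 < L + 1 by lra.
have d0 : 0 < d by rewrite divr_gt0// mulr_gt0.
have eta0 : 0 < eta by rewrite divr_gt0// mulr_gt0.
have Ld : L * d <= tau / 8.
  have : (L + 1) * d = tau / 8 by rewrite /d; field; rewrite gt_eqF.
  by lra.
have Leta : L * eta <= tau / 4.
  have : eta = 2 * d by rewrite /eta /d; field; rewrite gt_eqF.
  by move=> ->; lra.
have cone y := @c1lip_cone L y (f y) eta L0 eta0.
have [F hF] := choice (fun y => let: ex_intro2 h h1 h2 := cone y in ex_intro _ h (conj h1 h2)).
have [l hl] := finite_net c r d0.
have [h hL hP] := @c1lip_softmin _ L F c l (tau / 4) ltac:(by rewrite divr_gt0) (fun y => (hF y).1).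
exists h => // x xr; have [h1 [y yl h2]] := hP x; have [z zl xz] := hl x xr.
have {}h1 := h1 z ltac:(by rewrite inE zl orbT).
have /andP[f1 _] := (hF y).2 x; have /andP[_ f2] := (hF z).2 x.
have := fL x y; have := fL z x; rewrite !ler_norml => /andP[_ k1] /andP[_ k2].
have : L * enorm (x - z) <= L * d by rewrite ler_wpM2l// ltW.
rewrite (enormC z x) in k1; rewrite mulrDr in f2; lra.
Qed.

(** All that gluing asks of a tolerance. Unlike continuity, it is also easy to check for distances
    to sets that vary with the point. *)
Definition locally_positive (O : set 'rV[R]_n) (eps : 'rV[R]_n -> R) :=
  forall x, O x -> exists2 e, 0 < e & \forall y \near x, e <= eps y.

(* [Q] distinguishes approximation with ([True]) and without ([False]) control of the
   derivative; [V] is a neighborhood of the support of [f]. *)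
Lemma glue_approximations (O V : set 'rV[R]_n) f eps L (Q : Prop) :
  open O -> open V -> locally_positive O eps ->
  (forall x, ~ V x -> \forall y \near x, f y = 0) -> 0 <= L ->
  (forall x, O x -> exists2 rho, 0 < rho &
     forall tau, 0 < tau -> exists h, (forall z, c1at h z) /\
     forall z, enorm (z - x) < rho -> `|h z - f z| <= eps z / 2 /\
       (Q -> `|h z - f z| <= tau /\ forall v, `|'D_v h z| <= L * enorm v)) ->
  exists g, forall x, O x -> [/\ c1at g x, `|g x - f x| < eps x,
    Q -> forall v, `|'D_v g x| <= (L + eps x) * enorm v &
    ~ V x -> \forall y \near x, g y = 0].
Proof.
move=> Oo Vo epsp fV L0 H.
have [[x0 Ox0]|O0] := pselect (O !=set0); last first.
  by exists (fun=> 0) => x Ox; exfalso; apply: O0; exists x.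
(* The alternative between lying in [V] and lying in the zero set of [f] makes it possible to take 0
   as approximant on the balls that leave [V]. *)
pose P c s := [/\ (exists2 e, 0 < e & forall z, eball c (2 * s) z -> e <= eps z),
  (eball c (2 * s) `<=` V \/ forall z, eball c (2 * s) z -> f z = 0) &
  forall tau, 0 < tau -> exists h, (forall z, c1at h z) /\
     forall z, eball c (2 * s) z -> `|h z - f z| <= eps z / 2 /\
       (Q -> `|h z - f z| <= tau /\ forall v, `|'D_v h z| <= L * enorm v)].
have [|x Ox|c [s [psi [pou hP]]]] := @partition_of_unity_exists R n O P.
- by exists x0.
- have [rho1 rho10 h1] := H _ Ox.
  have [e e0 /nbhs_eballP[rho2 rho20 h2]] := epsp _ Ox.
  have [rho3 rho30 h3] : exists2 rho, 0 < rho &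
      (eball x rho `<=` V \/ forall z, eball x rho z -> f z = 0).
    have [Vx|nVx] := pselect (V x).
      by have /nbhs_eballP[r r0 rV] := open_nbhs_nbhs (conj Vo Vx); exists r => //; left.
    by have /nbhs_eballP[r r0 rV] := fV _ nVx; exists r => //; right.
  exists (Num.min rho1 (Num.min rho2 rho3) / 3); first by rewrite divr_gt0// !lt_min rho10 rho20.
  move=> c s s0 ss cx.
  have sub r : Num.min rho1 (Num.min rho2 rho3) <= r -> eball c (2 * s) `<=` eball x r.
    by move=> hr; apply: sub_eball; lra.
  have sub1 : eball c (2 * s) `<=` eball x rho1 by apply: sub; rewrite ge_min lexx.
  have sub2 : eball c (2 * s) `<=` eball x rho2 by apply: sub; rewrite !ge_min lexx orbT.
  have sub3 : eball c (2 * s) `<=` eball x rho3 by apply: sub; rewrite !ge_min lexx !orbT.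
  split.
  + by exists e => // z /sub2/h2.
  + by case: h3 => h3; [left => z /sub3/h3|right => z /sub3/h3].
  + by move=> tau /h1[h [ch hh]]; exists h; split => // z /sub1/hh.
have [N pouN] := pou_index pou.
have hh i : exists h, [/\ (forall z, c1at h z),
    (forall z, eball (c i) (2 * s i) z -> `|h z - f z| <= eps z / 2),
    (Q -> forall z, eball (c i) (2 * s i) z -> (forall v, `|'D_v h z| <= L * enorm v) /\
       forall v, `|(h z - f z) * 'D_v (psi i) z| <= 2^-1 ^+ i.+1 * eps z * enorm v) &
    (eball (c i) (2 * s i) `<=` V \/ forall z, h z = 0)].
  have [[e e0 he] [hV|hf] happ] := hP i.
    have [G G0 hG] := pou_bounded_derive pou i.
    have h2 : (0 : R) < 2^-1 ^+ i.+1 by rewrite exprn_gt0.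
    (* [G] bounds the derivative of [psi i], so with this accuracy the [i]-th error term in the
       derivative is at most [2^-1 ^+ i.+1] times [eps], and these terms sum to at most [eps]. *)
    have tau0 : 0 < 2^-1 ^+ i.+1 * e / (G + 1) by rewrite divr_gt0 ?mulr_gt0// ltr_wpDl.
    have [h [ch H1]] := happ _ tau0; exists h; split => //; last by left.
      by move=> z /H1[].
    move=> q z zi; have [_ /(_ q)[H2 H3]] := H1 z zi; split => // v.
    rewrite normrM; apply: le_trans (ler_pM _ _ H2 (hG z v)) _ => //.
    rewrite -!mulrA !ler_wpM2l// ?(ltW h2)// mulrA.
    have := he _ zi; have := @enorm_ge0 _ _ v; move: (enorm v) (eps z) => a b a0 eb.
    rewrite mulrA ler_wpM2r//; apply: le_trans eb.
    by rewrite mulrAC ler_pdivrMr ?ltr_wpDl// ler_pM2l// lerDl.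
  exists (fun=> 0); split => [z|z zi|q z zi|]; last by right.
  - exact: c1at_cst.
  - by rewrite hf// subrr normr0 divr_ge0// (le_trans (ltW e0))// he.
  split=> v; first by rewrite derive_cst normr0 mulr_ge0 ?enorm_ge0.
  rewrite hf// subrr mul0r normr0 !mulr_ge0 ?enorm_ge0//.
  by rewrite (le_trans (ltW e0))// he.
have {hh}[h hh] := choice hh.
have hc1 i z : eball (c i) (2 * s i) z -> c1at (h i) z by have [] := hh i.
exists (glued psi N h) => x Ox.
have p01 i := pou_ge0_le1 pou i x.
have sum1 := sum_psi pouN Ox.
have wsum a : \sum_(i < N x) psi i x * a = a by rewrite -mulr_suml sum1 mul1r.
have eps0 : 0 < eps x by have [e e0 /nbhs_singleton] := epsp _ Ox; exact: lt_le_trans.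
split.
- exact (c1at_glue Oo pou pouN hc1 Ox).
- apply: (@le_lt_trans _ _ (eps x / 2)); last by rewrite ltr_pdivrMr// ltr_pMr// ltr1n.
  rewrite /glued -[f x]wsum -sumrB.
  apply: le_trans (ler_norm_sum _ _ _) _.
  rewrite -[leRHS]wsum; apply: ler_sum => i _.
  have /andP[p0 _] := p01 i; rewrite -mulrBr normrM ger0_norm//.
  have [xi|xi] := pselect (eball (c i) (2 * s i) x); last by rewrite (psi_eq0 pou xi) !mul0r.
  by rewrite ler_wpM2l//; have [_ + _ _] := hh i; exact.
- move=> q v; rewrite (derive_glue Oo pou pouN hc1 v Ox).
  (* The derivatives of the [psi i] sum to 0, so [f x] can be subtracted: only the small differences
     [h i x - f x] multiply them. *)
  rewrite (_ : \sum_(i < N x) h i x * 'D_v (psi i) x =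
    \sum_(i < N x) (h i x - f x) * 'D_v (psi i) x); last first.
    under [RHS]eq_bigr do rewrite mulrBl.
    by rewrite sumrB -mulr_sumr (sum_derive_psi pou pouN v Ox) mulr0 subr0.
  rewrite mulrDl; apply: le_trans (ler_normD _ _) _; apply: lerD.
    rewrite -[leRHS]wsum; apply: le_trans (ler_norm_sum _ _ _) _.
    apply: ler_sum => i _; have /andP[p0 _] := p01 i; rewrite normrM ger0_norm//.
    have [xi|xi] := pselect (eball (c i) (2 * s i) x); last by rewrite (psi_eq0 pou xi) !mul0r.
    by rewrite ler_wpM2l//; have [_ _ /(_ q x xi)[]] := hh i.
  apply: (@le_trans _ _ (\sum_(i < N x) 2^-1 ^+ i.+1 * (eps x * enorm v))).
    apply: le_trans (ler_norm_sum _ _ _) _; apply: ler_sum => i _.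
    have [xi|xi] := pselect (eball (c i) (2 * s i) x).
      by rewrite mulrA; have [_ _ /(_ q x xi)[_]] := hh i.
    by rewrite (derive_psi_eq0 pou v xi) mulr0 normr0 !mulr_ge0 ?enorm_ge0// ltW.
  rewrite -mulr_suml ler_piMl ?mulr_ge0 ?enorm_ge0 ?(ltW eps0)//.
  suff -> M : \sum_(i < M) (2^-1 : R) ^+ i.+1 = 1 - 2^-1 ^+ M by rewrite lerBlDr lerDl exprn_ge0.
  elim: M => [|M IH]; first by rewrite big_ord0 expr0 subrr.
  by rewrite big_ord_recr/= IH exprS; field.
(* A ball contained in [V] misses [x], so its [psi i] vanishes near [x]; for the other balls [h i]
   is 0. *)
- move=> nVx; have gn := glue_near Oo pouN h Ox.
  have : \forall y \near x, forall i : 'I_(N x), psi i y * h i y = 0.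
    apply: near_forall => i; have [_ _ _ [hV|h0]] := hh i; last first.
      by apply: near_all => y; rewrite h0 mulr0.
    have /negP : ~ eball (c i) (2 * s i) x by move=> /hV.
    by rewrite -leNgt => /(pou_support pou); apply: filterS => y ->; rewrite mul0r.
  by apply: filterS2 gn => y -> hy; rewrite big1.
Qed.

Lemma smooth_approx_lipschitz (O V : set 'rV[R]_n) f eps L :
  open O -> open V -> locally_positive O eps ->
  (forall x, ~ V x -> \forall y \near x, f y = 0) -> 0 <= L ->
  (forall x y, `|f x - f y| <= L * enorm (x - y)) ->
  exists g, forall x, O x -> [/\ c1at g x, `|g x - f x| < eps x,
    forall v, `|'D_v g x| <= (L + eps x) * enorm v & ~ V x -> \forall y \near x, g y = 0].
Proof.
move=> Oo Vo ep fV L0 fL.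
have [|g hg] := @glue_approximations O V f eps L True Oo Vo ep fV L0.
  move=> x Ox; have [e e0 /nbhs_eballP[rho rho0 he]] := ep _ Ox.
  exists rho => // tau tau0.
  have m0 : 0 < Num.min tau (e / 2) by rewrite lt_min tau0 divr_gt0.
  have [h [ch dh] hf] := @c1lip_approx f L x rho _ L0 fL m0.
  exists h; split => // z zx; have {}hf := hf z (ltW zx); split => [|_].
    apply: le_trans hf _; rewrite ge_min; apply/orP; right.
    by rewrite ler_pM2r//; exact: he.
  by split => //; apply: le_trans hf _; rewrite ge_min lexx.
by exists g => x /hg[g1 g2 /(_ I) g3 g4].
Qed.

(** With [Q] false no derivative bound is sought, and the constant [f x] is a good enough
    approximant on a small ball around [x]. *)
Lemma smooth_approx_continuous (O V : set 'rV[R]_n) f eps :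
  open O -> open V -> locally_positive O eps ->
  (forall x, ~ V x -> \forall y \near x, f y = 0) -> continuous f ->
  exists g, forall x, O x -> [/\ c1at g x, `|g x - f x| < eps x &
     ~ V x -> \forall y \near x, g y = 0].
Proof.
move=> Oo Vo ep fV fc.
have [|g hg] := @glue_approximations O V f eps 0 False Oo Vo ep fV (lexx _).
  move=> x Ox; have [e e0 /nbhs_eballP[rho1 rho10 he]] := ep _ Ox.
  have e2 : 0 < e / 2 by rewrite divr_gt0.
  have [rho2 rho20 hf] := (continuousR_eballP f x).1 (fc x) _ e2.
  exists (Num.min rho1 rho2); first by rewrite lt_min rho10.
  move=> tau _; exists (fun=> f x); split => [z|z]; first exact: c1at_cst.
  rewrite lt_min => /andP[z1 z2]; split => //.
  rewrite distrC; apply: le_trans (ltW (hf _ z2)) _.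
  by rewrite ler_pM2r//; exact: he.
by exists g => x /hg[g1 g2 _ g4].
Qed.

End smoothing.

(** * Regularized distances *)

Section distance.
Context {R : realType} {n : nat}.
Implicit Types (x y : 'rV[R]_n) (S : set 'rV[R]_n).

(* Truncating at 1 avoids the junk value of the infimum when [S] is empty. *)
Definition tdist S x : R :=
  inf [set t | exists y, t = (if pselect (S y) then 0 else 1) + enorm (x - y)].

Let tdist_set S x := [set t : R | exists y, t = (if pselect (S y) then 0 else 1) + enorm (x - y)].

Let tdist_set_ge0 S x : lbound (tdist_set S x) 0.
Proof. by move=> _ [y ->]; rewrite addr_ge0 ?enorm_ge0//; case: pselect. Qed.

Let tdist_set_inf S x : has_inf (tdist_set S x).
Proof.
split; last by exists 0; exact: tdist_set_ge0.
by eexists; exists x.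
Qed.

Lemma tdist_ge0 S x : 0 <= tdist S x.
Proof. by apply: lb_le_inf; [exact: (tdist_set_inf S x).1|exact: tdist_set_ge0]. Qed.

Lemma tdist_le S x y : S y -> tdist S x <= enorm (x - y).
Proof.
move=> Sy; apply: ge_inf; first exact: (tdist_set_inf S x).2.
by exists y; case: pselect => //= _; rewrite add0r.
Qed.

Lemma tdist_lt S x t : tdist S x < t -> t <= 1 -> exists2 y, S y & enorm (x - y) < t.
Proof.
move=> xt t1; have [_ [y ->] yt] := inf_lt (tdist_set_inf S x).1 xt.
move: yt; case: pselect => /= [Sy|_]; first by rewrite add0r; exists y.
by have := @enorm_ge0 _ _ (x - y); move: (enorm _) => e; lra.
Qed.

Lemma tdist_lipschitz S x y : `|tdist S x - tdist S y| <= enorm (x - y).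
Proof.
wlog suff H : x y / tdist S x - tdist S y <= enorm (x - y).
  by rewrite ler_norml H andbT lerNl opprB enormC H.
suff : tdist S x - enorm (x - y) <= tdist S y by lra.
apply: lb_le_inf; first exact: (tdist_set_inf S y).1.
move=> _ [z ->]; rewrite lerBlDr -addrA.
apply: (@le_trans _ _ ((if pselect (S z) then 0 else 1) + enorm (x - z))).
  by apply: ge_inf; [exact: (tdist_set_inf S x).2|exists z].
by rewrite lerD2l addrC; exact: ler_enorm_trans.
Qed.

Lemma tdist0 S x : S x -> tdist S x = 0.
Proof.
by move=> Sx; apply/eqP; rewrite eq_le tdist_ge0 andbT (le_trans (tdist_le x Sx))// subrr enorm0.
Qed.

Lemma tdist_gt0 S x : closed S -> ~ S x -> 0 < tdist S x.
Proof.
move=> Sc nSx; rewrite lt_def tdist_ge0 andbT; apply/negP => /eqP x0.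
have /nbhs_eballP[r r0 rS] : nbhs x (~` S).
  by apply: open_nbhs_nbhs; split => //; exact: closed_openC.
have xr : tdist S x < Num.min r 1 by rewrite x0 lt_min r0 ltr01.
have [|y Sy xy] := tdist_lt xr; first by rewrite ge_min lexx orbT.
apply: (rS y) => //; rewrite /eball/= enormC.
by apply: lt_le_trans xy _; rewrite ge_min lexx.
Qed.

Lemma tdist_locally_positive S : closed S -> locally_positive (~` S) (tdist S).
Proof.
move=> Sc x nSx; have d0 := tdist_gt0 Sc nSx.
exists (tdist S x / 2); first by rewrite divr_gt0.
apply/nbhs_eballP; exists (tdist S x / 2); first by rewrite divr_gt0.
move=> y; rewrite /eball/= => yx.
by have := tdist_lipschitz S y x; rewrite ler_norml => /andP[+ _]; lra.
Qed.

Lemma locally_positive_min (O : set 'rV[R]_n) (a b : 'rV[R]_n -> R) :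
  locally_positive O a -> locally_positive O b ->
  locally_positive O (fun x => Num.min (a x) (b x)).
Proof.
move=> Oa Ob x Ox; have [d d0 hd] := Oa x Ox; have [e e0 he] := Ob x Ox.
exists (Num.min d e); first by rewrite lt_min d0.
apply: filterS2 hd he => y dy ey.
by rewrite le_min !ge_min dy ey orbT.
Qed.

Lemma locally_positive_cst (O : set 'rV[R]_n) (e : R) : 0 < e -> locally_positive O (fun=> e).
Proof. by move=> e0 x _; exists e => //; exact: near_all. Qed.

Lemma locally_positive_scale (O : set 'rV[R]_n) (a : 'rV[R]_n -> R) (k : R) : 0 < k ->
  locally_positive O a -> locally_positive O (fun x => k * a x).
Proof.
move=> k0 Oa x Ox; have [e e0 he] := Oa x Ox; exists (k * e); first exact: mulr_gt0.
by apply: filterS he => y; rewrite ler_pM2l.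
Qed.

Lemma locally_positive_sqr (O : set 'rV[R]_n) (a : 'rV[R]_n -> R) :
  locally_positive O a -> locally_positive O (fun x => a x ^+ 2).
Proof.
move=> Oa x Ox; have [e e0 he] := Oa x Ox; exists (e ^+ 2); first exact: exprn_gt0.
by apply: filterS he => y ey; rewrite lerXn2r// nnegrE ?(ltW e0)// (le_trans (ltW e0)).
Qed.

Lemma locally_positive_gt0 (O : set 'rV[R]_n) (a : 'rV[R]_n -> R) x :
  locally_positive O a -> O x -> 0 < a x.
Proof. by move=> Oa /Oa[e e0 /nbhs_singleton]; exact: lt_le_trans. Qed.

Lemma locally_positive_continuous (O : set 'rV[R]_n) (a : 'rV[R]_n -> R) :
  (forall x, O x -> {for x, continuous a} /\ 0 < a x) -> locally_positive O a.
Proof.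
move=> H x /H[/continuousR_eballP ac a0]; exists (a x / 2); first by rewrite divr_gt0.
have [r r0 hr] := ac (a x / 2) ltac:(by rewrite divr_gt0).
apply/nbhs_eballP; exists r => // y /hr; rewrite ltr_norml => /andP[+ _]; lra.
Qed.

(** Lipschitz smoothing of the 1-Lipschitz function [tdist S], with an error at most half its value.
    Capping the tolerance at 1 bounds the derivative by [1 + 1]. *)
Lemma regularized_distance S : closed S -> exists rho : 'rV[R]_n -> R, forall x, ~ S x ->
  [/\ c1at rho x, tdist S x / 2 <= rho x <= 2 * tdist S x &
      forall v, `|'D_v rho x| <= 2 * enorm v].
Proof.
move=> Sc.
have [||||||g hg] := @smooth_approx_lipschitz R n (~` S) setT (tdist S)
  (fun x => Num.min 1 (2^-1 * tdist S x)) 1.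
- exact: closed_openC.
- exact: openT.
- apply: locally_positive_min; first exact: locally_positive_cst.
  by apply: locally_positive_scale => //; exact: tdist_locally_positive.
- by move=> x /(_ I).
- by [].
- by move=> x y; rewrite mul1r; exact: tdist_lipschitz.
exists g => x /hg[cg + dg _]; rewrite lt_min => /andP[_].
rewrite ltr_norml => /andP[g1 g2]; split => //.
  by apply/andP; split; have := tdist_ge0 S x; lra.
move=> v; apply: le_trans (dg v) _; rewrite ler_wpM2r ?enorm_ge0//.
by rewrite -[2]/(1 + 1) lerD2l ge_min lexx.
Qed.

End distance.

(** * Tangent spaces and Newton steps *)

Section first_order.
Context {R : realType} {n : nat}.
Implicit Types (f g : 'rV[R]_n -> R) (x h : 'rV[R]_n).

Lemma differentiable_first_order f x : differentiable f x ->
  forall e, 0 < e -> exists2 r, 0 < r & forall y, enorm (y - x) < r ->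
    `|f y - f x - dot (y - x) (gradient f x)| <= e * enorm (y - x).
Proof.
move=> df e e0; have /nbhs_eballP[r r0 H] := differentiable_eps df e0.
exists r => // y yx; have := H (y - x); rewrite /eball/= subr0 subrK => /(_ yx).
rewrite -(deriveE _ df) derive_gradient// => /le_trans; apply.
by rewrite ler_wpM2l ?(ltW e0)// norm_le_enorm.
Qed.

Lemma near_enorm x (P : 'rV[R]_n -> Prop) : (\forall y \near x, P y) ->
  exists2 r, 0 < r & forall y, enorm (y - x) < r -> P y.
Proof. by move=> /nbhs_eballP. Qed.

(** Tangency in terms of the set alone: [M] has points within [o(t)] of [x + t *: h] as [t]
    decreases to 0. It mediates between two local equations of the same manifold. *)
Definition secant_limit (M : set 'rV[R]_n) x h := forall c, 0 < c ->
  exists2 t0, 0 < t0 & forall t, 0 < t < t0 ->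
    exists2 y, M y & enorm (y - (x + t *: h)) <= c * t.

(** Expand [g] to first order at points of [M] close to [x + t *: h], where it vanishes: [t] times
    the derivative is then at most a small multiple of [t]. *)
Lemma derive_secant_limit M g x h : M x -> differentiable g x ->
  (\forall y \near x, M y -> g y = 0) -> secant_limit M x h -> 'D_h g x = 0.
Proof.
move=> Mx dg gM hM; apply/eqP; apply/negP => /negP D0.
pose d := `|'D_h g x|; have d0 : 0 < d by rewrite normr_gt0.
have dE : d = `|dot h (gradient g x)| by rewrite /d derive_gradient.
set G := gradient g x in dE *.
have h1 : 0 < enorm h + 1 by rewrite ltr_wpDl ?enorm_ge0.
have G1 : 0 < enorm G + 1 by rewrite ltr_wpDl ?enorm_ge0.
(* [e] and [c] make the Taylor error and the deviation from the line at most [t * (d / 4)] each,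
   together less than [t * d]. *)
pose e := d / 4 / (enorm h + 1); have e0 : 0 < e by rewrite !divr_gt0.
pose c := Num.min 1 (d / 4 / (enorm G + 1)).
have c0 : 0 < c by rewrite lt_min ltr01 !divr_gt0.
have c1 : c <= 1 by rewrite ge_min lexx.
have cG : c * enorm G <= d / 4.
  apply: (@le_trans _ _ (d / 4 / (enorm G + 1) * enorm G)).
    by rewrite ler_wpM2r ?enorm_ge0// ge_min lexx orbT.
  by rewrite mulrAC ler_pdivrMr// ler_pM2l ?divr_gt0// lerDl.
have [r1 r10 H1] := differentiable_first_order dg e0.
have [r2 r20 H2] := near_enorm gM.
have [t0 t00 H3] := hM c c0.
pose t := Num.min t0 (Num.min r1 r2 / (enorm h + 1)) / 2.
have m0 : 0 < Num.min r1 r2 by rewrite lt_min r10.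
have tm0 : 0 < Num.min t0 (Num.min r1 r2 / (enorm h + 1)) by rewrite lt_min t00 divr_gt0.
have tpos : 0 < t by rewrite divr_gt0.
have tt0 : t < t0.
  by apply: (@lt_le_trans _ _ (Num.min t0 (Num.min r1 r2 / (enorm h + 1))));
    [rewrite /t; lra|rewrite ge_min lexx].
have thr : t * (enorm h + 1) < Num.min r1 r2.
  rewrite -ltr_pdivlMr//.
  by apply: (@lt_le_trans _ _ (Num.min t0 (Num.min r1 r2 / (enorm h + 1))));
    [rewrite /t; lra|rewrite ge_min lexx orbT].
have [|y My yh] := H3 t; first by rewrite tpos.
pose dl := y - (x + t *: h).
have yxE : y - x = t *: h + dl by apply/rowP => i; rewrite /dl !mxE; ring.
have yx : enorm (y - x) <= t * (enorm h + c).
  rewrite yxE; apply: le_trans (ler_enormD _ _) _; rewrite enormZ gtr0_norm//.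
  by rewrite mulrDr lerD2l mulrC.
have yxr : enorm (y - x) < Num.min r1 r2.
  by apply: le_lt_trans yx _; apply: le_lt_trans thr; rewrite ler_pM2l// lerD2l.
have yr1 : enorm (y - x) < r1 by apply: lt_le_trans yxr _; rewrite ge_min lexx.
have yr2 : enorm (y - x) < r2 by apply: lt_le_trans yxr _; rewrite ge_min lexx orbT.
have := H1 y yr1; rewrite (H2 y yr2 My) (nbhs_singleton gM Mx) subrr sub0r normrN.
rewrite -/G yxE dotDl dotZl -yxE => H4.
have H5 : t * d <= e * enorm (y - x) + enorm dl * enorm G.
  have -> : t * d = `|t * dot h G| by rewrite normrM (gtr0_norm tpos) dE.
  have := normr_dot_le dl G; move: H4.
  move: (t * dot h G) (dot dl G) (e * _) (enorm dl * _) => a b p q h2 h3.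
  by have := ler_normB (a + b) b; rewrite addrK; lra.
have H6 : e * enorm (y - x) <= t * (d / 4).
  apply: (@le_trans _ _ (e * (t * (enorm h + 1)))).
    by rewrite ler_pM2l//; apply: le_trans yx _; rewrite ler_pM2l// lerD2l.
  by rewrite /e mulrCA divfK ?gt_eqF.
have H7 : enorm dl * enorm G <= t * (d / 4).
  apply: (@le_trans _ _ (c * t * enorm G)); first by rewrite ler_wpM2r ?enorm_ge0.
  by rewrite -mulrA mulrCA ler_pM2l.
have : 0 < t * d by rewrite mulr_gt0.
by move: H5 H6 H7; rewrite mulrA; lra.
Qed.

End first_order.

(** * Zeros of maps close to the identity *)

Section near_identity.
Context {R : realType}.

(** Minimize the norm of [G] on the closed ball. At a minimizer [a], closeness to the identity gives
    [enorm a <= 4 * enorm (G 0)], so [a - G a] is still in the ball; there [G] is at most half as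
    large, which forces [G a = 0]. *)
Lemma near_identity_zero k (G : 'rV[R]_k -> 'rV[R]_k) rho :
  (forall a b, enorm a <= rho -> enorm b <= rho ->
     enorm (G a - G b - (a - b)) <= enorm (a - b) / 2) ->
  5 * enorm (G 0) <= rho -> exists2 a, enorm a <= 4 * enorm (G 0) & G a = 0.
Proof.
move=> H G0; have G00 := @enorm_ge0 _ _ (G 0).
have rho0 : 0 <= rho by apply: le_trans G0; rewrite mulr_ge0.
have Glip a b : enorm a <= rho -> enorm b <= rho ->
    `|enorm (G a) - enorm (G b)| <= 2 * enorm (a - b).
  move=> ha hb; apply: le_trans (ler_enorm_dist _ _) _.
  have := ler_enormD (G a - G b - (a - b)) (a - b); rewrite subrK.
  by have := H a b ha hb; have := @enorm_ge0 _ _ (a - b); lra.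
have [] := @EVT_min_rV R k (fun a => enorm (G a)) (ecball 0 rho).
- by exists 0; rewrite /ecball/= subrr enorm0.
- exact: compact_ecball.
- apply/subspace_continuousP => a; rewrite /ecball/= subr0 => ha.
  apply/cvgrPdist_lt => e e0; rewrite near_withinE; apply/nbhs_eballP.
  exists (e / 2); first by rewrite divr_gt0.
  move=> b; rewrite /eball/= subr0 => ba hb.
  by have := Glip a b ha hb; rewrite (enormC a b); lra.
move=> a; rewrite inE /ecball/= subr0 => ha amin.
have in_ball b : enorm b <= rho -> b \in (ecball 0 rho : set 'rV[R]_k).
  by move=> hb; rewrite inE /ecball/= subr0.
have aG0 : enorm (G a) <= enorm (G 0) by apply: amin; rewrite in_ball// enorm0.
have a4 : enorm a <= 4 * enorm (G 0).
  have := H a 0 ha; rewrite enorm0 subr0 => /(_ rho0).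
  rewrite enormC => h; have := ler_enormD (a - (G a - G 0)) (G a - G 0); rewrite subrK.
  by have := ler_enormB (G a) (G 0); lra.
exists a => //; apply/eqP; rewrite -enorm_eq0; apply/eqP.
have ha' : enorm (a - G a) <= rho by have := ler_enormB a (G a); lra.
have := amin (a - G a) (in_ball _ ha'); have := H (a - G a) a ha' ha.
rewrite [a - _ - _]addrC addKr opprK enormN => h1 h2.
have h3 : enorm (G (a - G a)) <= enorm (G a) / 2.
  by move: h1; rewrite -addrA addNr addr0.
by have := @enorm_ge0 _ _ (G a); lra.
Qed.

Lemma ler_enorm_sum n I (l : seq I) (F : I -> 'rV[R]_n) :
  enorm (\sum_(i <- l) F i) <= \sum_(i <- l) enorm (F i).
Proof.
elim: l => [|i l IH]; first by rewrite !big_nil enorm0.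
by rewrite !big_cons; apply: le_trans (ler_enormD _ _) _; rewrite lerD2l.
Qed.

Lemma enorm_mulmx_le k n (K : 'M[R]_(k, n)) :
  exists2 C, 0 < C & forall a : 'rV[R]_k, enorm (a *m K) <= C * enorm a.
Proof.
exists (1 + \sum_(i < k) enorm (row i K)).
  by rewrite ltr_pwDl// sumr_ge0// => i _; exact: enorm_ge0.
move=> a; rewrite mulmx_sum_row; apply: le_trans (ler_enorm_sum _ _) _.
rewrite mulrDl mul1r ler_wpDl ?enorm_ge0// mulr_suml; apply: ler_sum => i _.
by rewrite enormZ mulrC ler_wpM2l ?enorm_ge0// coord_le_enorm.
Qed.

End near_identity.

Section tangent.
Context {R : realType} {n : nat}.
Implicit Types (M U : set 'rV[R]_n) (x y h u : 'rV[R]_n).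

Lemma smooth_on1_row k U (F : 'rV[R]_n -> 'rV[R]_k) : open U -> smooth_on 1 U F ->
  forall z, U z -> differentiable F z /\ forall j, c1at (fun y => F y 0 j) z.
Proof.
move=> Uo [dF cF] z Uz; split; first exact: dF.
have nU := open_nbhs_nbhs (conj Uo Uz).
move=> j; split; first by apply: filterS nU => y /dF; exact: differentiable_rowE.
move=> v; apply: (@near_eq_continuous _ _ _ (fun y => ('D_v F y) 0 j)).
  by apply: filterS nU => y /dF dFy; rewrite derive_row.
apply: (@continuous_comp _ _ _ (fun y => 'D_v F y) (fun w : 'rV[R]_k => w 0 j)).
  exact: cF.
exact: coord_continuous.
Qed.

Lemma smooth_on2_smooth_on1 (V W : normedModType R) (U : set V) (F : V -> W) :
  smooth_on 2 U F -> smooth_on 1 U F.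
Proof.
move=> [dF cF]; split => // v x Ux.
by have [+ _] := cF v; move=> /(_ x Ux); exact: differentiable_continuous.
Qed.

Lemma local_equation21 k M x U (F : 'rV[R]_n -> 'rV[R]_k) :
  local_equation 2 M x U F -> local_equation 1 M x U F.
Proof. by move=> [? /smooth_on2_smooth_on1]. Qed.

Lemma local_equation_center k p M x U (F : 'rV[R]_n -> 'rV[R]_k) : M x ->
  local_equation p M x U F -> U x /\ F x = 0.
Proof. by move=> Mx [[_ Ux] _ /seteqP[/(_ x (conj Mx Ux))]]. Qed.

(* Lyusternik's theorem: [a |-> F (x + t h + a K)], where K is a right inverse of the
   derivative, is close to the identity, so [x + t h] can be corrected to a zero of F. *)
Lemma secant_limit_kernel k M x U (F : 'rV[R]_n -> 'rV[R]_k) h : M x ->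
  local_equation 1 M x U F -> 'd F x h = 0 -> secant_limit M x h.
Proof.
move=> Mx eqF dFh.
have [[Uo Ux] smF MU rkF] := eqF.
have Fx := (local_equation_center Mx eqF).2.
have dFx := (smooth_on1_row Uo smF Ux).1.
set J := jacobian F x in rkF.
have dFJ v : 'D_v F x = v *m J by rewrite deriveEjacobian.
have /row_fullP[K KJ] : row_full J by rewrite /row_full rkF.
have [C C0 hC] := enorm_mulmx_le K.
(* [psi j] is a component of [F] without its linear part at [x], so its gradient is small near [x].
   The value of [kap] gives the factor 1/2 of [near_identity_zero] after summing components and
   applying [K]. *)
pose psi j z : R := F z 0 j - dot z (gradient (fun y => F y 0 j) x).
pose kap := (C * 2 * k.+1%:R)^-1.
have kap0 : 0 < kap by rewrite invr_gt0 !mulr_gt0.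
have gradJ j v : dot v (gradient (fun y => F y 0 j) x) = (v *m J) 0 j.
  by rewrite -dFJ derive_row// derive_gradient//; exact: differentiable_rowE.
have near_psi : \forall z \near x, [/\ U z, (forall j, differentiable (psi j) z) &
    (forall j, enorm (gradient (psi j) z) <= kap)].
  have dlin j z : differentiable (fun y : 'rV[R]_n => dot y (gradient (fun y => F y 0 j) x)) z.
    by apply: (@differentiable_dot _ _ _ id).
  have Dpsi j z v : U z -> 'D_v (psi j) z =
      dot v (gradient (fun y => F y 0 j) z - gradient (fun y => F y 0 j) x).
    move=> Uz; have dFz := differentiable_rowE j (smooth_on1_row Uo smF Uz).1.
    rewrite derive_add//; last exact: differentiableN.
    rewrite deriveN; last exact: diff_derivable.
    by rewrite derive_gradient// (@derive_dot _ _ _ id)// derive_id dotBr.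
  have nU := open_nbhs_nbhs (conj Uo Ux).
  have ngrad : \forall z \near x, forall j,
      enorm (gradient (fun y => F y 0 j) z - gradient (fun y => F y 0 j) x) <= kap.
    apply: near_forall => j.
    have cg := c1at_gradient ((smooth_on1_row Uo smF Ux).2 j).
    have := near_comp cg (nbhs_eball (gradient (fun y => F y 0 j) x) kap0).
    by apply: filterS => z /ltW.
  apply: filterS2 nU ngrad => z Uz gz; split => // j.
    apply: differentiableB => //.
    exact: differentiable_rowE j (smooth_on1_row Uo smF Uz).1.
  by rewrite (gradient_unique (fun v => Dpsi j z v Uz)).
have [rho rho0 hrho] := near_enorm near_psi.
have psi_lip j a b : enorm (a - x) < rho -> enorm (b - x) < rho ->
    `|psi j b - psi j a| <= kap * enorm (b - a).
  move=> ha hb; apply: (@gradient_lipschitz_eball _ _ _ x rho) => //; first exact: ltW.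
  by move=> z /hrho[].
move=> c c0.
pose rho' := rho / (2 * C); have rho'0 : 0 < rho' by rewrite divr_gt0// mulr_gt0.
have rho'C : C * rho' = rho / 2 by rewrite /rho'; field; rewrite gt_eqF.
have h1 : 0 < enorm h + 1 by rewrite ltr_wpDl ?enorm_ge0.
(* The 5 gives the hypothesis [5 * enorm (G 0) <= rho']; the 4 makes the correction [a *m K] at most
   [C * (4 * (t * (c / (4 * C)))) = c * t]. *)
pose e := Num.min (c / (4 * C)) (rho' / 5) / (k.+1%:R * (enorm h + 1)).
have m0 : 0 < Num.min (c / (4 * C)) (rho' / 5) by rewrite lt_min !divr_gt0// mulr_gt0.
have e0 : 0 < e by rewrite divr_gt0// mulr_gt0.
have nearF : \forall y \near x, forall j, `|F y 0 j - F x 0 j -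
    dot (y - x) (gradient (fun y => F y 0 j) x)| <= e * enorm (y - x).
  apply: near_forall => j.
  by have [r r0 hr] := differentiable_first_order (differentiable_rowE j dFx) e0;
    apply/nbhs_eballP; exists r.
have [r1 r10 hr1] := near_enorm nearF.
exists (Num.min 1 (Num.min r1 (rho / 2) / (enorm h + 1))).
  by rewrite lt_min ltr01 divr_gt0// lt_min r10 divr_gt0.
move=> t /andP[t0]; rewrite lt_min ltr_pdivlMr// lt_min => /andP[t1 /andP[tr1 trho]].
have th : enorm (t *: h) < t * (enorm h + 1).
  by rewrite enormZ gtr0_norm// ltr_pM2l// ltrDl.
pose G a := F (x + t *: h + a *m K).
have G0e : enorm (G 0) <= t * Num.min (c / (4 * C)) (rho' / 5).
  have Gj j : `|G 0 0 j| <= e * (t * (enorm h + 1)).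
    have := hr1 (x + t *: h); rewrite [x + _]addrC addrK => /(_ (lt_trans th tr1) j).
    rewrite /G mul0mx addr0 [x + _]addrC Fx mxE subr0 dotZl gradJ -dFJ deriveE// dFh mxE.
    rewrite mulr0 subr0 => /le_trans; apply.
    by rewrite ler_pM2l// ltW.
  apply: le_trans (enorm_le_norm _) _.
  apply: (@le_trans _ _ (k.+1%:R * (e * (t * (enorm h + 1))))).
    rewrite ler_pM2l// [leLHS]/Num.Def.normr/= mx_normrE bigmax_le//.
      exact: mulr_ge0 (ltW e0) (mulr_ge0 (ltW t0) (ltW h1)).
    by move=> [i j] _ /=; rewrite (ord1 i).
  rewrite le_eqVlt; apply/orP; left; apply/eqP; rewrite /e.
  by field; rewrite gt_eqF// addrC natr1 pnatr_eq0.
have in_rho a : enorm a <= rho' -> enorm (x + t *: h + a *m K - x) < rho.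
  move=> ha; rewrite -[x + _ + _]addrA [x + _]addrC addrK.
  apply: le_lt_trans (ler_enormD _ _) _.
  have : enorm (a *m K) <= rho / 2.
    by apply: le_trans (hC a) _; rewrite -rho'C ler_pM2l.
  by have := lt_trans th trho; lra.
have [||a ha Ga] := @near_identity_zero R k G rho'.
- move=> a b ha hb.
  have Ga j : `|(G a - G b - (a - b)) 0 j| <= kap * (C * enorm (a - b)).
    have abJ : (a - b) 0 j = dot (x + t *: h + a *m K - (x + t *: h + b *m K))
        (gradient (fun y => F y 0 j) x).
      rewrite opprD addrACA subrr add0r gradJ mulmxBl -!mulmxA KJ !mulmx1.
      by rewrite !mxE.
    have := psi_lip j _ _ (in_rho _ hb) (in_rho _ ha).
    rewrite (_ : psi j _ - psi j _ = (G a - G b - (a - b)) 0 j); last first.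
      rewrite [RHS]mxE [(- (a - b)) 0 j]mxE abJ /psi dotBl /G !mxE; ring.
    move=> /le_trans; apply; rewrite ler_pM2l//.
    by rewrite opprD addrACA subrr add0r -mulmxBl.
  apply: le_trans (enorm_le_norm _) _.
  apply: (@le_trans _ _ (k.+1%:R * (kap * (C * enorm (a - b))))).
    rewrite ler_pM2l// [leLHS]/Num.Def.normr/= mx_normrE bigmax_le//.
      exact: mulr_ge0 (ltW kap0) (mulr_ge0 (ltW C0) (enorm_ge0 _)).
    by move=> [i j] _ /=; rewrite (ord1 i).
  rewrite le_eqVlt; apply/orP; left; apply/eqP; rewrite /kap.
  by field; rewrite (gt_eqF C0) addrC natr1 pnatr_eq0.
- have : enorm (G 0) <= rho' / 5.
    apply: le_trans G0e _; apply: (@le_trans _ _ (1 * Num.min (c / (4 * C)) (rho' / 5))).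
      by rewrite ler_pM2r// ltW.
    by rewrite mul1r ge_min lexx orbT.
  by lra.
have aK : enorm (a *m K) <= c * t.
  apply: le_trans (hC a) _; apply: (@le_trans _ _ (C * (4 * (t * (c / (4 * C)))))).
    rewrite ler_pM2l//; apply: le_trans ha _; rewrite ler_pM2l//; apply: le_trans G0e _.
    by rewrite ler_pM2l// ge_min lexx.
  by rewrite le_eqVlt; apply/orP; left; apply/eqP; field; rewrite gt_eqF.
have a_rho : enorm a <= rho'.
  apply: le_trans ha _; have : enorm (G 0) <= rho' / 5.
    apply: le_trans G0e _; apply: (@le_trans _ _ (1 * Num.min (c / (4 * C)) (rho' / 5))).
      by rewrite ler_pM2r// ltW.
    by rewrite mul1r ge_min lexx orbT.
  by have := ltW rho'0; lra.
exists (x + t *: h + a *m K); last by rewrite [_ + a *m K]addrC addrK.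
have [Uy _ _] := hrho _ (in_rho _ a_rho).
by have /seteqP[_ /(_ _ (conj Uy Ga))[]] := MU.
Qed.

(** A vector killed by one local equation is a secant limit, and a secant limit is killed by every
    local equation: the tangent space does not depend on the equation, even if the numbers of
    components differ. *)
Lemma tangent_kernel k M x U (F : 'rV[R]_n -> 'rV[R]_k) h : M x ->
  local_equation 1 M x U F -> tangent M x h -> 'd F x h = 0.
Proof.
move=> Mx eqF [r [U' [F' [_ eqF' dF'h]]]].
have [[Uo Ux] smF MU _] := eqF.
have dF := (smooth_on1_row Uo smF Ux).1.
rewrite -(deriveE _ dF); apply/rowP => j; rewrite mxE derive_row//.
apply: (derive_secant_limit Mx (differentiable_rowE j dF)).
  apply: filterS (open_nbhs_nbhs (conj Uo Ux)) => y Uy My.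
  by have /seteqP[/(_ y (conj My Uy))[_ ->]] := MU; rewrite mxE.
exact: secant_limit_kernel eqF' dF'h.
Qed.

End tangent.

(** * Matrices depending on a point in a C^1 way *)

Section c1at_matrix.
Context {R : realType} {V : normedModType R}.

Definition c1at_mx m k (A : V -> 'M[R]_(m, k)) x := forall i j, c1at (fun y => A y i j) x.

Lemma c1at_mulmx m k l (A : V -> 'M[R]_(m, k)) (B : V -> 'M[R]_(k, l)) x :
  c1at_mx A x -> c1at_mx B x -> c1at_mx (fun y => A y *m B y) x.
Proof.
move=> cA cB i j; apply: (@c1at_near _ _ (fun y => \sum_k A y i k * B y k j)).
  by apply: near_all => y; rewrite mxE.
by apply: c1at_sum => l'; exact: c1atM.
Qed.

Lemma c1at_trmx m k (A : V -> 'M[R]_(m, k)) x : c1at_mx A x -> c1at_mx (fun y => (A y)^T) x.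
Proof.
move=> cA i j; apply: (@c1at_near _ _ (fun y => A y j i)); last exact: cA.
by apply: near_all => y; rewrite mxE.
Qed.

Lemma c1at_det m (A : V -> 'M[R]_m) x : c1at_mx A x -> c1at (fun y => \det (A y)) x.
Proof.
move=> cA; apply: c1at_sum => s; apply: c1atM; first exact: c1at_cst.
by apply: c1at_prod => i; exact: cA.
Qed.

Lemma c1at_invmx m (A : V -> 'M[R]_m) x : c1at_mx A x -> \det (A x) != 0 ->
  c1at_mx (fun y => invmx (A y)) x.
Proof.
move=> cA dA i j.
have cd := c1at_det cA.
apply: (@c1at_near _ _ (fun y => (\det (A y))^-1 * cofactor (A y) j i)).
  have : \forall y \near x, \det (A y) != 0.
    apply: (near_comp (c1at_continuous cd) (P := fun t => t != 0)).
    by apply: open_nbhs_nbhs; split => //; exact: open_neq.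
  apply: filterS => y dy.
  by rewrite /invmx unitmxE unitfE dy !mxE.
apply: c1atM; first exact: c1atV.
apply: c1atM; first exact: c1at_cst.
apply: c1at_det => i' j'.
apply: (@c1at_near _ _ (fun y => A y (lift j i') (lift i j'))); last exact: cA.
by apply: near_all => y; rewrite !mxE.
Qed.

End c1at_matrix.

Section gram.
Context {R : realType}.

(** If [v] kills the Gram matrix, then the square of the norm of [v *m J^T] is 0, and full rank
    gives [v = 0]. *)
Lemma gram_unitmx n k (J : 'M[R]_(n, k)) : (J^T *m J \in unitmx) = (\rank J == k).
Proof.
rewrite -row_free_unit; apply/idP/eqP => [|rJ].
  rewrite /row_free => /eqP rG; apply/eqP; rewrite eqn_leq rank_leq_col -{1}rG.
  exact: mxrankM_maxr.
rewrite -kermx_eq0; apply/rowV0P => v /sub_kermxP vG.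
have fJ : row_free J^T by rewrite /row_free mxrank_tr rJ.
apply: (row_free_inj fJ); rewrite mul0mx; apply/eqP; rewrite -enorm_eq0.
rewrite -sqrf_eq0 sqr_enorm dot_mx trmx_mul trmxK mulmxA.
by rewrite mulmxA in vG; rewrite vG mul0mx mxE.
Qed.

End gram.

(** * Newton steps along a manifold *)

Section newton.
Context {R : realType} {n : nat}.
Implicit Types (M U O : set 'rV[R]_n) (x y h u v : 'rV[R]_n).

(** [v1 - v2] equals [t2 - t1], so its square expands into four products of a normal and a tangent
    vector. This identifies the derivatives of different Newton steps on [M]. *)
Lemma normal_component_unique M y (t1 t2 v1 v2 : 'rV[R]_n) :
  tangent M y t1 -> normal M y v1 -> tangent M y t2 -> normal M y v2 ->
  t1 + v1 = t2 + v2 -> v1 = v2.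
Proof.
move=> T1 N1 T2 N2 E; apply/eqP; rewrite -subr_eq0 -enorm_eq0 -sqrf_eq0 sqr_enorm.
have D : v1 - v2 = t2 - t1.
  by apply/rowP => i; have := congr1 (fun z : 'rV[R]_n => z 0 i) E; rewrite !mxE; lra.
by rewrite {2}D dotBl !dotBr N1// N1// N2// N2// !subrr.
Qed.

(* On [M], the transposed derivative [tgrad w y] is the orthogonal projection onto the
   normal space. *)
Definition newton_on M O (w : 'rV[R]_n -> 'rV[R]_n) :=
  (forall z, O z -> forall i, c1at (fun y => w y 0 i) z) /\
  forall y, M y -> O y -> w y = 0 /\ forall u,
    tangent M y (u - tgrad w y u) /\ normal M y (tgrad w y u).

(* w = F (J^T J)^-1 J^T, where J is the jacobian of F, acting on row vectors on the right. *)
Lemma newton_local r M x : manifold 2 r M -> M x ->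
  exists O w, open_nbhs x O /\ newton_on M O w.
Proof.
move=> [rn mM] Mx; have [U [F eqF]] := mM x Mx.
have [[Uo Ux] [dF sF] MU rkF] := eqF.
have cF := fun z Uz => (smooth_on1_row Uo (smooth_on2_smooth_on1 (conj dF sF)) Uz).2.
pose J z := jacobian F z.
have cJ z : U z -> c1at_mx J z.
  move=> Uz i j; apply: (@c1at_near _ _ (fun y => ('D_(delta_mx 0 i) F y) 0 j)).
    apply: filterS (open_nbhs_nbhs (conj Uo Uz)) => y Uy.
    rewrite deriveEjacobian; last exact: dF.
    by rewrite -rowE mxE.
  exact: (smooth_on1_row Uo (sF (delta_mx 0 i)) Uz).2.
pose A z := (J z)^T *m J z.
have cA z : U z -> c1at_mx A z by move=> Uz; apply: c1at_mulmx; [apply: c1at_trmx|]; exact: cJ.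
pose O := U `&` [set z | \det (A z) != 0].
have Oo : open O.
  rewrite openE => z [Uz dz]; apply: filterI; first exact: open_nbhs_nbhs (conj Uo Uz).
  apply: (near_comp (c1at_continuous (c1at_det (cA z Uz))) (P := fun t => t != 0)).
  by apply: open_nbhs_nbhs; split => //; exact: open_neq.
have unitA z : O z -> A z \in unitmx by move=> [_ dz]; rewrite unitmxE unitfE.
have Ox : O x by split => //; rewrite /= -unitfE -unitmxE gram_unitmx rkF.
pose Q z := invmx (A z) *m (J z)^T.
have cQ z : O z -> c1at_mx Q z.
  move=> [Uz dz]; apply: c1at_mulmx; last by apply: c1at_trmx; exact: cJ.
  by apply: c1at_invmx => //; exact: cA.
exists O, (fun z => F z *m Q z); split => //; split.
  move=> z Oz i; apply: (@c1at_mulmx _ _ _ _ _ F Q) => //; last exact: cQ.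
  by move=> i' j; rewrite (ord1 i'); exact: cF Oz.1 j.
move=> y My Oy; have [Uy dy] := Oy.
have Fy : F y = 0 by have /seteqP[/(_ y (conj My Uy))[]] := MU.
split; first by rewrite Fy mul0mx.
(* Full rank persists on [O], so [F] is a local equation at each point of [M] in [O], not only at
   [x]; tangent vectors at [y] are thus the kernel of [J y]. *)
have eqFy : local_equation 1 M y O F.
  split.
  - by [].
  - split => [z [Uz _]|v z [Uz _]]; first exact: dF.
    have [_ cFv] := smooth_on2_smooth_on1 (conj dF sF).
    exact: cFv.
  - apply/seteqP; split => z.
      move=> [Mz Oz]; have [_ Fz] : [set y | U y /\ F y = 0] z by rewrite -MU; split; [|exact: Oz.1].
      exact: (conj Oz Fz).
    move=> [Oz Fz]; have [Mz _] : (M `&` U) z by rewrite MU; exact: (conj Oz.1 Fz).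
    exact: (conj Mz Oz).
  - by apply/eqP; rewrite -gram_unitmx; exact: unitA.
(* Since [F y = 0], only the factor [F] is differentiated. The resulting matrix is symmetric: it is
   the orthogonal projection onto the complement of the kernel of [J y]. *)
move=> u; have -> : tgrad (fun z => F z *m Q z) y u = u *m (J y *m (invmx (A y) *m (J y)^T)).
  apply: gradient_unique => v.
  have dQ i j : differentiable (fun z => Q z i j) y by apply: c1at_differentiable; exact: cQ.
  have dFj j : differentiable (fun z => F z 0 j) y by apply: differentiable_rowE; exact: dF.
  have dFQ i j : differentiable (fun z => F z 0 j * Q z j i) y by exact: differentiableM.
  have DFQ i : 'D_v (fun z => (F z *m Q z) 0 i) y = (v *m J y *m Q y) 0 i.
    rewrite (_ : (fun _ => _) = (fun z => \sum_j F z 0 j * Q z j i)); last first.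
      by apply/funext => z; rewrite mxE.
    rewrite derive_bigsum// mxE; apply: eq_bigr => j _.
    rewrite derive_mul// Fy mxE mul0r add0r mulrC -derive_row ?deriveEjacobian//; exact: dF.
  have dw : differentiable (fun z => F z *m Q z) y.
    apply: differentiable_row => i.
    rewrite (_ : (fun _ => _) = (fun z => \sum_j F z 0 j * Q z j i)); last first.
      by apply/funext => z; rewrite mxE.
    exact: differentiable_bigsum.
  rewrite derive_dot//.
  have -> : 'D_v (fun z => F z *m Q z) y = v *m J y *m Q y.
    by apply/rowP => i; rewrite derive_row.
  rewrite !dot_mx; congr (_ 0 0); rewrite /Q !trmx_mul trmxK trmx_inv.
  by rewrite /A trmx_mul trmxK -!mulmxA.
have dFy := dF y Uy.
split.
  exists r, O, F; split => //.
  rewrite -(deriveE _ dFy) deriveEjacobian// -/(J y) mulmxBl.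
  by rewrite -!mulmxA mulVmx ?mulmx1 ?subrr//; exact: unitA.
move=> h /(tangent_kernel My eqFy); rewrite -(deriveE _ dFy) deriveEjacobian// -/(J y) => hJ.
rewrite dot_mx !mulmxA -mulmxA -trmx_mul hJ.
by rewrite trmx0 mulmx0 mxE.
Qed.

(** Averaging is harmless on [M]: all local steps vanish there, which kills the terms with
    derivatives of the partition, and their derivatives are the same projection by
    [normal_component_unique]. *)
Lemma newton_field r M : manifold 2 r M ->
  exists O w, [/\ open O, M `<=` O & newton_on M O w].
Proof.
move=> mM.
have [M0|M0] := pselect (M !=set0); last first.
  exists set0, (fun=> 0); split; first exact: open0.
    by move=> x Mx; exfalso; apply: M0; exists x.
  by split => // x Mx; exfalso; apply: M0; exists x.
have loc x : exists Dw : set 'rV[R]_n * ('rV[R]_n -> 'rV[R]_n),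
    M x -> open_nbhs x Dw.1 /\ newton_on M Dw.1 Dw.2.
  have [Mx|nMx] := pselect (M x); last by exists (setT, fun=> 0).
  by have [U [w ?]] := newton_local mM Mx; exists (U, w).
have [Dw hDw] := choice loc.
pose O := \bigcup_(x in M) (Dw x).1.
have Oo : open O by apply: bigcup_open => x /hDw[[]].
have MO : M `<=` O by move=> x Mx; exists x => //; have [[]] := hDw x Mx.
pose P c s := exists w, newton_on M (eball c (2 * s)) w.
have [|x [z Mz zx]|c [s [psi [pou hP]]]] := @partition_of_unity_exists R n O P.
- by have [x /MO Ox] := M0; exists x.
- have [[Uo _] [w1 w2]] := hDw z Mz.
  have /nbhs_eballP[rho rho0 hrho] := open_nbhs_nbhs (conj Uo zx).
  exists (rho / 3); first by rewrite divr_gt0.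
  move=> c s s0 srho cx.
  have sub : eball c (2 * s) `<=` (Dw z).1.
    by apply: subset_trans hrho; apply: sub_eball; lra.
  exists (Dw z).2; split => y; first by move=> /sub; exact: w1.
  by move=> My /sub; exact: w2.
have [N pouN] := pou_index pou.
have [w hw] := choice hP.
pose h i k y := w k y 0 i.
have hc1 i k z : eball (c k) (2 * s k) z -> c1at (h i k) z by move=> zk; apply: (hw k).1.
pose W y := \row_i glued psi N (h i) y.
have cW z i : O z -> c1at (fun y => W y 0 i) z.
  move=> Oz; apply: (@c1at_near _ _ (glued psi N (h i))).
    by apply: near_all => y; rewrite mxE.
  exact (c1at_glue Oo pou pouN (hc1 i) Oz).
exists O, W; split => //; split => [z Oz i|y My Oy]; first exact: cW.
have w0 k : eball (c k) (2 * s k) y -> w k y = 0 by move=> yk; have [] := (hw k).2 y My yk.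
have psih i k : h i k y * psi k y = 0.
  have [yk|yk] := pselect (eball (c k) (2 * s k) y); last by rewrite (psi_eq0 pou yk) mulr0.
  by rewrite /h w0// mxE mul0r.
split.
  apply/rowP => i; rewrite !mxE /glued big1// => k _.
  by rewrite mulrC psih.
move=> u.
have dW : differentiable W y by apply: differentiable_row => i; apply: c1at_differentiable; exact: cW.
have DW v i : 'D_v (fun z => W z 0 i) y = \sum_(k < N y) psi k y * 'D_v (h i k) y.
  rewrite (_ : (fun _ => _) = glued psi N (h i)); last by apply/funext => z; rewrite mxE.
  rewrite (derive_glue Oo pou pouN (hc1 i) v Oy) [X in _ + X]big1 ?addr0// => k _.
  have [yk|yk] := pselect (eball (c k) (2 * s k) y).
    by rewrite /h w0// mxE mul0r.
  by rewrite (derive_psi_eq0 pou v yk) mulr0.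
have DWu v : dot v (tgrad W y u) = \sum_(k < N y) psi k y * dot v (tgrad (w k) y u).
  have dwk k : eball (c k) (2 * s k) y -> differentiable (w k) y.
    by move=> yk; apply: differentiable_row => i; apply: c1at_differentiable; exact: (hw k).1.
  rewrite dot_tgrad// /dot.
  under eq_bigr do rewrite derive_row// DW mulr_suml.
  rewrite exchange_big/=; apply: eq_bigr => k _.
  have [yk|yk] := pselect (eball (c k) (2 * s k) y); last first.
    by rewrite (psi_eq0 pou yk) mul0r big1// => i _; rewrite !mul0r.
  rewrite -/(dot v (tgrad (w k) y u)) dot_tgrad; last exact: dwk.
  rewrite /dot mulr_sumr; apply: eq_bigr => i _.
  by rewrite derive_row ?mulrA//; exact: dwk.
have [k0 yk0] : exists k, eball (c k) (2 * s k) y.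
  apply: contrapT => /forallNP nk; have := sum_psi pouN Oy.
  rewrite big1 => [/eqP|k _]; first by rewrite eq_sym oner_eq0.
  by rewrite (psi_eq0 pou (nk k)).
have wk k : eball (c k) (2 * s k) y -> tgrad (w k) y u = tgrad (w k0) y u.
  move=> yk; have [_ /(_ u)[T1 N1]] := (hw k).2 y My yk.
  have [_ /(_ u)[T2 N2]] := (hw k0).2 y My yk0.
  by apply: (normal_component_unique T1 N1 T2 N2); rewrite !subrK.
suff -> : tgrad W y u = tgrad (w k0) y u by have [_ /(_ u)] := (hw k0).2 y My yk0.
apply: gradient_unique => v; rewrite derive_gradient; last exact: differentiable_dot.
rewrite -/(tgrad W y u) DWu.
rewrite -[RHS]mul1r -(sum_psi pouN Oy) mulr_suml; apply: eq_bigr => k _.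
have [yk|yk] := pselect (eball (c k) (2 * s k) y); first by rewrite wk.
by rewrite (psi_eq0 pou yk) !mul0r.
Qed.

End newton.

(** * The retraction attached to a stratum *)

Section tgrad_estimates.
Context {R : realType} {n : nat}.
Implicit Types (x y h u v : 'rV[R]_n) (w r : 'rV[R]_n -> 'rV[R]_n).

Lemma near_tgrad w y e : 0 < e -> (forall i, c1at (fun z => w z 0 i) y) ->
  \forall z \near y, forall u, enorm (tgrad w z u - tgrad w y u) <= e * enorm u.
Proof.
move=> e0 cw; pose e' := e / n.+1%:R; have e'0 : 0 < e' by rewrite divr_gt0.
have H : \forall z \near y, forall i,
    enorm (gradient (fun z => w z 0 i) z - gradient (fun z => w z 0 i) y) < e'.
  apply: near_forall => i.
  exact: (near_comp (c1at_gradient (cw i)) (nbhs_eball _ e'0)).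
apply: filterS2 H (c1at_row_differentiable cw) => z Hz dz u.
have dy := nbhs_singleton (c1at_row_differentiable cw).
rewrite !tgradE// -sumrB.
under eq_bigr do rewrite -scalerBr.
apply: le_trans (ler_enorm_sum _ _) _.
apply: (@le_trans _ _ (\sum_(i < n) e' * enorm u)).
  apply: ler_sum => i _; rewrite enormZ mulrC.
  by apply: ler_pM; rewrite ?enorm_ge0 ?coord_le_enorm// ltW.
rewrite sumr_const card_ord -mulr_natl mulrA ler_wpM2r ?enorm_ge0//.
by rewrite /e' mulrCA ler_piMr ?(ltW e0)// ler_pdivrMr// mul1r ler_nat.
Qed.

Lemma near_eq_tgrad w r x u : (\forall z \near x, w z = r z) -> tgrad w x u = tgrad r x u.
Proof. by move=> wr; apply: near_eq_gradient; apply: filterS wr => z ->. Qed.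

Lemma tgrad_id x u : tgrad id x u = u.
Proof.
apply: gradient_unique => v; rewrite (@derive_dot _ _ _ id)//.
by rewrite derive_id.
Qed.

(** Transposed product rule. The first part is close to the identity minus a multiple of a
    projection; the last is the cutoff term to be made small. *)
Lemma dot_tgrad_subZ w (c : 'rV[R]_n -> R) x u v : differentiable w x -> differentiable c x ->
  dot v (tgrad (fun z => z - c z *: w z) x u) =
  dot v (u - c x *: tgrad w x u) - dot (w x) u * 'D_v c x.
Proof.
move=> dw dc.
have dcw : differentiable (fun z => c z * dot (w z) u) x.
  by apply: differentiableM => //; exact: differentiable_dot.
have didu : differentiable (fun z : 'rV[R]_n => dot z u) x by exact: (@differentiable_dot _ _ _ id).
have E : (fun z => dot (z - c z *: w z) u) = (fun z => dot z u - c z * dot (w z) u).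
  by apply/funext => z; rewrite dotBl dotZl.
rewrite /tgrad -derive_gradient; last by rewrite E; exact: differentiableB.
rewrite E derive_add//; last exact: differentiableN.
rewrite deriveN; last exact: diff_derivable.
rewrite derive_mul//; last exact: differentiable_dot.
rewrite (derive_gradient _ (differentiable_dot u dw)) -/(tgrad w x u).
rewrite (@derive_dot _ _ _ id)// derive_id dotBr dotZr; ring.
Qed.

Lemma lipschitz_of_tgrad r K : 0 <= K -> (forall x, differentiable r x) ->
  (forall x u, enorm (tgrad r x u) <= K * enorm u) ->
  forall x y, enorm (r x - r y) <= K * enorm (x - y).
Proof.
move=> K0 dr Hr x y; apply: enorm_le_dot; first by rewrite mulr_ge0 ?enorm_ge0.
move=> u; apply: le_trans (ler_norm _) _; rewrite dotBl mulrAC.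
apply: (@gradient_lipschitz R n (fun z => dot (r z) u)).
  by rewrite mulr_ge0 ?enorm_ge0.
by move=> z; split; [exact: differentiable_dot|exact: Hr].
Qed.

(** A displacement quadratic in the distance to [x] is [o] of that distance. This handles the points
    of [B], near which the retraction has no C^1 formula. *)
Lemma differentiable_quadratic r x : r x = x ->
  (forall z, enorm (r z - z) <= enorm (z - x) ^+ 2) ->
  differentiable r x /\ forall u, tgrad r x u = u.
Proof.
move=> rx H.
have [dr drE] : differentiable r x /\ 'd r x = idfun :> ('rV[R]_n -> 'rV[R]_n).
  apply: differentiable_epsP; first by move=> z; exact: id.
  move=> e e0; apply/nbhs_eballP; exists (e / n.+1%:R); first by rewrite divr_gt0.
  move=> h; rewrite /eball/= subr0 => he; apply: le_trans (norm_le_enorm _) _.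
  rewrite rx -addrA -opprD [x + h]addrC.
  have := H (h + x); rewrite addrK => /le_trans; apply.
  rewrite expr2; apply: (@le_trans _ _ (e / n.+1%:R * (n.+1%:R * `|h|))).
    by apply: ler_pM; rewrite ?enorm_ge0 ?enorm_le_norm// ltW.
  by rewrite mulrA divfK.
split => // u; apply: gradient_unique => v.
by rewrite derive_dot// deriveE// drE.
Qed.

(** The squared norm is that of [u] minus [c * (2 - c) * dot p p]. So partially removing a normal
    component does not lengthen a vector, whatever the value of the cutoff. *)
Lemma enorm_sub_proj u p c : dot (u - p) p = 0 -> 0 <= c <= 1 -> enorm (u - c *: p) <= enorm u.
Proof.
move=> up /andP[c0 c1]; rewrite ler_sqrt ?dotxx_ge0//.
move: up; rewrite !(dotBl, dotBr, dotZl, dotZr) (dotC p u) => up.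
have : dot u p = dot p p by lra.
have c2 : 0 <= 2 - c by lra.
move=> ->; have := mulr_ge0 (mulr_ge0 c0 c2) (dotxx_ge0 p); move: (dot p p) => P; lra.
Qed.

Lemma enorm_proj u p : dot (u - p) p = 0 -> enorm p <= enorm u.
Proof.
move=> up; rewrite ler_sqrt ?dotxx_ge0//.
have := dotxx_ge0 (u - p); move: up; rewrite !(dotBl, dotBr) (dotC p u); lra.
Qed.

End tgrad_estimates.

Section retraction.
Context {R : realType} {n : nat}.
Implicit Types (x y h u v : 'rV[R]_n).

(** [B] is the union of the strata already treated. [retr_normal] serves for condition (a): off [B]
    the transposed derivative alters [u] by little more than a multiple of its normal component at a
    nearby point of [M]. *)
Record is_retraction (B M V : set 'rV[R]_n) (delta : 'rV[R]_n -> R) (eta : R)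
    (r : 'rV[R]_n -> 'rV[R]_n) : Prop := {
  retr_close : forall x, ~ B x -> enorm (r x - x) < delta x ;
  retr_fix : forall x, B x -> r x = x ;
  retr_lip : forall x y, enorm (r x - r y) <= (1 + eta) * enorm (x - y) ;
  retr_diff : forall x, differentiable r x ;
  retr_tgrad_fix : forall x u, B x -> tgrad r x u = u ;
  retr_tangent : forall x u, M x -> tangent M x (tgrad r x u) ;
  retr_c1at : forall x i, ~ B x -> c1at (fun z => r z 0 i) x ;
  retr_out : forall x, ~ V x -> r x = x ;
  retr_normal : forall x, ~ B x -> (forall u, tgrad r x u = u) \/
    exists y, [/\ M y, enorm (y - x) < delta x & forall u, exists v,
      [/\ normal M y v, dot (u - v) v = 0 &
          enorm (tgrad r x u - u) <= 2 * (enorm v + delta x * enorm u)]]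
}.

Lemma le_of_right_limit (A c d t0 : R) : 0 <= c -> d < t0 ->
  (forall t, d < t <= t0 -> A <= c * t) -> A <= c * d.
Proof.
move=> c0 dt H; apply/ler_addgt0Pr => e e0.
have c1 : 0 < c + 1 by lra.
pose t := Num.min t0 (d + e / (c + 1)).
have : A <= c * t.
  by apply: H; rewrite /t lt_min dt ge_min lexx andbT ltrDl divr_gt0.
move/le_trans; apply; apply: (@le_trans _ _ (c * (d + e / (c + 1)))).
  by rewrite ler_wpM2l// ge_min lexx orbT.
rewrite mulrDr lerD2l mulrCA ler_piMr ?(ltW e0)// ler_pdivrMr// mul1r; lra.
Qed.

Section construction.
Variables (B M V O : set 'rV[R]_n) (w : 'rV[R]_n -> 'rV[R]_n) (delta : 'rV[R]_n -> R).
Hypotheses (Bc : closed B) (BMc : closed (B `|` M)) (MB : forall x, M x -> ~ B x).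
Hypotheses (Vo : open V) (MV : M `<=` V) (delta_pos : locally_positive (~` B) delta).
Hypotheses (Oo : open O) (MO : M `<=` O) (wO : newton_on M O w).

Let d := tdist (B `|` M).

(** On [W] the step [w] is controlled by the distance to [M], because it vanishes on [M] and its
    derivative is close to a projection. One center [y] serves for all the estimates at [x]. *)
Lemma newton_neighborhood : exists W : set 'rV[R]_n, [/\ open W, M `<=` W &
  forall x, W x -> [/\ O x, V x, ~ B x & exists y, [/\ M y, enorm (y - x) < delta x,
    2 * d x < delta x,
    forall u, enorm (tgrad w x u - tgrad w y u) <= delta x * enorm u &
    forall u, `|dot (w x) u| <= (enorm (tgrad w y u) + delta x * enorm u) * d x]]].
Proof.
have [wc1 wM] := wO.
have loc y : exists se : R * R, M y -> [/\ 0 < se.1, 0 < se.2, 2 * se.1 < se.2, se.1 <= 1 &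
    forall x, eball y se.1 x -> [/\ O x, V x, ~ B x, se.2 <= delta x &
      forall u, enorm (tgrad w x u - tgrad w y u) <= se.2 * enorm u]].
  have [My|nMy] := pselect (M y); last by exists (0, 0).
  have [e e0 he] := delta_pos (MB My).
  have nB : \forall x \near y, ~ B x.
    by apply: open_nbhs_nbhs; split; [exact: closed_openC|exact: MB].
  have nO := open_nbhs_nbhs (conj Oo (MO My)).
  have nV := open_nbhs_nbhs (conj Vo (MV My)).
  have nT := near_tgrad e0 (wc1 y (MO My)).
  have [s1 s10 h1] := near_enorm (filterI (filterI nO nV) (filterI nB (filterI he nT))).
  exists (Num.min s1 (Num.min 1 (e / 3)), e) => _ /=; split => //.
  - by rewrite !lt_min s10 ltr01 divr_gt0.
  - have : Num.min s1 (Num.min 1 (e / 3)) <= e / 3 by rewrite !ge_min lexx !orbT.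
    by lra.
  - by rewrite !ge_min lexx orbT.
  - move=> x xy; have /h1[[]] : enorm (x - y) < s1.
      by apply: lt_le_trans xy _; rewrite ge_min lexx.
    by move=> Ox Vx [nBx [ex Tx]].
have [se hse] := choice loc.
(* For [x] in the half ball, a point of [B] or [M] that almost realizes the distance lies in the
   full ball; that ball avoids [B], so the point is in [M], where [w] vanishes. *)
pose W := \bigcup_(y in M) eball y ((se y).1 / 2).
exists W; split.
- by apply: bigcup_open => y _; exact: open_eball.
- by move=> y My; exists y => //; apply: eball_center; have [? _ _ _ _] := hse y My; rewrite divr_gt0.
move=> x [y My]; rewrite /eball/= => xy.
have [s0 e0 se2 s1 hy] := hse y My; set s := (se y).1 in xy s0 se2 s1 hy; set e := (se y).2 in e0 se2 hy.
have yx : eball y s x by rewrite /eball/=; lra.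
have [Ox Vx nBx ex Tx] := hy x yx.
split => //; exists y.
have dxy : d x <= enorm (x - y) by apply: tdist_le; right.
have e_le u : enorm (tgrad w y u) + e * enorm u <= enorm (tgrad w y u) + delta x * enorm u.
  by rewrite lerD2l ler_wpM2r ?enorm_ge0.
split => //.
- by rewrite enormC; lra.
- by lra.
- by move=> u; apply: le_trans (Tx u) _; rewrite ler_wpM2r ?enorm_ge0.
move=> u; apply: (@le_trans _ _ ((enorm (tgrad w y u) + e * enorm u) * d x)); last first.
  by rewrite ler_wpM2r// tdist_ge0.
set c := enorm (tgrad w y u) + e * enorm u.
have c0 : 0 <= c by rewrite addr_ge0 ?enorm_ge0// mulr_ge0 ?enorm_ge0// ltW.
(* The estimate is proved with each [t] above [d x] in place of [d x], no nearest point being at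
   hand; [t <= s / 2] also stays below the truncation of [tdist] at 1. *)
apply: (@le_of_right_limit _ _ _ (s / 2)) => //; first by lra.
move=> t /andP[dt ts].
have [|y' BMy' xy'] := tdist_lt dt; first by lra.
have yy' : eball y s y'.
  rewrite /eball/=; have := ler_enorm_trans x y' y; rewrite (enormC y' x); lra.
have My' : M y' by case: BMy' => // By'; have [_ _ /(_ By')] := hy y' yy'.
have [Oy' _ _ _ _] := hy y' yy'.
have -> : dot (w x) u = dot (w x) u - dot (w y') u.
  by rewrite (wM y' My' Oy').1 dot0l subr0.
apply: (@le_trans _ _ (c * enorm (x - y'))); last by rewrite ler_wpM2l// ltW.
apply: (@gradient_lipschitz_eball _ _ (fun z => dot (w z) u) y s) => //.
move=> z /hy[Oz _ _ _ Tz]; split.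
  by apply: differentiable_dot; exact: nbhs_singleton (c1at_row_differentiable (wc1 z Oz)).
rewrite -/(tgrad w z u) -[tgrad w z u](subrK (tgrad w y u)) addrC.
by apply: le_trans (ler_enormD _ _) _; rewrite lerD2l.
Qed.

End construction.
End retraction.

(** * Logarithmic cutoff and construction of the retraction *)

Section retraction_exists.
Context {R : realType} {n : nat}.
Implicit Types (x y z h u v : 'rV[R]_n).

(* The cutoff depends on the logarithm of the ratio [rho / sigma], so that its gradient is at
   most a small multiple of 1 / [tdist C]; this is what keeps the Lipschitz constant of the
   retraction close to 1. *)
Lemma log_cutoff (C W : set 'rV[R]_n) (k : R) : closed C -> open W -> 0 < k ->
  exists chi : 'rV[R]_n -> R, [/\
    forall x, 0 <= chi x <= 1,
    forall x, W x -> ~ C x -> c1at chi x /\ forall v, `|'D_v chi x| * tdist C x <= 32 * k * enorm v,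
    forall x, W x -> C x -> \forall z \near x, W z /\ (~ C z -> chi z = 1) &
    forall x, ~ W x -> ~ C x -> \forall z \near x, ~ C z /\ (W z -> chi z = 0)].
Proof.
move=> Cc Wo k0.
have Wc : closed (~` W) by exact: open_closedC.
have [rho hrho] := regularized_distance Cc.
have [sig hsig] := regularized_distance Wc.
have rho0 x : ~ C x -> 0 < rho x.
  move=> nC; have [_ /andP[h _] _] := hrho x nC.
  by apply: lt_le_trans h; rewrite divr_gt0//; exact: tdist_gt0.
have sig0 x : W x -> 0 < sig x.
  move=> Wx; have [|_ /andP[h _] _] := hsig x; first by move/(_ Wx).
  by apply: lt_le_trans h; rewrite divr_gt0//; apply: tdist_gt0 => //; move/(_ Wx).
(* [rho] and [sig] are comparable to the distances to [C] and to the complement of [W]. The cutoff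
   is 0 where [rho >= sig] and 1 where [rho <= expR (- k^-1) * sig]; it is meaningful only on [W]
   outside [C]. *)
pose lam x := k * (ln (sig x) - ln (rho x)).
exists (fun x => step (lam x)); split.
- by move=> x; rewrite step_ge0 step_le1.
- move=> x Wx nCx; have [cr /andP[r1 r2] dr] := hrho x nCx.
  have [|cs /andP[s1 s2] ds] := hsig x; first by move/(_ Wx).
  have r0 := rho0 x nCx; have s0 := sig0 x Wx.
  have clr := c1at_ln r0 cr; have cls := c1at_ln s0 cs.
  have cB := c1atB cls clr.
  have cl : c1at lam x by exact: c1atM (c1at_cst _ _) cB.
  split; first exact: c1at_step.
  move=> v; rewrite derive_step; last exact: c1at_differentiable.
  have [/andP[l0 l1]|/dstep_eq0 ->] := boolP (0 < lam x < 1); last first.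
    by rewrite mul0r normr0 mul0r mulr_ge0 ?enorm_ge0// mulr_ge0// ltW.
  have Dl : 'D_v lam x = k * ((sig x)^-1 * 'D_v sig x - (rho x)^-1 * 'D_v rho x).
    have [dls dlr] := (c1at_differentiable cls, c1at_differentiable clr).
    have [ds' dr'] := (c1at_differentiable cs, c1at_differentiable cr).
    rewrite (derive_mul v (differentiable_cst (k : R) x) (c1at_differentiable cB)).
    rewrite derive_cst mulr0 addr0 (derive_sub v dls dlr).
    by rewrite (derive_ln_comp v s0 ds') (derive_ln_comp v r0 dr').
  (* Where the cutoff has nonzero slope [lam] is positive, so the gradient of [ln sig] is also
     bounded through [rho]. In the constant 32, a 4 bounds [dstep], a 4 comes from the two
     logarithms, and a 2 from comparing [tdist C] with [rho]. *)
  have rs : rho x <= sig x.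
    by move: l0; rewrite /lam pmulr_rgt0// subr_gt0 ltr_ln// => /ltW.
  have e0 := @enorm_ge0 _ _ v.
  have hs : `|(sig x)^-1 * 'D_v sig x| <= (rho x)^-1 * (2 * enorm v).
    rewrite normrM ger0_norm ?invr_ge0 ?(ltW s0)//.
    by apply: ler_pM => //; rewrite ?invr_ge0 ?(ltW s0)// lef_pV2.
  have hr : `|(rho x)^-1 * 'D_v rho x| <= (rho x)^-1 * (2 * enorm v).
    by rewrite normrM ger0_norm ?invr_ge0 ?(ltW r0)// ler_wpM2l ?invr_ge0 ?(ltW r0).
  have hD : `|'D_v lam x| <= k * ((rho x)^-1 * (4 * enorm v)).
    rewrite Dl normrM (gtr0_norm k0) ler_pM2l//; apply: le_trans (ler_normB _ _) _.
    by apply: le_trans (lerD hs hr) _; rewrite -mulrDr -mulrDl; lra.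
  rewrite normrM; apply: (@le_trans _ _ (4 * (k * ((rho x)^-1 * (4 * enorm v))) * (2 * rho x))).
    by apply: ler_pM; rewrite ?mulr_ge0 ?tdist_ge0//; [apply: ler_pM => //; exact: dstep_le4|lra].
  by rewrite le_eqVlt; apply/orP; left; apply/eqP; field; rewrite gt_eqF.
- move=> x Wx Cx; pose D := tdist (~` W) x.
  have D0 : 0 < D by apply: tdist_gt0 => //; move/(_ Wx).
  have E0 := expR_gt0 (- k^-1).
  have nD : \forall z \near x, W z /\ enorm (z - x) < Num.min (D / 2) (expR (- k^-1) * (D / 8)).
    apply: filterI; first exact: open_nbhs_nbhs (conj Wo Wx).
    by apply: nbhs_eball; rewrite lt_min !divr_gt0 ?mulr_gt0// divr_gt0.
  apply: filterS nD => z [Wz]; rewrite lt_min => /andP[z1 z2]; split => // nCz.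
  have [_ /andP[_ r2] _] := hrho z nCz; have [|_ /andP[s1 _] _] := hsig z; first by move/(_ Wz).
  have hd : tdist C z <= enorm (z - x) by exact: tdist_le.
  have hD : D / 2 <= tdist (~` W) z.
    by have := tdist_lipschitz (~` W) z x; rewrite -/D ler_norml => /andP[h _]; lra.
  apply: step1; rewrite /lam mulrC -ler_pdivrMr// div1r.
  have r0 := rho0 z nCz; have s0 := sig0 z Wz.
  have h : rho z <= expR (- k^-1) * sig z.
    apply: (@le_trans _ _ (expR (- k^-1) * (D / 4))); first by lra.
    by rewrite ler_pM2l//; lra.
  have : ln (rho z) <= ln (expR (- k^-1) * sig z) by rewrite ler_ln// posrE ?mulr_gt0.
  by rewrite lnM ?posrE// expRK; lra.
- move=> x nWx nCx; have d0 := tdist_gt0 Cc nCx.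
  have nC : \forall z \near x, ~ C z.
    by apply: open_nbhs_nbhs; split => //; exact: closed_openC.
  have nd : \forall z \near x, enorm (z - x) < tdist C x / 8.
    by apply: nbhs_eball; rewrite divr_gt0.
  apply: filterS2 nC nd => z nCz zx; split => // Wz.
  have [_ /andP[r1 _] _] := hrho z nCz; have [|_ /andP[_ s2] _] := hsig z; first by move/(_ Wz).
  have hd : tdist (~` W) z <= enorm (z - x) by exact: tdist_le.
  have hC : tdist C x / 2 <= tdist C z.
    by have := tdist_lipschitz C z x; rewrite ler_norml => /andP[h _]; lra.
  apply: step0; rewrite /lam pmulr_rle0// subr_le0 ler_ln ?posrE; last 2 first.
  - exact: sig0.
  - exact: rho0.
  lra.
Qed.

(** On [W] the transposed derivative is [u - c *: p] up to a small error, with [p] the normal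
    component of [u] at a nearby point of [M] and [c] between 0 and 1. This does not lengthen [u],
    whence the constant [1 + eta]. *)
Lemma retraction_exists r0 (B M V : set 'rV[R]_n) (delta : 'rV[R]_n -> R) (eta : R) :
  closed B -> manifold 2 r0 M -> closed (B `|` M) -> (forall x, M x -> ~ B x) ->
  open V -> M `<=` V -> locally_positive (~` B) delta -> 0 < eta ->
  exists r, is_retraction B M V delta eta r.
Proof.
move=> Bc mM BMc MB Vo MV dpos eta0.
have [U [w [Oo MO wO]]] := newton_field mM.
have [wc1 wM] := wO.
(* The error in the derivative will be at most [e1 + 2 * e1], whence the 3. *)
pose e1 : R := Num.min 1 eta / 3.
have e10 : 0 < e1 by rewrite divr_gt0// lt_min ltr01.
have e11 : 3 * e1 <= 1.
  by rewrite /e1; have : Num.min 1 eta <= 1; [rewrite ge_min lexx|lra].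
have e1eta : 3 * e1 <= eta.
  by rewrite /e1; have : Num.min 1 eta <= eta; [rewrite ge_min lexx orbT|lra].
(* The square of the distance makes [r] tangent to the identity on [B]; [e1] limits the variation of
   the derivative of [w]. *)
pose dl x := Num.min (delta x) (Num.min (tdist B x ^+ 2) e1).
have dlpos : locally_positive (~` B) dl.
  apply: locally_positive_min => //; apply: locally_positive_min.
    by apply: locally_positive_sqr; exact: tdist_locally_positive.
  exact: locally_positive_cst.
have dl1 x : dl x <= delta x by rewrite ge_min lexx.
have dl2 x : dl x <= tdist B x ^+ 2 by rewrite !ge_min lexx orbT.
have dl3 x : dl x <= e1 by rewrite !ge_min lexx !orbT.
have [W [Wo MW hW]] := newton_neighborhood Bc MB Vo MV dlpos Oo MO wO.
set C := B `|` M in BMc hW.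
(* The denominator cancels the 32 of [log_cutoff]. *)
have k0 : 0 < e1 / 32 by rewrite divr_gt0.
have [chi0 [chi01 chiW chi1 chi0']] := log_cutoff BMc Wo k0.
(* [chi0] is controlled only on [W] outside [C]. The values 1 on [M] and 0 outside [W] extend it
   consistently by the last two properties of the cutoff, so [r] has a C^1 formula near each point
   off [B]. *)
pose chi x := if pselect (W x) then if pselect (M x) then 1 else chi0 x else 0.
have chi_01 x : 0 <= chi x <= 1.
  rewrite /chi; case: pselect => _ /=; last by rewrite lexx ler01.
  by case: pselect => _ /=; rewrite ?ler01 ?lexx//; exact: chi01.
have chiM x : W x -> M x -> chi x = 1.
  by move=> Wx Mx; rewrite /chi; case: pselect => //= _; case: pselect.
have chi_W x : W x -> ~ M x -> chi x = chi0 x.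
  by move=> Wx Mx; rewrite /chi; case: pselect => //= _; case: pselect.
have chi_nW x : ~ W x -> chi x = 0.
  by move=> nWx; rewrite /chi; case: pselect.
pose r x := x - chi x *: w x.
have r_nW x : ~ W x -> r x = x by move=> /chi_nW; rewrite /r => ->; rewrite scale0r subr0.
have WnB x : W x -> ~ B x by move=> /hW[].
have wW x : W x -> forall i, c1at (fun z => w z 0 i) x by move=> /hW[Ox _ _ _]; exact: wc1.
have w_lt x : W x -> enorm (w x) < dl x.
  move=> /hW[_ _ nBx [y [My _ d2 _ wd]]].
  apply: le_lt_trans d2; apply: enorm_le_dot; first by rewrite mulr_ge0 ?tdist_ge0.
  move=> u; apply: le_trans (ler_norm _) _; apply: le_trans (wd u) _.
  rewrite mulrAC ler_wpM2r ?tdist_ge0//.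
  have [_ /(_ u)[T1 N1]] := wM y My (MO _ My).
  have : enorm (tgrad w y u) <= enorm u by apply: enorm_proj; rewrite dotC; exact: N1.
  have := dl3 x; have := @enorm_ge0 _ _ u; move: (enorm u) (dl x) => a b a0 b1 h.
  nra.
have rx_lt x : ~ B x -> enorm (r x - x) < dl x.
  move=> nBx; have d0 := locally_positive_gt0 dlpos nBx.
  have [Wx|nWx] := pselect (W x); last by rewrite r_nW// subrr enorm0.
  rewrite /r addrC addKr enormN enormZ; have /andP[c0 c1] := chi_01 x.
  rewrite ger0_norm//; apply: le_lt_trans (w_lt x Wx).
  by rewrite ler_piMl ?enorm_ge0.
have rB x : B x -> r x = x by move=> Bx; apply: r_nW => /WnB.
have rdB x : B x -> differentiable r x /\ forall u, tgrad r x u = u.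
  move=> Bx; apply: differentiable_quadratic; first exact: rB.
  move=> z; have [Bz|nBz] := pselect (B z); first by rewrite rB// subrr enorm0 sqr_ge0.
  apply: le_trans (ltW (rx_lt z nBz)) _; apply: le_trans (dl2 z) _.
  by rewrite lerXn2r ?nnegrE ?tdist_ge0 ?enorm_ge0// tdist_le.
have rM x : M x -> \forall z \near x, r z = z - w z.
  move=> Mx; have := chi1 x (MW _ Mx) (or_intror Mx); apply: filterS => z [Wz hz].
  have [Mz|nMz] := pselect (M z); first by rewrite /r chiM// scale1r.
  rewrite /r chi_W// hz ?scale1r//; case => // /(WnB _ Wz) //.
have rWM x : W x -> ~ M x -> \forall z \near x, r z = z - chi0 z *: w z.
  move=> Wx nMx.
  have nC : \forall z \near x, ~ C z.
    by apply: open_nbhs_nbhs; split; [exact: closed_openC|case => //; exact: WnB].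
  apply: filterS2 (open_nbhs_nbhs (conj Wo Wx)) nC => z Wz nCz.
  by rewrite /r chi_W// => Mz; apply: nCz; right.
have rnW x : ~ B x -> ~ W x -> \forall z \near x, r z = z.
  move=> nBx nWx; have := chi0' x nWx; have nCx : ~ C x by case => // /MW.
  move=> /(_ nCx); apply: filterS => z [nCz hz].
  have [Wz|nWz] := pselect (W z); last exact: r_nW.
  by rewrite /r chi_W ?hz ?scale0r ?subr0// => Mz; apply: nCz; right.
have rc1 x i : ~ B x -> c1at (fun z => r z 0 i) x.
  move=> nBx; have [Wx|nWx] := pselect (W x); last first.
    apply: (@c1at_near _ _ (fun z : 'rV[R]_n => z 0 i)); last exact: c1at_coord.
    by apply: filterS (rnW x nBx nWx) => z ->.
  have [Mx|nMx] := pselect (M x).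
    apply: (@c1at_near _ _ (fun z : 'rV[R]_n => z 0 i - w z 0 i)).
      by apply: filterS (rM x Mx) => z ->; rewrite !mxE.
    by apply: c1atB; [exact: c1at_coord|exact: wW].
  apply: (@c1at_near _ _ (fun z : 'rV[R]_n => z 0 i - chi0 z * w z 0 i)).
    by apply: filterS (rWM x Wx nMx) => z ->; rewrite !mxE.
  apply: c1atB; first exact: c1at_coord.
  by apply: c1atM; [apply: (chiW x Wx _).1; case => //; exact: WnB|exact: wW].
have rd x : differentiable r x.
  have [Bx|nBx] := pselect (B x); first exact: (rdB x Bx).1.
  by apply: differentiable_row => i; apply: c1at_differentiable; exact: rc1.
have dw x : W x -> differentiable w x.
  by move=> Wx; exact: nbhs_singleton (c1at_row_differentiable (wW x Wx)).
have tgM x u : M x -> tgrad r x u = u - tgrad w x u.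
  move=> Mx; rewrite (near_eq_tgrad u (rM x Mx)).
  rewrite (@near_eq_tgrad _ _ _ (fun z => z - cst 1 z *: w z)); last first.
    by apply: near_all => z; rewrite scale1r.
  apply: gradient_unique => v; rewrite derive_gradient; last first.
    apply: differentiable_dot; apply: differentiableB => //.
    rewrite (_ : (fun _ => _) = w); first exact: dw (MW _ Mx).
    by apply/funext => z; rewrite scale1r.
  rewrite -/(tgrad _ x u) dot_tgrad_subZ; [|exact: dw (MW _ Mx)|exact: differentiable_cst].
  by rewrite derive_cst mulr0 subr0 scale1r.
(* The derivative of [r] is nearly [I - c P], with [P] the projection onto the normal space. *)
have key x : W x -> exists y, [/\ M y, enorm (y - x) < dl x & forall u, [/\
    normal M y (tgrad w y u), dot (u - tgrad w y u) (tgrad w y u) = 0 &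
    exists2 c, 0 <= c <= 1 & enorm (tgrad r x u - (u - c *: tgrad w y u)) <=
      dl x * enorm u + e1 * (enorm (tgrad w y u) + dl x * enorm u)]].
  move=> Wx; have [_ _ nBx [y [My yx _ Tw wd]]] := hW x Wx.
  exists y; split => // u.
  have [_ /(_ u)[T1 N1]] := wM y My (MO _ My).
  have dl0 := locally_positive_gt0 dlpos nBx.
  have m0 : 0 <= e1 * (enorm (tgrad w y u) + dl x * enorm u).
    by rewrite mulr_ge0 ?(ltW e10)// addr_ge0 ?enorm_ge0// mulr_ge0 ?enorm_ge0// ltW.
  split => //; first by rewrite dotC; exact: N1.
  have [Mx|nMx] := pselect (M x).
    exists 1; first by rewrite ler01 lexx.
    rewrite tgM// scale1r [u - _ - _]addrC opprB addrA subrK enormC.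
    by apply: le_trans (Tw u) _; rewrite lerDl.
  have nCx : ~ C x by case.
  have [cc hc] := chiW x Wx nCx.
  have dc : differentiable chi0 x by exact: c1at_differentiable.
  have /andP[c0 c1] := chi01 x.
  exists (chi0 x); first exact: chi01.
  rewrite (near_eq_tgrad u (rWM x Wx nMx)).
  apply: enorm_le_dot; first by rewrite addr_ge0// mulr_ge0 ?enorm_ge0// ltW.
  move=> v; rewrite dotC dotBr (dot_tgrad_subZ u v (dw x Wx) dc).
  (* Two errors remain: the derivative of [w] taken at [x] instead of [y], and the cutoff term,
     where the distance bounding [w] compensates the inverse distance bounding the gradient of
     [chi0]. *)
  rewrite (_ : _ - _ - _ = - (chi0 x * dot v (tgrad w x u - tgrad w y u)) -
    dot (w x) u * 'D_v chi0 x); last first.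
    by rewrite !dotBr !dotZr; move: ('D_v chi0 x) (chi0 x) (dot (w x) u) => b c0' a; ring.
  apply: le_trans (ler_norm _) _; apply: le_trans (ler_normB _ _) _.
  rewrite normrN mulrDl; apply: lerD.
    rewrite normrM (ger0_norm c0); apply: (@le_trans _ _ (1 * (enorm v * (dl x * enorm u)))).
      apply: ler_pM => //; apply: le_trans (normr_dot_le _ _) _.
      by rewrite ler_wpM2l ?enorm_ge0.
    by rewrite mul1r mulrC.
  rewrite normrM; set q := enorm (tgrad w y u) + dl x * enorm u in m0 *.
  have q0 : 0 <= q by rewrite addr_ge0 ?enorm_ge0// mulr_ge0 ?enorm_ge0// ltW.
  apply: (@le_trans _ _ (q * (tdist C x * `|'D_v chi0 x|))).
    by rewrite mulrA ler_wpM2r// wd.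
  rewrite -[leRHS]mulrA [leRHS]mulrCA ler_wpM2l// mulrC.
  by apply: le_trans (hc v) _; rewrite mulrCA divff// mulr1.
exists r; split => //.
- by move=> x /rx_lt h; exact: lt_le_trans h (dl1 x).
- apply: lipschitz_of_tgrad => //; first by rewrite addr_ge0// ltW.
  move=> x u; have [Bx|nBx] := pselect (B x).
    by rewrite (rdB x Bx).2 ler_peMl ?enorm_ge0// lerDl ltW.
  have [Wx|nWx] := pselect (W x); last first.
    by rewrite (near_eq_tgrad u (rnW x nBx nWx)) tgrad_id ler_peMl ?enorm_ge0// lerDl ltW.
  have [y [My _ /(_ u)[_ up [c c01 hc]]]] := key x Wx.
  rewrite -[tgrad r x u](subrK (u - c *: tgrad w y u)).
  apply: le_trans (ler_enormD _ _) _.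
  have h1 := enorm_sub_proj up c01; have h2 := enorm_proj up.
  have e0 := @enorm_ge0 _ _ u.
  have h3 : dl x * enorm u <= e1 * enorm u by rewrite ler_wpM2r.
  have h4 : e1 * (enorm (tgrad w y u) + dl x * enorm u) <= e1 * (2 * enorm u).
    rewrite ler_pM2l//; apply: (@le_trans _ _ (enorm u + e1 * enorm u)); first by rewrite lerD.
    by rewrite -[2]/(1 + 1) mulrDl mul1r lerD2l ler_piMl//; lra.
  have h5 : 3 * e1 * enorm u <= eta * enorm u by rewrite ler_wpM2r.
  rewrite mulrDl mul1r; lra.
- by move=> x u Bx; rewrite (rdB x Bx).2.
- by move=> x u Mx; rewrite tgM//; have [_ /(_ u)[]] := wM x Mx (MO _ Mx).
- by move=> x nVx; apply: r_nW => /hW[].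
- move=> x nBx; have [Wx|nWx] := pselect (W x); last first.
    by left => u; rewrite (near_eq_tgrad u (rnW x nBx nWx)) tgrad_id.
  right; have dl0 := locally_positive_gt0 dlpos nBx.
  have [y [My yx hy]] := key x Wx.
  exists y; split => //; first exact: lt_le_trans yx (dl1 x).
  move=> u; have [Nv up [c /andP[c0 c1] hc]] := hy u; exists (tgrad w y u); split => //.
  have -> : tgrad r x u - u = tgrad r x u - (u - c *: tgrad w y u) - c *: tgrad w y u.
    by rewrite opprB -[RHS]addrA [c *: _ - u - _]addrAC subrr add0r.
  apply: le_trans (ler_enormB _ _) _; rewrite enormZ ger0_norm//.
  have e0 := @enorm_ge0 _ _ u; have p0 := @enorm_ge0 _ _ (tgrad w y u).
  have h1 : c * enorm (tgrad w y u) <= enorm (tgrad w y u) by rewrite ler_piMl.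
  have h2 : dl x * enorm u <= delta x * enorm u by rewrite ler_wpM2r.
  have q0 : 0 <= enorm (tgrad w y u) + dl x * enorm u.
    by rewrite addr_ge0// mulr_ge0// ltW.
  have h3 : e1 * (enorm (tgrad w y u) + dl x * enorm u) <= enorm (tgrad w y u) + dl x * enorm u.
    by rewrite ler_piMl//; lra.
  lra.
Qed.

End retraction_exists.

(** * The approximation *)

Section lipschitz.
Context {R : realType} {n : nat}.
Implicit Types (x y u v : 'rV[R]_n) (f g : 'rV[R]_n -> R) (Q : set 'rV[R]_n).

Lemma lip_le Q f L : 0 <= L ->
  (forall x y, Q x -> Q y -> `|f x - f y| <= L * enorm (x - y)) -> (lip Q f <= L%:E)%E.
Proof.
move=> L0 H; apply: ge_ereal_sup => _ [->|[x [y [Qx Qy xy ->]]]]; first by rewrite lee_fin.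
by rewrite lee_fin ler_pdivrMr ?H// enorm_gt0 subr_eq0; apply/eqP.
Qed.

Lemma lip_bound Q f : lipschitz_continuous Q f -> exists L, [/\ 0 <= L, lip Q f = L%:E &
  forall x y, Q x -> Q y -> `|f x - f y| <= L * enorm (x - y)].
Proof.
move=> fL; have l0 : (0 <= lip Q f)%E by apply: ereal_sup_ubound; left.
have lf : lip Q f \is a fin_num by rewrite ge0_fin_numE.
exists (fine (lip Q f)); split; [exact: fine_ge0|by rewrite fineK|].
move=> x y Qx Qy; have [->|xy] := eqVneq x y; first by rewrite !subrr normr0 enorm0 mulr0.
rewrite -ler_pdivrMr ?enorm_gt0 ?subr_eq0// -lee_fin fineK//.
by apply: ereal_sup_ubound; right; exists x, y; split => //; apply/eqP.
Qed.

Definition locally_lipschitz g := forall x, exists rho K, [/\ 0 < rho, 0 <= K &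
  forall a b, eball x rho a -> eball x rho b -> `|g a - g b| <= K * enorm (a - b)].

Lemma locally_lipschitzP g : locally_lipschitz g -> locally_lipschitz_continuous setT g.
Proof.
move=> H x _; have [rho [K [rho0 K0 hK]]] := H x.
exists (eball x rho); first exact: nbhs_eball.
apply: (@le_lt_trans _ _ K%:E); last exact: ltry.
by apply: lip_le => // a b [_ ax] [_ bx]; exact: hK.
Qed.

Lemma c1at_locally_lipschitz g : (forall x, c1at g x) -> locally_lipschitz g.
Proof.
move=> cg x; have := near_comp (c1at_gradient (cg x)) (nbhs_eball (gradient g x) ltr01).
move=> /near_enorm[rho rho0 hrho].
exists rho, (enorm (gradient g x) + 1); split => //; first by rewrite addr_ge0 ?enorm_ge0.
move=> a b ax bx; apply: (@gradient_lipschitz_eball _ _ g x rho) => //.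
  by rewrite addr_ge0 ?enorm_ge0.
move=> z /hrho hz; split; first exact: c1at_differentiable.
rewrite -[gradient g z](subrK (gradient g x)) addrC.
by apply: le_trans (ler_enormD _ _) _; rewrite lerD2l ltW.
Qed.

Lemma locally_lipschitz_comp g r K : 0 <= K -> locally_lipschitz g ->
  (forall a b, enorm (r a - r b) <= K * enorm (a - b)) -> locally_lipschitz (fun x => g (r x)).
Proof.
move=> K0 gl rl x; have [rho [L [rho0 L0 hL]]] := gl (r x).
have K1 : 0 < K + 1 by lra.
exists (rho / (K + 1)), (L * K); split; [exact: divr_gt0|exact: mulr_ge0|].
have sub a : eball x (rho / (K + 1)) a -> eball (r x) rho (r a).
  rewrite /eball/= ltr_pdivlMr// => h; apply: le_lt_trans (rl _ _) _; apply: le_lt_trans h.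
  by rewrite mulrC ler_wpM2l ?enorm_ge0// lerDl.
move=> a b /sub ha /sub hb; apply: le_trans (hL _ _ ha hb) _.
by rewrite -mulrA ler_wpM2l.
Qed.

Lemma continuous_tdist (S : set 'rV[R]_n) : continuous (tdist S).
Proof.
move=> x; apply/continuousR_eballP => e e0; exists e => // y.
exact: le_lt_trans (tdist_lipschitz _ _ _).
Qed.

(** The forbidden set may depend on the point; if it stays uniformly away near each [x0], the
    distance to it is an admissible tolerance. *)
Lemma locally_positive_tdist (O : set 'rV[R]_n) (S : 'rV[R]_n -> set 'rV[R]_n) :
  (forall x0, O x0 -> exists2 rho, 0 < rho & forall x y, enorm (x - x0) < rho ->
    enorm (y - x0) < rho -> ~ S x y) -> locally_positive O (fun x => tdist (S x) x).
Proof.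
move=> H x0 /H[rho rho0 hrho]; exists (Num.min 1 (rho / 2)); first by rewrite lt_min ltr01 divr_gt0.
apply/nbhs_eballP; exists (rho / 2); first by rewrite divr_gt0.
move=> x; rewrite /eball/= => xx0; rewrite leNgt; apply/negP => h.
have [|y Sy xy] := tdist_lt h; first by rewrite ge_min lexx.
apply: (hrho x y) Sy; first by apply: lt_trans xx0 _; lra.
have : enorm (x - y) < rho / 2 by apply: lt_le_trans xy _; rewrite ge_min lexx orbT.
by have := ler_enorm_trans x y x0; rewrite (enormC y x); lra.
Qed.

End lipschitz.

(** * Frontiers of strata and their order *)

Section frontier.
Context {R : realType} {n : nat}.
Implicit Types (L M P : set 'rV[R]_n).

(** Near [x] the manifold is the zero set of a continuous map, hence relatively closed. *)
Lemma manifold_locally_closed p r M x : manifold p.+1 r M -> M x ->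
  \forall z \near x, closure M z -> M z.
Proof.
move=> [_ mM] Mx; have [U [F [[Uo Ux] smF MU _]]] := mM x Mx.
apply: filterS (open_nbhs_nbhs (conj Uo Ux)) => z Uz cMz.
have Fc : {for z, continuous F} by apply: differentiable_continuous; exact: smF.1.
apply: contrapT => nMz; have Fz : F z != 0.
  apply/eqP => Fz; have [] : (M `&` U) z by rewrite MU.
  by [].
have nF : \forall y \near z, F y != 0.
  exact: (cvgr_neq0 (F z) Fc Fz).
have [y [My [Uy Fy]]] := cMz _ (filterI (open_nbhs_nbhs (conj Uo Uz)) nF).
have [_ Fy0] : [set y | U y /\ F y = 0] y by rewrite -MU.
by move: Fy; rewrite Fy0 eqxx.
Qed.

Lemma closed_frontier p r M : manifold p.+1 r M -> closed (closure M `\` M).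
Proof.
move=> mM x cx; split.
  apply: (@closed_closure _ M); apply: closureS cx; exact: subDsetl.
move=> Mx; have [y [[cMy nMy] My]] := cx _ (manifold_locally_closed mM Mx).
by apply: nMy; exact: My.
Qed.

(** The head replaces the minimal element of the tail exactly when it lies below it; transitivity
    then keeps it minimal. *)
Lemma seq_minimal (T : eqType) (rel : T -> T -> Prop) (s : seq T) :
  s != [::] -> (forall a, a \in s -> ~ rel a a) ->
  (forall a b c, a \in s -> b \in s -> c \in s -> rel a b -> rel b c -> rel a c) ->
  exists2 a, a \in s & forall b, b \in s -> ~ rel b a.
Proof.
elim: s => // a s IH _ irr tr.
have [s0|s0] := eqVneq s [::].
  exists a; first by rewrite mem_head.
  by move=> b; rewrite s0 inE => /eqP ->; apply: irr; rewrite mem_head.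
have sub b : b \in s -> b \in a :: s by rewrite inE => ->; rewrite orbT.
have [|b c d /sub bs /sub cs /sub ds|m ms mmin] := IH s0.
- by move=> b /sub; exact: irr.
- exact: tr.
have [am|nam] := pselect (rel a m).
  exists a; first by rewrite mem_head.
  move=> b; rewrite inE => /orP[/eqP->|bs ba]; first by apply: irr; rewrite mem_head.
  by apply: (mmin b bs); apply: (tr b a m) => //; [exact: sub|rewrite mem_head|exact: sub].
exists m; first exact: sub.
by move=> b; rewrite inE => /orP[/eqP->|/mmin].
Qed.

End frontier.

(** * Condition (a) and continuity of the gradient *)

Section whitney.
Context {R : realType} {n : nat}.
Implicit Types (x y u v : 'rV[R]_n).

Lemma cvg_natSinv (x : 'rV[R]_n) (a : nat -> 'rV[R]_n) :
  (forall k, enorm (a k - x) < k.+1%:R^-1) -> a @ \oo --> x.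
Proof.
move=> H; apply/cvgrPdist_lt => e e0; near=> k.
rewrite distrC; apply: le_lt_trans (norm_le_enorm _) _; apply: lt_trans (H k) _.
by near: k; exact: near_infty_natSinv_lt (PosNum e0).
Unshelve. all: by end_near. Qed.

(** By contradiction and compactness: normal components [v] of vectors [u] tending to [u0] have a
    cluster point [v0], which is normal to [L] by condition (a), so [dot u0 v0 = 0]. But the square
    of [enorm v] is [dot u v], which tends to [dot u0 v0]. *)
Lemma whitney_small (A : set (set 'rV[R]_n)) L M x0 u0 e :
  whitney_a A -> A L -> A M -> L x0 -> tangent L x0 u0 -> 0 < e ->
  exists2 rho, 0 < rho & forall y u v, M y -> enorm (y - x0) < rho -> enorm (u - u0) < rho ->
    normal M y v -> dot (u - v) v = 0 -> enorm v <= e.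
Proof.
move=> wA AL AM Lx0 Tu0 e0; apply: contrapT => H.
have H' (k : nat) : exists yuv : 'rV[R]_n * 'rV[R]_n * 'rV[R]_n, [/\ M yuv.1.1,
    enorm (yuv.1.1 - x0) < k.+1%:R^-1, enorm (yuv.1.2 - u0) < k.+1%:R^-1 &
    [/\ normal M yuv.1.1 yuv.2, dot (yuv.1.2 - yuv.2) yuv.2 = 0 & e < enorm yuv.2]].
  apply: contrapT => Hk; apply: H; exists k.+1%:R^-1; first by rewrite invr_gt0.
  move=> y u v My yx uu Nv uv; rewrite leNgt; apply/negP => ev.
  by apply: Hk; exists (y, u, v).
have [q hq] := choice H'.
pose A0 := enorm u0 + 1; have A00 : 0 < A0 by rewrite ltr_wpDl ?enorm_ge0.
have vA k : enorm (q k).2 <= A0.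
  have [_ _ qu [_ /enorm_proj h _]] := hq k; apply: le_trans h _.
  rewrite -[(q k).1.2](subrK u0); apply: le_trans (ler_enormD _ _) _.
  rewrite addrC lerD2l; apply: le_trans (ltW qu) _.
  by rewrite invf_le1// ler1n.
have vball : ((fun k => (q k).2) @ \oo) (ecball 0 A0).
  by exists 0%N => // k _; rewrite /ecball/= subr0.
have [v0 [_ clv]] := @compact_ecball R n 0 A0 ((fun k => (q k).2) @ \oo) _ vball.
(* The chosen indices need not increase: being at least [j] is enough for the convergence along
   them. *)
have sub (j : nat) : exists k, (j <= k)%N /\ enorm ((q k).2 - v0) < j.+1%:R^-1.
  have Fj : ((fun k => (q k).2) @ \oo) [set v | exists2 k, (j <= k)%N & v = (q k).2].
    by exists j => // k /= jk; exists k.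
  have [|_ [[k jk ->] hv]] := clv _ (eball v0 j.+1%:R^-1) Fj.
    by apply: nbhs_eball; rewrite invr_gt0.
  by exists k.
have [s hs] := choice sub.
have le_s j : (s j).+1%:R^-1 <= j.+1%:R^-1 :> R.
  by rewrite lef_pV2 ?posrE// ler_nat ltnS; exact: (hs j).1.
have Nv0 : normal L x0 v0.
  apply: (wA L M (fun j => (q (s j)).1.1) (fun j => (q (s j)).2)) => //.
  - by move=> j; have [] := hq (s j).
  - apply: cvg_natSinv => j; have [_ h _ _] := hq (s j); exact: lt_le_trans h (le_s j).
  - by move=> j; have [_ _ _ []] := hq (s j).
  - by apply: cvg_natSinv => j; exact: (hs j).2.
have u0v0 : dot u0 v0 = 0 by rewrite dotC; exact: Nv0.
have bound j : e ^+ 2 <= (2 * A0) * j.+1%:R^-1.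
  have [_ _ hu [_ uv ev]] := hq (s j); have [_ hv] := hs j.
  set u := (q (s j)).1.2 in hu uv; set v := (q (s j)).2 in uv ev hv.
  have {}hu : enorm (u - u0) <= j.+1%:R^-1 by apply: le_trans (ltW hu) (le_s j).
  apply: (@le_trans _ _ (enorm v ^+ 2)); first by rewrite lerXn2r ?nnegrE ?enorm_ge0// ltW.
  have -> : enorm v ^+ 2 = dot (u - u0) v + dot u0 (v - v0).
    by rewrite sqr_enorm; move: uv; rewrite !(dotBl, dotBr) u0v0; lra.
  have j0 : 0 <= j.+1%:R^-1 :> R by rewrite invr_ge0.
  have h1 : dot (u - u0) v <= j.+1%:R^-1 * A0.
    by apply: le_trans (dot_le_enorm _ _) _; apply: ler_pM; rewrite ?enorm_ge0// vA.
  have h2 : dot u0 (v - v0) <= A0 * j.+1%:R^-1.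
    apply: le_trans (dot_le_enorm _ _) _; apply: ler_pM; rewrite ?enorm_ge0 ?(ltW hv)//.
    by rewrite lerDl.
  apply: le_trans (lerD h1 h2) _.
  by rewrite le_eqVlt; apply/orP; left; apply/eqP; ring.
have : e ^+ 2 <= 0.
  apply/ler_addgt0Pr => d d0; rewrite add0r.
  have [j hj] : exists j : nat, j.+1%:R^-1 < d / (2 * A0).
    have d1 : 0 < d / (2 * A0) by rewrite divr_gt0// mulr_gt0.
    exists (Num.truncn (d / (2 * A0))^-1).
    by rewrite invf_plt ?posrE// truncnS_gt// invr_ge0 ltW.
  apply: le_trans (bound j) _; rewrite mulrC -ler_pdivlMr ?mulr_gt0//; exact: ltW.
by rewrite leNgt exprn_gt0.
Qed.

End whitney.

Section whitney_gradient.
Context {R : realType} {n : nat}.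

(** The retraction alters the gradient by at most twice its normal component at a nearby point of
    [M], up to a small error. At [x0] the gradient is tangent to [L], so [whitney_small] makes this
    component tend to 0. *)
Lemma whitney_gradient_continuous (A : set (set 'rV[R]_n)) (L M B V : set 'rV[R]_n)
    (delta g : 'rV[R]_n -> R) (eta : R) (r : 'rV[R]_n -> 'rV[R]_n) (x0 : 'rV[R]_n) :
  is_retraction B M V delta eta r -> (forall x, delta x <= tdist B x) ->
  whitney_a A -> A L -> A M -> L x0 -> B x0 -> tangent L x0 (gradient g x0) -> c1at g x0 ->
  {for x0, continuous (fun x => tgrad r x (gradient g (r x)))}.
Proof.
have sum_lt (a : R) : 0 < a -> a / 2 + a / 4 < a by lra.
move=> hr dB wA AL AM Lx0 Bx0 Tu0 cg.
have rx0 := retr_fix hr Bx0.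
have rc : {for x0, continuous r} by exact: differentiable_continuous (retr_diff hr x0).
pose u x := gradient g (r x); pose u0 := gradient g x0.
have uc : {for x0, continuous u}.
  by apply: (@continuous_comp _ _ _ r (gradient g)) => //; rewrite rx0; exact: c1at_gradient.
have ux0 : u x0 = u0 by rewrite /u rx0.
apply/continuous_eballP => e e0; rewrite (retr_tgrad_fix hr _ Bx0) rx0 -/u0.
have e4 : 0 < e / 4 by rewrite divr_gt0.
have e8 : 0 < e / 8 by rewrite divr_gt0.
have [rho rho0 hrho] := whitney_small wA AL AM Lx0 Tu0 e8.
have U0 : 0 < enorm u0 + 1 by rewrite ltr_wpDl ?enorm_ge0.
have eU : 0 < e / 8 / (enorm u0 + 1) by rewrite divr_gt0.
have rho2 : 0 < rho / 2 by rewrite divr_gt0.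
have nu d : 0 < d -> \forall x \near x0, enorm (u x - u0) < d.
  by move=> d0; rewrite -ux0; exact: (near_comp uc (nbhs_eball (u x0) d0)).
have nx d : 0 < d -> \forall x \near x0, enorm (x - x0) < d by move=> d0; exact: nbhs_eball.
suff /near_enorm[d d0 hd] : \forall x \near x0, enorm (tgrad r x (u x) - u0) < e.
  exists d => // y /hd hy; rewrite -ball_normE/= distrC.
  exact: le_lt_trans (norm_le_enorm _) hy.
apply: filterS2 (filterI (nu _ rho0) (filterI (nu _ ltr01) (nu _ e4)))
  (filterI (nx _ rho2) (nx _ eU)) => x [u1 [u2 u3]] [x1 x2].
have close : enorm (tgrad r x (u x) - u x) <= e / 2.
  have [Bx|nBx] := pselect (B x).
    by rewrite (retr_tgrad_fix hr _ Bx) subrr enorm0 divr_ge0// ltW.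
  have [->|[y [My yx hy]]] := retr_normal hr nBx.
    by rewrite subrr enorm0 divr_ge0// ltW.
  (* Since [delta] is at most the distance to [B], the point [y] of [M] tends to [x0] together with
     [x]. *)
  have dx : delta x <= enorm (x - x0) by apply: le_trans (dB x) _; exact: tdist_le.
  have [v [Nv uv tv]] := hy (u x).
  have yx0 : enorm (y - x0) < rho.
    apply: le_lt_trans (ler_enorm_trans x _ _) _; rewrite [ltRHS]splitr.
    by apply: ltrD => //; exact: lt_trans (lt_le_trans yx dx) x1.
  have v8 : enorm v <= e / 8 by exact: hrho My yx0 u1 Nv uv.
  have ub : enorm (u x) <= enorm u0 + 1.
    by rewrite -[u x](subrK u0) addrC; apply: le_trans (ler_enormD _ _) _; rewrite lerD2l ltW.
  have d0 : 0 <= delta x by apply: le_trans (ltW yx); exact: enorm_ge0.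
  have du : delta x * enorm (u x) <= e / 8.
    rewrite -[leRHS](divfK (lt0r_neq0 U0)).
    by apply: ler_pM; rewrite ?enorm_ge0//; apply: le_trans dx (ltW x2).
  apply: le_trans tv _; apply: le_trans (ler_wpM2l _ (lerD v8 du)) _ => //.
  by rewrite le_eqVlt; apply/orP; left; apply/eqP; field.
apply: le_lt_trans (ler_enorm_trans (u x) _ _) _; apply: le_lt_trans (lerD close (ltW u3)) _.
exact: sum_lt.
Qed.

End whitney_gradient.

(** * Induction on the strata *)

Section approximation.
Context {R : realType} {n : nat}.
Implicit Types (x y u v : 'rV[R]_n) (g : 'rV[R]_n -> R) (M : set 'rV[R]_n).
Variables (Q : set 'rV[R]_n) (A : set (set 'rV[R]_n)) (f eps : 'rV[R]_n -> R)
  (V1 V2 : set 'rV[R]_n).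
Hypotheses (Qclosed : closed Q) (Astrat : stratification 2 Q A).
Hypotheses (fcont : continuous f) (epscont : continuous eps) (epspos : forall x, 0 < eps x).
Hypotheses (V1o : open V1) (fV1 : supp f `<=` V1).
Hypotheses (V2o : open V2) (lowV2 : low_dim_part 2 A `<=` V2).

(** The invariant after treating the strata in [Bs], with current Lipschitz factor [kap]. Making the
    C^1 clause conditional on condition (a) lets one induction yield both conclusions. *)
Record approximates (Bs : set (set 'rV[R]_n)) (kap : R) g : Prop := {
  appr_close : forall x, `|f x - g x| < eps x ;
  appr_loclip : locally_lipschitz g ;
  appr_diff : forall x, differentiable g x ;
  appr_lip : forall L, 0 <= L -> (forall x y, `|f x - f y| <= L * enorm (x - y)) ->
    forall x y, `|g x - g y| <= kap * L * enorm (x - y) ;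
  appr_tangent : forall M, Bs M -> forall x, M x -> tangent M x (gradient g x) ;
  appr_supp : supp g `<=` V1 ;
  appr_agree : (forall x, c1at f x) -> forall x, ~ V2 x -> g x = f x ;
  appr_c1 : whitney_a A -> forall x, c1at g x
}.

Lemma near_supp0 g x : ~ supp g x -> \forall y \near x, g y = 0.
Proof.
move=> nx; have : nbhs x (~` supp g).
  by apply: open_nbhs_nbhs; split => //; apply: closed_openC; exact: closed_closure.
apply: filterS => y ny; apply: contrapT => gy; apply: ny.
by apply: subset_closure; exact/eqP.
Qed.

Lemma approximates_c1 kap g : (forall x, c1at g x) -> (forall x, `|f x - g x| < eps x) ->
  (forall L, 0 <= L -> (forall x y, `|f x - f y| <= L * enorm (x - y)) ->
    forall x y, `|g x - g y| <= kap * L * enorm (x - y)) ->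
  (forall x, ~ V1 x -> \forall y \near x, g y = 0) ->
  ((forall x, c1at f x) -> forall x, g x = f x) -> approximates set0 kap g.
Proof.
move=> cg close lipg suppg agree; split.
- exact: close.
- exact: c1at_locally_lipschitz.
- by move=> x; exact: c1at_differentiable (cg x).
- exact: lipg.
- by [].
- move=> x gx; apply: contrapT => /suppg nx; have [y [/= gy g0]] := gx _ nx.
  by rewrite g0 eqxx in gy.
- by move=> cf x _; exact: agree.
- by move=> _; exact: cg.
Qed.

(** A C^1 function is kept unchanged, as the agreement clause requires. Otherwise [f] is smoothed:
    with factor 2 if it is Lipschitz, and with a vacuous Lipschitz clause if it is not. *)
Lemma approximates_base : exists kap g, [/\ 0 < kap, kap < 11 & approximates set0 kap g].
Proof.
have fV x : ~ V1 x -> \forall y \near x, f y = 0.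
  by move=> nV; apply: near_supp0 => /fV1.
have lt0_1 : (0 : R) < 1 by exact: ltr01.
have lt1_11 : (1 : R) < 11 by rewrite ltr1n.
have [cf|ncf] := pselect (forall x, c1at f x).
  exists 1, f; split; [exact: lt0_1|exact: lt1_11|apply: approximates_c1].
  - exact: cf.
  - by move=> x; rewrite subrr normr0; exact: epspos.
  - by move=> L L0 fL x y; rewrite mul1r; exact: fL.
  - exact: fV.
  - by [].
have epsp : locally_positive setT eps.
  by apply: locally_positive_continuous => x _; split; [exact: epscont|exact: epspos].
have [fL|nfL] := pselect (lipschitz_continuous setT f); last first.
  have [g hg] := smooth_approx_continuous openT V1o epsp fV fcont.
  exists 1, g; split; [exact: lt0_1|exact: lt1_11|apply: approximates_c1].
  - by move=> x; have [] := hg x I.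
  - by move=> x; rewrite distrC; have [] := hg x I.
  - move=> L L0 fL; exfalso; apply: nfL.
    by apply: (@le_lt_trans _ _ L%:E); [apply: lip_le => // x y _ _; exact: fL|exact: ltry].
  - by move=> x; have [_ _] := hg x I.
  - by move=> /ncf.
have [L [L0 lipL fLip]] := lip_bound fL.
have {}fLip x y : `|f x - f y| <= L * enorm (x - y) by exact: fLip.
(* A constant [f] is C^1 and was treated above. With [L] positive the tolerance can be capped at
   [L], which bounds the derivative by [L + L]. *)
have Lpos : 0 < L.
  rewrite lt_def L0 andbT; apply/eqP => L00; apply: ncf => x.
  apply: (@c1at_near _ _ (fun=> f 0)); last exact: c1at_cst.
  apply: near_all => y; apply/eqP; rewrite -subr_eq0 -normr_le0.
  by apply: le_trans (fLip _ _) _; rewrite L00 mul0r.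
have epsp' : locally_positive setT (fun x => Num.min (eps x) L).
  by apply: locally_positive_min; [exact: epsp|exact: locally_positive_cst].
have [g hg] := smooth_approx_lipschitz openT V1o epsp' fV L0 fLip.
have L2 : 0 <= 2 * L by rewrite mulr_ge0.
have gLip x y : `|g x - g y| <= 2 * L * enorm (x - y).
  apply: (gradient_lipschitz L2) => z; have [cg _ dg _] := hg z I.
  have df := c1at_differentiable cg; split; first exact: df.
  apply: (enorm_gradient_le L2 df) => v; apply: le_trans (ler_norm _) _.
  apply: le_trans (dg v) _; rewrite (ler_wpM2r (enorm_ge0 v))// mulrDl mul1r.
  by rewrite (lerD2l L) ge_min lexx orbT.
have lt2_11 : (2 : R) < 11 by rewrite ltr_nat.
exists 2, g; split; [exact: ltr0Sn|exact: lt2_11|apply: approximates_c1].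
- by move=> x; have [] := hg x I.
- move=> x; rewrite distrC; have [_ h _ _] := hg x I; apply: lt_le_trans h _.
  by rewrite ge_min lexx.
- move=> L' L'0 fL' x y.
  have LL' : L <= L'.
    by rewrite -lee_fin -lipL; apply: lip_le => // a b _ _; exact: fL'.
  apply: le_trans (gLip x y) _.
  by apply: (ler_wpM2r (enorm_ge0 _)); rewrite ler_pM2l.
- by move=> x; have [_ _ _] := hg x I.
- by move=> /ncf.
Qed.

Lemma stratum_disjoint (L M : set 'rV[R]_n) x : A L -> A M -> L x -> M x -> L = M.
Proof. by have [_ [_ tA _] _ _] := Astrat => AL AM Lx Mx; apply: (tA L M AL AM); exists x. Qed.

(** In full dimension the equation takes values in a space of dimension 0, so it kills every
    vector. *)
Lemma tangent_full_dim M x u : manifold 2 n M -> M x -> tangent M x u.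
Proof.
move=> [nn mM] Mx; have [U [F eqF]] := mM x Mx.
exists n, U, F; split => //; first exact: local_equation21.
by apply/rowP => i; case: i => i hi; exfalso; move: hi; rewrite subnn.
Qed.

(** A full-dimensional stratum leaves [g] unchanged. Otherwise [M] lies in [V2], and composing with
    a retraction that is the identity outside [V2] keeps the agreement with [f] there. *)
Lemma approximates_step Bs M kap g : Bs `<=` A -> A M -> ~ Bs M ->
  closed (\bigcup_(L in Bs) L) -> closed (\bigcup_(L in Bs) L `|` M) -> 0 < kap -> kap < 11 ->
  approximates Bs kap g ->
  exists kap' g', [/\ 0 < kap', kap' < 11 & approximates (Bs `|` [set M]) kap' g'].
Proof.
move=> BsA AM nBM Bc BMc kap0 kap11 ag.
have [_ _ mA _] := Astrat.
set B := \bigcup_(L in Bs) L in Bc BMc.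
have [[r0 r0n mM]|full] := pselect (exists2 r, (r < n)%N & manifold 2 r M); last first.
  exists kap, g; split => //; case: ag => *; split => // L [BL|->]; first by auto.
  move=> x Mx; apply: tangent_full_dim => //.
  have [r mM] := mA M AM; have [rn _] := mM.
  have [rn'|rn'] := eqVneq r n; first by move: mM; rewrite rn'.
  by exfalso; apply: full; exists r => //; rewrite ltn_neqAle rn'.
have MB x : M x -> ~ B x.
  by move=> Mx [L BL Lx]; apply: nBM; rewrite -(stratum_disjoint (BsA L BL) AM Lx Mx).
have MV2 : M `<=` V2 by apply: subset_trans lowV2 => x Mx; exists M => //; split => //; exists r0.
case: ag => gclose gloc gdiff glip gtan gsupp gagree gc1.
have gcont x : {for x, continuous g} by exact: differentiable_continuous.
pose e' x := eps x - `|f x - g x|.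
have e'0 x : 0 < e' x by rewrite subr_gt0.
have e'cont x : {for x, continuous e'}.
  have ec : {for x, continuous eps} := @epscont x.
  have fc : {for x, continuous f} := @fcont x.
  exact: (cvgB ec (cvg_norm (cvgB fc (gcont x)))).
(* [e'] is the room left by the current error. A displacement shorter than the distance from [x] to
   [S1 x] changes the value of [g] by less than this room. *)
pose S1 x := [set y | e' x <= `|g y - g x|].
have S1pos : locally_positive setT (fun x => tdist (S1 x) x).
  apply: locally_positive_tdist => x0 _.
  have e4 : 0 < e' x0 / 4 by rewrite divr_gt0.
  have [rho1 rho10 h1] := (continuousR_eballP _ _).1 (gcont x0) _ e4.
  have [rho2 rho20 h2] := (continuousR_eballP _ _).1 (e'cont x0) _ e4.
  exists (Num.min rho1 rho2); first by rewrite lt_min rho10.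
  move=> x y; rewrite !lt_min => /andP[/h1 x1 /h2 x2] /andP[/h1 y1 _].
  rewrite /S1/= => h.
  have := ler_normB (g y - g x0) (g x - g x0); rewrite opprB addrA subrK.
  by move: x2; rewrite ltr_norml => /andP[]; have := e'0 x0; lra.
pose S := supp g; have Sc : closed S by exact: closed_closure.
have V1c : closed (~` V1) by exact: open_closedC.
(* If [x] is closer to the complement of [V1] than to the support, the displacement is less than the
   distance to the support, so [g] vanishes at [r x]. The new support thus lies in the closed set
   [T] below, which is contained in [V1]. *)
pose d2 x := Num.max (tdist S x) (tdist (~` V1) x).
have d2pos : locally_positive setT d2.
  apply: locally_positive_continuous => x _; split.
    by apply: continuous_max; exact: continuous_tdist.
  rewrite /d2 lt_max; have [V1x|nV1x] := pselect (V1 x).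
    by apply/orP; right; apply: tdist_gt0 => //; move/(_ V1x).
  by apply/orP; left; apply: tdist_gt0 => // /gsupp.
pose delta x := Num.min (tdist (S1 x) x) (Num.min (d2 x) (tdist B x)).
have delta1 x : delta x <= tdist (S1 x) x by rewrite ge_min lexx.
have delta2 x : delta x <= d2 x by rewrite !ge_min lexx orbT.
have delta3 x : delta x <= tdist B x by rewrite !ge_min lexx !orbT.
have dpos : locally_positive (~` B) delta.
  apply: locally_positive_min; first by move=> x _; exact: S1pos.
  apply: locally_positive_min; first by move=> x _; exact: d2pos.
  exact: tdist_locally_positive.
(* Chosen so that the new factor is the midpoint of [kap] and 11. *)
pose eta := (11 - kap) / (2 * kap).
have eta0 : 0 < eta by rewrite divr_gt0 ?subr_gt0// mulr_gt0.
have kap_eta : kap * (1 + eta) = (kap + 11) / 2 by rewrite /eta; field; rewrite gt_eqF.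
have [r hr] := retraction_exists Bc mM BMc MB V2o MV2 dpos eta0.
have rd := retr_diff hr.
have rlip := retr_lip hr.
have eta1 : 0 <= 1 + eta by rewrite addr_ge0// ltW.
have gradE x : gradient (fun z => g (r z)) x = tgrad r x (gradient g (r x)).
  by rewrite gradient_gcomp.
have gr x : ~ B x -> `|g (r x) - g x| < e' x.
  move=> nBx; rewrite ltNge; apply/negP => h.
  have := retr_close hr nBx; have := tdist_le x (h : S1 x (r x)).
  by have := delta1 x; rewrite enormC; lra.
have grad_B x : B x -> gradient (fun z => g (r z)) x = gradient g x.
  by move=> Bx; rewrite gradE (retr_fix hr Bx) (retr_tgrad_fix hr _ Bx).
exists (kap * (1 + eta)), (fun x => g (r x)); split; rewrite ?kap_eta; [lra|lra|].
rewrite -kap_eta; split.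
- move=> x; have [Bx|nBx] := pselect (B x); first by rewrite (retr_fix hr Bx).
  have := gr x nBx; rewrite /e' => h; have := ler_normB (f x - g x) (g (r x) - g x).
  by rewrite opprB addrA subrK; lra.
- exact: locally_lipschitz_comp eta1 gloc rlip.
- by move=> x; apply: (differentiable_comp (rd x)).
- move=> L L0 fL x y; apply: le_trans (glip L L0 fL _ _) _.
  apply: (@le_trans _ _ (kap * L * ((1 + eta) * enorm (x - y)))).
    by rewrite ler_wpM2l ?mulr_ge0// ltW.
  by rewrite le_eqVlt; apply/orP; left; apply/eqP; ring.
- move=> L [BL|->] x Lx; last by rewrite gradE; exact: (retr_tangent hr).
  by rewrite grad_B; [exact: gtan|exists L].
- pose T := [set x | tdist S x <= tdist (~` V1) x].
  have Tc : closed T.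
    rewrite (_ : T = (fun x => tdist (~` V1) x - tdist S x) @^-1` [set t | 0 <= t]).
      apply: closed_comp; last exact: closed_ge.
      move=> x _; exact: (cvgB (@continuous_tdist _ _ (~` V1) x) (@continuous_tdist _ _ S x)).
    by apply/funext => x; rewrite /T/= subr_ge0.
  have TV1 : T `<=` V1.
    move=> x; rewrite /T/= => h; apply: contrapT => nV1x.
    have : 0 < tdist S x by apply: tdist_gt0 => // /gsupp.
    by move: h; rewrite (@tdist0 _ _ (~` V1))// => h1 h2; lra.
  apply: subset_trans TV1; apply: subset_trans Tc; apply: closureS => x /=.
  move=> gx; rewrite /T/= leNgt; apply/negP => h.
  have S0 : 0 < tdist S x by apply: le_lt_trans h; exact: tdist_ge0.
  have Sr : S (r x) by apply: subset_closure; exact: gx.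
  have [Bx|nBx] := pselect (B x).
    by move: S0; rewrite tdist0 ?ltxx// -(retr_fix hr Bx).
  have := tdist_le x Sr; have := retr_close hr nBx; have := delta2 x.
  by rewrite /d2 max_l ?(ltW h)// enormC; lra.
- by move=> cf x nV2; rewrite (retr_out hr nV2); exact: gagree.
- move=> wA x0; have cg := gc1 wA.
  have [[L BL Lx0]|nBx0] := pselect (B x0); last first.
    by apply: c1at_gcomp => // i; exact: (retr_c1at hr).
  have Bx0 : B x0 by exists L.
  apply: c1atP; first by apply: near_all => x; exact: (differentiable_comp (rd x)).
  apply: (@near_eq_continuous _ _ _ (fun x => tgrad r x (gradient g (r x)))).
    by apply: near_all => x; rewrite gradE.
  exact: (whitney_gradient_continuous hr delta3 wA (BsA L BL) AM Lx0 Bx0 (gtan L BL x0 Lx0) (cg x0)).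
Qed.

Lemma prec_irreflexive M : M !=set0 -> ~ prec M M.
Proof. by move=> [x Mx] /(_ x Mx)[]. Qed.

(** Only the disjointness of [L] and [P] needs an argument: a common point forces [L = P], and then
    [L] lies in the closure of [M], itself contained in the frontier of [L], which is closed; so [L]
    would meet its own frontier. *)
Lemma prec_trans (L M P : set 'rV[R]_n) : A L -> A M -> A P -> prec L M -> prec M P -> prec L P.
Proof.
have [_ _ mA _] := Astrat.
move=> AL AM AP LM MP.
have cMP : closure M `<=` closure P.
  by apply: subset_trans (@closed_closure _ P); apply: closureS => x /MP[].
move=> x Lx; split; first by apply: cMP; have [] := LM x Lx.
move=> Px; have LP := stratum_disjoint AL AP Lx Px; rewrite -LP in MP.
have [r mL] := mA L AL.
have [cMx _] := LM x Lx.
have : (closure L `\` L) x by apply: (closed_frontier mL); exact: closureS MP x cMx.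
by case.
Qed.

(** The next stratum is minimal for [prec] among those remaining, so its frontier consists of points
    of treated strata and the union stays closed. *)
Lemma approximates_all : exists kap g, [/\ 0 < kap, kap < 11 & approximates A kap g].
Proof.
have [Afin [covA _ ne] mA front] := Astrat.
have [s0 As] := (finite_seqP A).1 Afin.
suff H k (Bs : set (set 'rV[R]_n)) (s : seq (set 'rV[R]_n)) : (size s <= k)%N ->
    Bs `<=` A -> (forall M, A M <-> Bs M \/ M \in s) -> closed (\bigcup_(L in Bs) L) ->
    (exists kap g, [/\ 0 < kap, kap < 11 & approximates Bs kap g]) ->
    exists kap g, [/\ 0 < kap, kap < 11 & approximates A kap g].
  apply: (H (size s0) set0 s0) => //; last exact: approximates_base.
    by move=> M; split=> [|[]//]; rewrite As; [right|].
  by rewrite bigcup_set0; exact: closed0.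
elim: k => [|k IH] in Bs s *.
  rewrite leqn0 size_eq0 => /eqP -> BsA AE _ [kap [g [k0 k11 ag]]].
  exists kap, g; split; [exact: k0|exact: k11|].
  suff -> : A = Bs by [].
  by apply/seteqP; split => // M /AE[].
move=> sk BsA AE Bc ag.
(* [s] may still contain treated strata; [s'] keeps exactly the remaining ones. *)
pose s' := [seq M <- s | `[< ~ Bs M >]].
have s'P M : M \in s' <-> M \in s /\ ~ Bs M.
  rewrite mem_filter; split; first by move=> /andP[/asboolP nB ->].
  by move=> [-> nB]; rewrite andbT; exact/asboolP.
have As' M : M \in s' -> A M by move=> /s'P[Ms _]; apply/AE; right.
have AE' M : A M <-> Bs M \/ M \in s'.
  split=> [|[/BsA//|/As'//]] /AE[|Ms]; first by left.
  by have [|nB] := pselect (Bs M); [left|right; apply/s'P].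
have s'k : (size s' <= k.+1)%N by apply: leq_trans sk; rewrite size_filter count_size.
have [s'0|s'0] := eqVneq s' [::].
  apply: (IH Bs [::]) => // M; rewrite AE' s'0; exact: iff_refl.
have [||M Ms' Mmin] := @seq_minimal _ (@prec R n) s' s'0.
- by move=> a /As' Aa; exact: prec_irreflexive (ne a Aa).
- by move=> a b c /As' Aa /As' Ab /As' Ac; exact: prec_trans.
have AM := As' M Ms'; have [_ nBM] := (s'P M).1 Ms'.
have BMc : closed (\bigcup_(L in Bs) L `|` M).
  rewrite /closed closureU => x [/Bc|cMx]; first by left.
  (* Closedness of [Q] puts the limit point in some stratum [L]. If [L] is not [M], the frontier
     condition gives [prec L M], and minimality of [M] leaves only treated strata. *)
  have : Q x.
    apply: Qclosed; apply: closureS cMx; rewrite -covA => z Mz; exists M => //.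
  rewrite -covA => -[L AL Lx].
  have [LM|LM] := pselect (L = M); first by right; rewrite -LM.
  have pLM : prec L M by apply: front => //; exists x.
  have [BL|] := (AE' L).1 AL; first by left; exists L.
  by move=> /Mmin.
have [kap [g [k0 k11 agg]]] := ag.
apply: (IH (Bs `|` [set M]) [seq L <- s' | L != M]).
- rewrite -ltnS; apply: leq_trans s'k; rewrite size_filter.
  rewrite -(count_predC (pred1 M) s') -[X in (X < _)%N]add0n ltn_add2r -has_count.
  by apply/hasP; exists M => //=.
- by move=> L [/BsA//|->].
- move=> L; rewrite AE' [X in _ <-> _ \/ is_true X]mem_filter; split.
    move=> [BL|Ls]; first by left; left.
    by have [->|LM] := eqVneq L M; [left; right|right; rewrite Ls ?LM].
  by move=> [[BL|->]|/andP[_ Ls]]; [left|right|right].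
- by rewrite bigcup_setU bigcup_set1.
- exact: approximates_step BsA AM nBM Bc BMc k0 k11 agg.
Qed.

End approximation.

Theorem theorem2p4 (R : realType) (n m : nat) (Q : set 'rV[R]_n)
    (A : set (set 'rV[R]_n)) (f eps : 'rV[R]_n -> R) (V1 V2 : set 'rV[R]_n)
    (Qclosed : closed Q)
    (Astrat : stratification 2 Q A)
    (Adepth : depth A m)
    (fcont : continuous f)
    (epscont : continuous eps)
    (epspos : forall x, 0 < eps x)
    (V1nbhs : set_nbhs (supp f) V1)
    (V2nbhs : set_nbhs (low_dim_part 2 A) V2) :
  (exists g : 'rV[R]_n -> R, good_approximation m A f eps V1 V2 g) /\
  (whitney_a A ->
   exists g : 'rV[R]_n -> R,
     good_approximation m A f eps V1 V2 g /\ smooth_on 1 setT g).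
Proof.
have [C1 [C1o fC1 C1V1]] := (set_nbhsP _ _).1 V1nbhs.
have [C2 [C2o lowC2 C2V2]] := (set_nbhsP _ _).1 V2nbhs.
have [kap [g [kap0 kap11 [close loclip diff lipg tan suppg agree c1]]]] :=
  approximates_all Qclosed Astrat fcont epscont epspos C1o fC1 C2o lowC2.
suff good : good_approximation m A f eps V1 V2 g.
  split; first by exists g.
  move=> wA; exists g; split; first exact: good.
  by apply/(smooth_on1P _ openT) => x _; exact: c1 wA x.
split.
- exact: close.
- split; [exact: locally_lipschitzP|exact: diff|].
  move=> /lip_bound[L [L0 lipL fL]].
  have gL : (lip setT g <= (kap * L)%:E)%E.
    apply: lip_le; first by rewrite mulr_ge0// ltW.
    by move=> x y _ _; apply: (lipg L L0) => a b; exact: fL.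
  split; first by apply: le_lt_trans gL _; exact: ltry.
  apply: le_trans gL _; rewrite lipL -EFinM lee_fin ler_wpM2r//.
  (* It remains that [11 <= 11 ^+ m.+1]. *)
  apply: le_trans (ltW kap11) _.
  by rewrite exprS ler_peMr// exprn_ege1// ler1n.
- exact: tan.
- exact: subset_trans suppg C1V1.
- move=> /(smooth_on1P _ openT) cf x nV2; apply: agree; first by move=> y; exact: cf y I.
  by move=> /C2V2.
Qed.
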